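(* Let $T>0$, let $m\ge 1$, let $\alpha_0>\alpha_1>\cdots>\alpha_m\ge 0$ be real numbers, let $n_i$ be the nonnegative integer with $n_i-1<\alpha_i\le n_i$ ($i=0,\dots,m$), and let $\gamma=n_0-\alpha_0$ with $0<\gamma<1$. Assume that $n_0=n_1$ and that $a_i\in C^1_\gamma[0,T]$ and $D_{0+}^{n_0-\alpha_0}a_i\in C[0,T]$ for $i=1,\dots,m$. With $H_j=\{i\in\{1,\dots,m\}:0\le\alpha_i\le j\}$, assume that $n_0\ge2$ and that there exists $j_0\in\{0,1,\dots,n_0-2\}$ such that $H_{j_0}=\emptyset$ and $H_{j_0+1}\ne\emptyset$; for $j\ge j_0+1$ put $h_j=\min H_j$. Let $b_0,\dots,b_{n_0-1}\in\mathbb R$. Then the initial value problem $${}^cD_{0+}^{\alpha_0}y(t)=-\sum_{i=1}^m a_i(t)\,{}^cD_{0+}^{\alpha_i}y(t),\quad 0<t<T;\qquad D^ky(t)|_{t=+0}=b_k,\quad k=0,1,\dots,n_0-1,$$ has a unique solution $y\in C_\gamma^{n_0}[0,T]$, and it is represented as $y(t)=\sum_{j=0}^{n_0-1}b_jy_j(t)$, where $y_j\in C_\gamma^{n_0}[0,T]$, $j=0,1,\dots,n_0-1$, is the canonical fundamental system of solutions of the equation ${}^cD_{0+}^{\alpha_0}y(t)=-\sum_{i=1}^m a_i(t)\,{}^cD_{0+}^{\alpha_i}y(t)$, $0<t<T$, given by $$y_j(t)=\Phi_{j+1}(t),\qquad j=0,1,\dots,j_0,$$ $$y_j(t)=\Phi_{j+1}(t)+\sum_{k=0}^\infty(-1)^{k+1}I_{0+}^{\alpha_0}\Big[\sum_{i=1}^m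 a_i(t)I_{0+}^{\alpha_0-\alpha_i}\Big]^k\sum_{i=h_j}^m a_i(t)\Phi_{j+1-\alpha_i}(t),\qquad j=j_0+1,\dots,n_0-1.$$
   Context: All functions are real valued. For $0\le\gamma<1$, $C_\gamma[0,T]$ is the space of functions $f$ on $(0,T]$ such that $t\mapsto t^\gamma f(t)$ belongs to $C[0,T]$ (i.e. extends continuously to $[0,T]$); $C_0[0,T]=C[0,T]$. For $n\in\mathbb N$, $C^n_\gamma[0,T]$ is the space of functions $f$ that are $n-1$ times continuously differentiable on $[0,T]$ and have an $n$-th derivative $f^{(n)}\in C_\gamma[0,T]$; $C^0_\gamma=C_\gamma$. Riemann–Liouville integral: $I_{0+}^\alpha f(t)=\frac1{\Gamma(\alpha)}\int_0^t(t-\tau)^{\alpha-1}f(\tau)\,d\tau$ for $\alpha>0$, and $I^0_{0+}f=f$. Riemann–Liouville derivative: for $n-1<\alpha\le n$, $D_{0+}^\alpha f(t)=\frac{d^n}{dt^n}I_{0+}^{n-\alpha}f(t)$ for $t>0$ (with $D^0_{0+}f=f$). Caputo derivative: for $n-1<\alpha\le n$, ${}^cD_{0+}^\alpha f(t)=D_{0+}^\alpha\big[f(t)-\sum_{k=0}^{n-1}\frac{f^{(k)}(0)}{k!}t^k\big]$; in particular ${}^cD^0_{0+}f=f$. $D^k=d^k/dt^k$. $\Phi_{\beta}(t)=t^{\beta-1}/\Gamma(\beta)$ for $\beta>0$; thus $\Phi_{j+1}(t)=t^j/j!$, and $\Phi_{j+1-\alpha_i}=D_{0+}^{\alpha_i}\Phi_{j+1}$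 when $\alpha_i\le j$. The bracket $\big[\sum_i a_i(t)I_{0+}^{\alpha_0-\alpha_i}\big]^k$ is the $k$-th power (composition) of the operator $g\mapsto\sum_{i=1}^m a_i\cdot I_{0+}^{\alpha_0-\alpha_i}g$, the $0$-th power being the identity. The infinite series is the limit of its partial sums, for each $t\in[0,T]$. A canonical fundamental system of solutions of the equation is a system of solutions $y_0,\dots,y_{n_0-1}$ with $D^ky_j(t)|_{t=+0}=1$ if $k=j$ and $=0$ if $k\ne j$, for $k,j=0,1,\dots,n_0-1$. *)

(* Defs.v *)
From mathcomp Require Import all_boot all_order all_algebra.
From mathcomp Require Import all_classical all_reals all_analysis.

Set Implicit Arguments.
Unset Strict Implicit.
Unset Printing Implicit Defensive.

Import Order.TTheory GRing.Theory Num.Theory.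
Import numFieldNormedType.Exports.

Local Open Scope classical_set_scope.
Local Open Scope ring_scope.

(* Functions on [0,T] or (0,T] are total functions R -> R of which only the
   values on that interval matter. Derivatives are therefore taken relative to
   [0,T]: two-sided at interior points, one-sided at 0 and at T. As for the
   library's [derive1], the value is unspecified where the limit does not
   exist. *)
Definition dquot {R : realType} (f : R -> R) (t s : R) : R :=
  (f s - f t) / (s - t).

Definition derivable_on {R : realType} (T : R) (f : R -> R) (t : R) : Prop :=
  cvg (dquot f t @ within `[0, T] t^').

Definition deriv_on {R : realType} (T : R) (f : R -> R) (t : R) : R :=
  lim (dquot f t @ within `[0, T] t^').

Definition derivn_on {R : realType} (T : R) (k : nat) (f : R -> R) : R -> R :=
  iter k (deriv_on T) f.

(* C_gamma[0,T]; [C_space 0 T] is C[0,T] for functions given on (0,T] and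
   identified with their continuous extension. *)
Definition C_space {R : realType} (gamma T : R) (f : R -> R) : Prop :=
  exists2 g : R -> R, {within `[0, T], continuous g} &
    forall t : R, 0 < t <= T -> g t = t `^ gamma * f t.

(* The derivative of order p need not be differentiable at 0. *)
Definition Cn_space {R : realType} (n : nat) (gamma T : R) (f : R -> R) : Prop :=
  match n with
  | 0%N => C_space gamma T f
  | p.+1 =>
    [/\ forall k, (k < p)%N -> forall t : R, 0 <= t <= T ->
          derivable_on T (derivn_on T k f) t,
        forall k, (k <= p)%N ->
          {within `[0, T], continuous (derivn_on T k f)},
        forall t : R, 0 < t <= T -> derivable_on T (derivn_on T p f) t &
        C_space gamma T (derivn_on T p.+1 f)]
  end.

Definition Gamma {R : realType} (x : R) : R :=
  (\int[lebesgue_measure]_(t in `]0%R, +oo[) (t `^ (x - 1) * expR (- t)))%R.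

(* [0 `^ 0 = 1], so [Phi 1] is the constant 1, also at 0. *)
Definition Phi {R : realType} (beta t : R) : R := t `^ (beta - 1) / Gamma beta.

Definition RLint {R : realType} (alpha : R) (f : R -> R) : R -> R :=
  if alpha == 0 then f else fun t =>
    ((Gamma alpha)^-1 *
     \int[lebesgue_measure]_(s in `[0%R, t]) ((t - s) `^ (alpha - 1) * f s))%R.

(* For alpha >= 0, the natural number n such that n - 1 < alpha <= n. *)
Definition order_of {R : realType} (alpha : R) : nat := absz (Num.ceil alpha).

(* Meaningful at 0 < t <= T, where it only depends on f on (0,T]. *)
Definition RLderiv {R : realType} (T alpha : R) (f : R -> R) : R -> R :=
  derivn_on T (order_of alpha) (RLint ((order_of alpha)%:R - alpha) f).

(* If f is in [Cn_space n gamma T] with gamma < 1 and [order_of alpha <= n], all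
   the derivatives occurring here exist on (0,T]. *)
Definition Caputo {R : realType} (T alpha : R) (f : R -> R) : R -> R :=
  RLderiv T alpha (fun t =>
    f t - \sum_(0 <= k < order_of alpha) derivn_on T k f 0 / k`!%:R * t ^+ k).

Section Equation.
Context {R : realType}.
Variables (T : R) (m : nat) (alpha : nat -> R) (a : nat -> R -> R).

Definition solves_eq (y : R -> R) : Prop := forall t : R, 0 < t < T ->
  Caputo T (alpha 0%N) y t =
  - \sum_(1 <= i < m.+1) a i t * Caputo T (alpha i) y t.

Definition init_cond (n0 : nat) (b : nat -> R) (y : R -> R) : Prop :=
  forall k, (k < n0)%N -> derivn_on T k y t @[t --> 0^'+] --> b k.

Definition canonical_system (n0 : nat) (gamma : R) (ys : nat -> R -> R) : Prop :=
  forall j, (j < n0)%N ->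
    [/\ Cn_space n0 gamma T (ys j), solves_eq (ys j) &
        init_cond n0 (fun k => (k == j)%:R) (ys j)].

Definition Hset (j : nat) : seq nat :=
  [seq i <- index_iota 1 m.+1 | 0 <= alpha i <= j%:R].

(* The minimum of [Hset j] when it is nonempty, as its elements are <= m. *)
Definition hmin (j : nat) : nat := \big[minn/m]_(i <- Hset j) i.

Definition bracket (g : R -> R) : R -> R := fun t =>
  \sum_(1 <= i < m.+1) a i t * RLint (alpha 0%N - alpha i) g t.

Definition sol_term (j : nat) (t : R) (k : nat) : R :=
  (-1) ^+ k.+1 * RLint (alpha 0%N) (iter k bracket (fun s =>
    \sum_(hmin j <= i < m.+1) a i s * Phi (j.+1%:R - alpha i) s)) t.

Definition sol (j0 j : nat) (t : R) : R :=
  if (j <= j0)%N then Phi j.+1%:R t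
  else Phi j.+1%:R t + limn (series (sol_term j t)).

End Equation.

(* Main.v *)
Require Import Defs.
From mathcomp Require Import all_boot all_order all_algebra.
From mathcomp Require Import all_classical all_reals all_analysis.
From mathcomp Require Import measurable_realfun ring lra.
Import Order.TTheory GRing.Theory Num.Theory.
Import numFieldNormedType.Exports.
Local Open Scope classical_set_scope.
Local Open Scope ring_scope.

Set Implicit Arguments.
Unset Strict Implicit.
Unset Printing Implicit Defensive.

(** The unknown is u = y^(n0), so that y is the Taylor polynomial of its initial values plus
    I^n0 u. With g = n0 - alpha_0 and delta_i = alpha_0 - alpha_i, the equation becomes
      I^g u = - sum_i a_i (c_i + I^(g + delta_i) u),
    where c_i is a combination of functions Phi given by the initial values. As a_i' = O(t^-g),
    each a_i I^(g + delta_i) u is itself I^g of a function of u, linear and again O(t^-g).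
    Since I^g is injective (Abel's equation), the problem is equivalent to a fixed point
    equation u = - f - L u in the space of functions that are continuous on (0, X) and O(t^-g).
    There L is a contraction for the weight t^-g exp(lam t) with lam large, which gives
    existence and uniqueness, and applying I^n0 to the Neumann series of u term by term gives
    the series of the statement. *)

Section Integrals.
Context {R : realType}.
Local Notation mu := (@lebesgue_measure R).
Local Notation TR := (measurableTypeR R).

Lemma cont_oo_measurable (a b : R) (f : R -> R) :
  (forall x, a < x < b -> {for x, continuous f}) -> measurable_fun `]a, b[ f.
Proof.
move=> cf; apply: open_continuous_measurable_fun; first exact: interval_open.
by move=> x /set_mem/=; rewrite in_itv/=; exact: cf.
Qed.

Lemma affine_preimage_itv (a c : R) (i j : bool) (x y : R) : 0 < c ->
  (fun z => a + c * z) @^-1` [set` Interval (BSide i x) (BSide j y)] =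
  [set` Interval (BSide i ((x - a) / c)) (BSide j ((y - a) / c))].
Proof.
move=> c0; apply/seteqP; split=> z /=; rewrite !in_itv/= (addrC a) (mulrC c);
  case: i; case: j; rewrite /=
    ?ler_pdivrMr// ?ltr_pdivrMr// ?ler_pdivlMr// ?ltr_pdivlMr//;
  by rewrite ?lerBlDr ?ltrBlDr ?lerBrDr ?ltrBrDr.
Qed.

Lemma ge0_integral_affine (a c : R) (D : set R) (f : R -> \bar R) : 0 < c ->
  measurable D -> measurable_fun D f -> (forall x, D x -> (0 <= f x)%E) ->
  (\int[mu]_(x in D) f x =
   c%:E * \int[mu]_(z in (fun z => a + c * z)%R @^-1` D) f (a + c * z)%R)%E.
Proof.
move=> c0 mD mf f0.
pose phi : measurableTypeR R -> measurableTypeR R := fun z => a + c * z.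
have mphi : measurable_fun setT phi.
  by apply: measurable_funD => //; exact: measurable_funM.
have [nu nuE] : exists nu : {measure set TR -> \bar R}, nu = pushforward mu phi :> (set TR -> \bar R).
  by unshelve eexists; [exact: [the measure TR R of pushforward mu phi]|].
pose k : {nonneg R} := NngNum (ltW c0).
have H A : measurable A -> mu A = mscale k nu A.
  move=> mA; apply: lebesgue_measure_unique => //= _ [[x y]] _ <-.
  rewrite /mscale/= nuE /pushforward affine_preimage_itv//.
  rewrite !lebesgue_measure_itv/= !lte_fin ltr_pM2r ?invr_gt0// ltrD2r.
  case: ifP => _; last by rewrite mule0.
  by rewrite -!EFinD -EFinM; congr EFin; field; rewrite gt_eqF.
transitivity (\int[mscale k nu]_(x in D) f x)%E.
  by apply: eq_measure_integral => /= A mA _; exact: H.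
rewrite ge0_integral_mscale//; congr (_ * _)%E.
by rewrite nuE ge0_integral_pushforward// => y /set_mem; exact: f0.
Qed.

Lemma gt0_EFin_muleBr (c : R) (x y : \bar R) : 0 < c ->
  (c%:E * (x - y) = c%:E * x - c%:E * y)%E.
Proof.
move=> c0; case: x => [x||]; case: y => [y||] //=;
  rewrite ?(gt0_muley, gt0_muleNy) ?lte_fin//=; rewrite ?(gt0_muley, gt0_muleNy) ?lte_fin//=.
by rewrite -EFinB -!EFinM -EFinB mulrBr.
Qed.

Lemma gt0_fineM (c : R) (x : \bar R) : 0 < c -> fine (c%:E * x)%E = c * fine x.
Proof.
by move=> c0; case: x => [x||] //=; rewrite ?gt0_muley ?gt0_muleNy ?lte_fin//= mulr0.
Qed.

Lemma integral_affine (a c : R) (D : set R) (f : R -> R) : 0 < c ->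
  measurable D -> measurable_fun D f ->
  \int[mu]_(x in D) f x =
   c * \int[mu]_(z in (fun z => a + c * z)%R @^-1` D) f (a + c * z)%R.
Proof.
move=> c0 mD mf; have mf' : measurable_fun D (EFin \o f) by exact/measurable_EFinP.
rewrite /Rintegral integralE.
rewrite (@ge0_integral_affine a c)//; last exact: measurable_funepos.
rewrite (@ge0_integral_affine a c D ((EFin \o f)^\-)%E)//; last exact: measurable_funeneg.
rewrite -gt0_EFin_muleBr// gt0_fineM// [in RHS]integralE.
by congr (_ * fine _); congr (_ - _)%E; apply: eq_integral => z _;
  rewrite ?funeposE ?funenegE.
Qed.

Lemma integral_dep_swap (A : set R) (B : R -> set R) (A' : set R) (B' : R -> set R)
    (f : TR -> TR -> \bar R) :
  (forall t s, (A t /\ B t s) <-> (A' s /\ B' s t)) ->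
  let D : set (TR * TR) := [set z | A z.1 /\ B z.1 z.2] in
  measurable D ->
  measurable_fun D (fun z => f z.1 z.2) ->
  (forall t s, A t -> B t s -> (0 <= f t s)%E) ->
  (\int[mu]_(t in A) \int[mu]_(s in B t) f t s =
   \int[mu]_(s in A') \int[mu]_(t in B' s) f t s)%E.
Proof.
move=> AB D mD mf f0.
pose g : TR * TR -> \bar R := (fun z => f z.1 z.2) \_ D.
have mg : measurable_fun setT g by apply: (measurable_restrictT _ _).1.
have g0 z : (0 <= g z)%E.
  by rewrite /g patchE; case: ifPn => // /set_mem[]; exact: f0.
have := @fubini_tonelli _ _ _ _ _ mu mu g mg g0.
move=> H; rewrite [LHS]integral_mkcond [RHS]integral_mkcond.
transitivity (\int[mu]_t \int[mu]_s g (t, s))%E; last rewrite H;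
  apply: eq_integral => t _; rewrite patchE; case: ifPn => tA.
- rewrite integral_mkcond; apply: eq_integral => s _; rewrite /g !patchE.
  have -> : ((t, s) \in D) = (s \in B t).
    apply/idP/idP => /set_mem h; apply/mem_set; first by case: h.
    by split => //; exact/set_mem.
  by [].
- rewrite integral0_eq// => s _; rewrite /g patchE memNset//=.
  by case=> /= /mem_set + _; rewrite (negbTE tA).
- rewrite [RHS]integral_mkcond; apply: eq_integral => s _; rewrite /g !patchE.
  have -> : ((s, t) \in D) = (s \in B' t).
    apply/idP/idP => /set_mem h; apply/mem_set; first by case/AB: h.
    by apply/AB; split => //; exact/set_mem.
  by [].
- rewrite integral0_eq// => s _; rewrite /g patchE memNset//=.
  by move/AB => -[/mem_set + _]; rewrite (negbTE tA).
Qed.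

Lemma Rintegral_fubini (g : TR * TR -> R) :
  (mu \x mu)%E.-integrable setT (EFin \o g) ->
  \int[mu]_t \int[mu]_s g (t, s) = \int[mu]_s \int[mu]_t g (t, s).
Proof.
move=> ig; rewrite /Rintegral; congr fine.
have mF := measurable_fubini_F ig; have mG := measurable_fubini_G ig.
transitivity (\int[mu]_t \int[mu]_s (g (t, s))%:E)%E.
  apply: ae_eq_integral => //.
    by apply/measurable_EFinP; apply: measurableT_comp => //; exact: measurable_fine.
  apply: filterS (ae_integrable1 ig) => t /= it _; rewrite fineK//.
  exact: integrable_fin_num it.
rewrite (Fubini ig); apply/esym; apply: ae_eq_integral => //.
  by apply/measurable_EFinP; apply: measurableT_comp => //; exact: measurable_fine.
apply: filterS (ae_integrable2 ig) => t /= it _; rewrite fineK//.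
exact: integrable_fin_num it.
Qed.

Lemma Rintegral_dep_swap (A : set R) (B : R -> set R) (A' : set R) (B' : R -> set R)
    (f : TR -> TR -> R) :
  (forall t s, (A t /\ B t s) <-> (A' s /\ B' s t)) ->
  let D : set (TR * TR) := [set z | A z.1 /\ B z.1 z.2] in
  measurable D ->
  measurable_fun D (fun z => f z.1 z.2) ->
  (\int[mu]_(t in A) \int[mu]_(s in B t) (`|f t s|)%:E < +oo)%E ->
  \int[mu]_(t in A) \int[mu]_(s in B t) f t s =
  \int[mu]_(s in A') \int[mu]_(t in B' s) f t s.
Proof.
move=> AB D mD mf foo.
pose g : TR * TR -> R := (fun z => f z.1 z.2) \_ D.
have mg : measurable_fun setT g by apply: (measurable_restrictT _ _).1.
have DB t s : t \in A -> ((t, s) \in D) = (s \in B t).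
  move=> tA; apply/idP/idP => /set_mem h; apply/mem_set; first by case: h.
  by split => //; exact/set_mem.
have DB' t s : s \in A' -> ((t, s) \in D) = (t \in B' s).
  move=> sA; apply/idP/idP => /set_mem h; apply/mem_set; first by case/AB: h.
  by apply/AB; split => //; exact/set_mem.
have g0 t s : t \notin A -> g (t, s) = 0.
  move=> tA; rewrite /g patchE memNset//=.
  by case=> /= /mem_set + _; rewrite (negbTE tA).
have g0' t s : s \notin A' -> g (t, s) = 0.
  move=> tA; rewrite /g patchE memNset//=.
  by move/AB => -[/mem_set + _]; rewrite (negbTE tA).
have ig : (mu \x mu)%E.-integrable setT (EFin \o g).
  apply/integrable12ltyP; first exact/measurable_EFinP.
  apply: le_lt_trans foo; rewrite [leRHS]integral_mkcond le_eqVlt; apply/orP; left; apply/eqP.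
  apply: eq_integral => t _; rewrite patchE; case: ifPn => tA.
    rewrite [RHS]integral_mkcond; apply: eq_integral => s _ /=.
    by rewrite /g !patchE DB//; case: ifPn => // _; rewrite /= normr0.
  by rewrite integral0_eq// => s _ /=; rewrite g0//= normr0.
rewrite [LHS]Rintegral_mkcond [RHS]Rintegral_mkcond.
transitivity (\int[mu]_t \int[mu]_s g (t, s)); last rewrite Rintegral_fubini//;
  apply: eq_Rintegral => t _; rewrite patchE; case: ifPn => tA.
- by rewrite Rintegral_mkcond; apply: eq_Rintegral => s _; rewrite /g !patchE DB.
- by rewrite /Rintegral integral0_eq// => s _; rewrite g0.
- by rewrite [RHS]Rintegral_mkcond; apply: eq_Rintegral => s _; rewrite /g !patchE DB'.
- by rewrite /Rintegral integral0_eq// => s _; rewrite g0'.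
Qed.

Lemma ge0_integral_oo_le (a b m M : R) (F f : R -> R) : a < b ->
  (forall x, a < x < b -> is_derive x 1 F (f x)) ->
  (forall x, a < x < b -> {for x, continuous f}) ->
  (forall x, a < x < b -> 0 <= f x) ->
  (forall x, a < x < b -> m <= F x <= M) ->
  (\int[mu]_(x in `]a, b[) (f x)%:E <= (M - m)%:E)%E.
Proof.
move=> ab dF cf f0 FmM.
pose e n : R := (b - a) / n.+3%:R.
have ba0 : 0 < b - a by rewrite subr_gt0.
have e0 n : 0 < e n by rewrite divr_gt0.
have e3 n : e n <= (b - a) / 3.
  by rewrite ler_pM2l// lef_pV2 ?posrE// ler_nat.
pose I n : set TR := `[a + e n, b - e n]%classic.
have sub n x : I n x -> a < x < b.
  rewrite /I/= in_itv/= => /andP[h1 h2]; have := e0 n.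
  by move=> h; apply/andP; split; lra.
have ndI : nondecreasing_seq I.
  move=> i j ij; apply/subsetPset => x; rewrite /I/= !in_itv/= => /andP[h1 h2].
  have : e j <= e i by rewrite ler_pM2l// lef_pV2 ?posrE// ler_nat.
  by move=> h; apply/andP; split; lra.
have UI : \bigcup_n I n = `]a, b[%classic.
  apply/seteqP; split=> [x [n _ /sub]|x]; rewrite /= in_itv//= => /andP[h1 h2].
  have [n hn] : exists n, e n < Num.min (x - a) (b - x).
    have c0 : 0 < Num.min (x - a) (b - x) by rewrite lt_min !subr_gt0 h1.
    exists (Num.truncn ((b - a) / Num.min (x - a) (b - x))).
    rewrite ltr_pdivrMr// mulrC -ltr_pdivrMr//.
    apply: (lt_le_trans (truncnS_gt _)); by rewrite ler_nat -addn2 leq_addr.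
  exists n => //; move: hn; rewrite lt_min /I/= in_itv/= => /andP[h3 h4].
  by apply/andP; split; lra.
have mI n : measurable (I n) by exact: measurable_itv.
have mf n : measurable_fun (I n) (EFin \o f).
  apply/measurable_EFinP; apply: (@measurable_funS _ _ _ _ `]a, b[) => //.
    by move=> x /sub; rewrite /= in_itv.
  exact: cont_oo_measurable.
have := @ge0_nondecreasing_set_cvg_integral _ TR _ I (EFin \o f) mu ndI mI mf.
rewrite UI => /(_ _)/cvg_lim <-//; last first.
  by move=> n x /sub h; rewrite lee_fin f0.
apply: lime_le.
  apply: ereal_nondecreasing_is_cvgn; apply: ge0_nondecreasing_set_nondecreasing_integral => //.
  by move=> n x /sub h; rewrite lee_fin f0.
apply: nearW => n.
have ee : a + e n < b - e n by have := e3 n; lra.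
have subo x : x \in `]a + e n, b - e n[ -> a < x < b.
  by move=> h; apply: (sub n); move: h; rewrite /I/= !in_itv/= => /andP[h1 h2]; rewrite !ltW.
have h1 : a < a + e n < b by have := e0 n; have := e3 n; move=> ? ?; apply/andP; split; lra.
have h2 : a < b - e n < b by have := e0 n; have := e3 n; move=> ? ?; apply/andP; split; lra.
have cF x : a < x < b -> {for x, continuous F}.
  by move=> /dF h; apply: differentiable_continuous; apply/derivable1_diffP.
rewrite (@continuous_FTC2 _ f F)//.
- rewrite -EFinB lee_fin; have /andP[? ?] := FmM _ h1; have /andP[? ?] := FmM _ h2; lra.
- apply/continuous_within_itvP => //; split.
  + by move=> x /subo; exact: cf.
  + by apply: cvg_at_right_filter; exact: cf.
  + by apply: cvg_at_left_filter; exact: cf.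
- split.
  + by move=> x /subo/dF[].
  + by apply: cvg_at_right_filter; exact: cF.
  + by apply: cvg_at_left_filter; exact: cF.
- by move=> x /subo/dF h; rewrite derive1E derive_val.
Qed.

End Integrals.

(** * Gamma function and Beta integral *)

Section GammaBeta.
Context {R : realType}.
Local Notation mu := (@lebesgue_measure R).
Local Notation TR := (measurableTypeR R).

Lemma powR_le_expR (p x : R) : 0 < p -> 0 < x -> x `^ p <= p `^ p * expR x.
Proof.
move=> p0 x0; rewrite /powR !gt_eqF// -expRD ler_expR.
have -> : ln x = ln (x / p) + ln p.
  by rewrite ln_div ?posrE// subrK.
rewrite mulrDr addrC lerD2l.
have xp : 0 < x / p by rewrite divr_gt0.
have h1 : ln (x / p) <= x / p - 1.
  by rewrite -{1}(subrK 1 (x / p)) addrC le_ln1Dx// ltrBrDr addNr.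
rewrite (le_trans (ler_wpM2l (ltW p0) h1))//.
by rewrite mulrBr mulr1 mulrC divfK ?gt_eqF// lerBlDr lerDl ltW.
Qed.

Lemma powRD_gt0 (x p q : R) : 0 < x -> x `^ (p + q) = x `^ p * x `^ q.
Proof. by move=> x0; rewrite powRD// (gt_eqF x0) implybT. Qed.

Lemma measurable_powRM (d : measure_display) (T : measurableType d) (D : set T)
    (f g : T -> R) (p : R) :
  measurable_fun D f -> measurable_fun D g ->
  measurable_fun D (fun z => f z `^ p * g z).
Proof.
move=> mf mg; apply: measurable_funM => //.
exact: (measurableT_comp (measurable_powR p)).
Qed.

Lemma measurable_triangle : measurable [set z : TR * TR | 0 < z.2 < z.1].
Proof.
have -> : [set z : TR * TR | 0 < z.2 < z.1] =
    [set z : TR * TR | 0 < z.2] `&` [set z : TR * TR | z.2 < z.1].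
  by apply/seteqP; split=> z /=; [move/andP|move=> [? ?]; apply/andP].
by apply: measurableI; rewrite -[X in measurable X]setTI;
  [have := @measurable_fun_ltr _ (TR * TR)%type R setT (cst 0) snd|
   have := @measurable_fun_ltr _ (TR * TR)%type R setT snd fst];
  move=> /(_ _ _ measurableT [set true] _); rewrite preimage_true; apply.
Qed.

Lemma integral_expRN_div (c : R) : 0 < c ->
  (\int[mu]_(x in `[0%R, +oo[) (expR (- (x / c)))%:E = c%:E)%E.
Proof.
move=> c0; rewrite (@ge0_continuous_FTC2y _ _ (fun x => - c * expR (- (x / c))) _ 0).
- by rewrite mul0r oppr0 expR0 mulr1 sub0e -EFinN opprK.
- by move=> x _; exact: expR_ge0.
- apply: continuous_subspaceT => x; apply: continuous_comp; last exact: continuous_expR.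
  by apply: cvgN; apply: cvgM => //; exact: cvg_cst.
- rewrite -[X in _ --> X](mulr0 (- c)); apply: cvgM; first exact: cvg_cst.
  apply: (@cvg_comp _ _ _ (fun x : R => x / c) (fun x => expR (- x)) _ _ _ _ (@cvgr_expR R)).
  by apply: gt0_cvgMly => //; rewrite invr_gt0.
- by move=> x _; exact: ex_derive.
- apply: cvg_at_right_filter; apply: cvgM; first exact: cvg_cst.
  apply: continuous_cvg; first exact: continuous_expR.
  by apply: cvgN; apply: cvgM => //; exact: cvg_cst.
- move=> x _; rewrite derive1E derive_val /GRing.scale/=.
  by field; rewrite gt_eqF.
Qed.

Lemma is_derive_powR_div (p x : R) : 0 < p -> 0 < x ->
  is_derive x 1 (fun t => t `^ p / p) (x `^ (p - 1)).
Proof.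
move=> p0 x0; have h := @is_derive1_powR R p x x0.
apply: is_derive_eq; rewrite /GRing.scale/=; field.
by rewrite gt_eqF.
Qed.

Lemma continuous_powR_gt0 (p x : R) : 0 < x -> {for x, continuous (fun t => t `^ p)}.
Proof.
move=> x0; apply: differentiable_continuous; apply/derivable1_diffP.
by have [] := @is_derive1_powR R p x x0.
Qed.

Lemma Gamma_lty (p : R) : 0 < p ->
  (\int[mu]_(t in `]0%R, +oo[) (t `^ (p - 1) * expR (- t))%:E < +oo)%E.
Proof.
move=> p0.
have mG (D : set R) : measurable D -> measurable_fun D (fun t => (t `^ (p - 1) * expR (- t))%:E).
  move=> mD; apply/measurable_EFinP; apply: measurable_powRM => //.
  by apply: measurableT_comp => //; exact: measurable_funN.
have -> : `]0%R, +oo[%classic = `]0%R, 1%R[ `|` `[1%R, +oo[ :> set R.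
  by rewrite -itv_bndbnd_setU// bnd_simp.
rewrite ge0_integral_setU//=; last 3 first.
- by apply: mG; exact: measurableU.
- by move=> t _; rewrite lee_fin mulr_ge0 ?powR_ge0 ?expR_ge0.
- apply/disj_setPS => t [/=]; rewrite !in_itv/= => /andP[_ h1] /andP[h2 _].
  by move: (lt_le_trans h1 h2); rewrite ltxx.
apply: lte_add_pinfty.
  have h : (\int[mu]_(t in `]0%R, 1%R[) (t `^ (p - 1))%:E <= (p^-1 - 0)%:E)%E.
    apply: (@ge0_integral_oo_le _ _ _ _ _ (fun t => t `^ p / p)) => //.
    - by move=> x /andP[x0 _]; exact: is_derive_powR_div.
    - by move=> x /andP[x0 _]; exact: continuous_powR_gt0.
    - by move=> x _; exact: powR_ge0.
    - move=> x /andP[x0 x1]; apply/andP; split; first by rewrite divr_ge0 ?powR_ge0 ?ltW.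
      rewrite ler_pdivrMr// mulVf ?gt_eqF//.
      apply: (@le_trans _ _ (1 `^ p)); last by rewrite powR1.
      by rewrite ge0_ler_powR ?nnegrE ?ltW.
  apply: le_lt_trans (ltry (p^-1 - 0)); apply: le_trans h; apply: ge0_le_integral => //.
  - by move=> t _; rewrite lee_fin mulr_ge0 ?powR_ge0 ?expR_ge0.
  - exact: mG.
  - by apply/measurable_EFinP/measurable_funTS; exact: measurable_powR.
  - move=> t; rewrite /= in_itv/= => /andP[t0 _].
    by rewrite lee_fin ler_piMr ?powR_ge0// -expR0 ler_expR oppr_le0 ltW.
apply: (@le_lt_trans _ _ (((2 * p) `^ p)%:E * 2%:E)%E); last by rewrite -EFinM ltry.
rewrite -(integral_expRN_div (@ltr0n R 2)) -ge0_integralZl//=; last 2 first.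
- apply/measurable_EFinP/measurableT_comp => //; apply: measurable_funN => //.
  exact: measurable_funM.
- by rewrite lee_fin powR_ge0.
apply: (@le_trans _ _ (\int[mu]_(x in `[1%R, +oo[) (((2 * p) `^ p)%:E * (expR (- (x / 2)))%:E))%E).
  apply: ge0_le_integral => //.
  - by move=> t _; rewrite lee_fin mulr_ge0 ?powR_ge0 ?expR_ge0.
  - exact: mG.
  - apply/measurable_EFinP; apply: measurable_funM => //; apply: measurableT_comp => //.
    by apply: measurable_funN; exact: measurable_funM.
  - move=> t; rewrite /= in_itv/= andbT => t1; rewrite lee_fin.
    have t0 : 0 < t by lra.
    have th : 0 < t / 2 by lra.
    apply: (@le_trans _ _ (t `^ p * expR (- t))).
      rewrite ler_wpM2r ?expR_ge0// ler_powR//; lra.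
    have -> : t = 2 * (t / 2) by lra.
    move: (t / 2) th => y y0; have y0' := ltW y0; have p0' := ltW p0.
    rewrite !powRM// -!mulrA ler_wpM2l ?powR_ge0//.
    apply: (le_trans (ler_wpM2r (expR_ge0 _) (powR_le_expR p0 y0))).
    rewrite -mulrA -expRD ler_wpM2l ?powR_ge0// ler_expR; lra.
apply: ge0_subset_integral => //.
- apply/measurable_EFinP; apply: measurable_funM => //; apply: measurableT_comp => //.
  by apply: measurable_funN; exact: measurable_funM.
- by move=> t _; rewrite lee_fin mulr_ge0 ?powR_ge0 ?expR_ge0.
- by move=> x /=; rewrite !in_itv/= !andbT; lra.
Qed.

Lemma Gamma_fin_num (p : R) : 0 < p ->
  (\int[mu]_(t in `]0%R, +oo[) (t `^ (p - 1) * expR (- t))%:E = (Gamma p)%:E)%E.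
Proof.
move=> p0; rewrite /Gamma /Rintegral fineK// ge0_fin_numE ?Gamma_lty//.
by apply: integral_ge0 => t _; rewrite lee_fin mulr_ge0 ?powR_ge0 ?expR_ge0.
Qed.

Lemma Gamma_gt0 (p : R) : 0 < p -> 0 < Gamma p.
Proof.
move=> p0; rewrite -lte_fin -Gamma_fin_num//.
have h t : 1 < t < 2 -> Num.min 1 (2 `^ (p - 1)) * expR (- 2) <= t `^ (p - 1) * expR (- t).
  move=> /andP[t1 t2]; apply: ler_pM; rewrite ?expR_ge0 ?le_min ?powR_ge0 ?ler01 ?ler_expR//; last lra.
  have [p1|p1] := leP 1 p.
    by rewrite ge_min; apply/orP; left; rewrite -[leLHS](powRr0 t) ler_powR ?subr_ge0// ltW.
  rewrite ge_min; apply/orP; right; rewrite -(opprK (p - 1)) !(powRN _ (- (p - 1))).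
  rewrite lef_pV2 ?posrE ?powR_gt0//; last lra.
  rewrite ge0_ler_powR ?nnegrE; lra.
have c0 : 0 < Num.min 1 (2 `^ (p - 1)) * expR (- 2) :> R.
  by rewrite mulr_gt0 ?expR_gt0// lt_min ltr01 powR_gt0.
apply: (@lt_le_trans _ _ (\int[mu]_(t in `]1%R, 2%R[) (cst (Num.min 1 (2 `^ (p - 1)) * expR (- 2))%:E) t)%E).
  rewrite integral_cst//= lebesgue_measure_itv/= lte_fin ltr1n -EFinD -EFinM lte_fin.
  by rewrite mulr_gt0//; lra.
have mG (D : set R) : measurable D -> measurable_fun D (fun t => (t `^ (p - 1) * expR (- t))%:E).
  move=> mD; apply/measurable_EFinP; apply: measurable_powRM => //.
  by apply: measurableT_comp => //; exact: measurable_funN.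
apply: (@le_trans _ _ (\int[mu]_(t in `]1%R, 2%R[) (t `^ (p - 1) * expR (- t))%:E)%E).
  apply: ge0_le_integral => //.
  - by move=> t _; rewrite lee_fin ltW.
  - exact: mG.
apply: ge0_subset_integral => //.
- exact: mG.
- by move=> t _; rewrite lee_fin mulr_ge0 ?powR_ge0 ?expR_ge0.
- by move=> x /=; rewrite !in_itv/= !andbT => /andP[]; lra.
Qed.

Definition eBeta (p q : R) : \bar R :=
  (\int[mu]_(s in `]0%R, 1%R[) ((1 - s) `^ (p - 1) * s `^ (q - 1))%:E)%E.

Lemma integral_beta_kernel (p q s x : R) : s < x ->
  (\int[mu]_(t in `]s, x[) ((x - t) `^ (p - 1) * (t - s) `^ (q - 1))%:E =
   ((x - s) `^ (p + q - 1))%:E * eBeta p q)%E.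
Proof.
move=> sx; have c0 : 0 < x - s by rewrite subr_gt0.
have mk : measurable_fun `]s, x[ (fun t => ((x - t) `^ (p - 1) * (t - s) `^ (q - 1))%:E).
  apply/measurable_EFinP; apply: measurable_powRM; first exact: measurable_funB.
  apply: (measurableT_comp (measurable_powR _)); exact: measurable_funB.
rewrite (ge0_integral_affine s c0 (measurable_itv _) mk); last first.
  by move=> t _; rewrite lee_fin mulr_ge0 ?powR_ge0.
have -> : (fun z => s + (x - s) * z) @^-1` `]s, x[ = `]0, 1[%classic.
  by rewrite affine_preimage_itv// subrr mul0r divff ?gt_eqF.
have -> : (x - s) `^ (p + q - 1) = (x - s) * ((x - s) `^ (p - 1) * (x - s) `^ (q - 1)).
  rewrite -powRD_gt0// -{2}[x - s](powRr1 (ltW c0)) -powRD_gt0//.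
  by congr (_ `^ _); ring.
rewrite EFinM -muleA; congr (_ * _)%E.
rewrite /eBeta -ge0_integralZl//=; last 3 first.
- apply/measurable_EFinP; apply: measurable_powRM; first exact: measurable_funB.
  by apply: measurable_funTS; exact: measurable_powR.
- by move=> t _; rewrite lee_fin mulr_ge0 ?powR_ge0.
- by rewrite lee_fin mulr_ge0 ?powR_ge0.
apply: eq_integral => t; rewrite inE/= in_itv/= => /andP[t0 t1].
rewrite -EFinM; congr EFin.
have -> : x - (s + (x - s) * t) = (x - s) * (1 - t) by ring.
have -> : s + (x - s) * t - s = (x - s) * t by ring.
rewrite !powRM ?ltW// ?subr_gt0//; ring.
Qed.

Lemma eBeta_Gamma (p q : R) : 0 < p -> 0 < q ->
  (eBeta p q * (Gamma (p + q))%:E = (Gamma p)%:E * (Gamma q)%:E)%E.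
Proof.
move=> p0 q0; have pq0 : 0 < p + q by rewrite addr_gt0.
have B0 : (0 <= eBeta p q)%E.
  by apply: integral_ge0 => t _; rewrite lee_fin mulr_ge0 ?powR_ge0.
pose f (z s : TR) : \bar R := ((z - s) `^ (p - 1) * (s `^ (q - 1) * expR (- z)))%:E.
have mfst : measurable_fun setT (fst : TR * TR -> TR) by exact: measurable_fst.
have msnd : measurable_fun setT (snd : TR * TR -> TR) by exact: measurable_snd.
transitivity (\int[mu]_(z in `]0%R, +oo[) \int[mu]_(s in `]0%R, z[) f z s)%E.
  rewrite -Gamma_fin_num// -ge0_integralZl//; last 2 first.
  - apply/measurable_EFinP; apply: measurable_powRM => //.
    by apply: measurableT_comp => //; exact: measurable_funN.
  - by move=> t _; rewrite lee_fin mulr_ge0 ?powR_ge0 ?expR_ge0.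
  apply: eq_integral => z; rewrite inE/= in_itv/= andbT => z0.
  rewrite EFinM muleA -{1}[z]subr0.
  rewrite [X in (X * _)%E]muleC -integral_beta_kernel// -ge0_integralZr//; last 2 first.
  - apply/measurable_EFinP; apply: measurable_powRM; first exact: measurable_funB.
    apply: (measurableT_comp (measurable_powR _)); exact: measurable_funB.
  - by move=> t _; rewrite lee_fin mulr_ge0 ?powR_ge0.
  by apply: eq_integral => s _; rewrite /f -EFinM subr0 mulrA.
rewrite (@integral_dep_swap R `]0%R, +oo[ (fun z => `]0%R, z[%classic) `]0%R, +oo[ (fun s => `]s, +oo[%classic)).
- rewrite -[in RHS](Gamma_fin_num q0) -ge0_integralZl//; last 3 first.
  - apply/measurable_EFinP; apply: measurable_powRM => //.
    by apply: measurableT_comp => //; exact: measurable_funN.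
  - by move=> t _; rewrite lee_fin mulr_ge0 ?powR_ge0 ?expR_ge0.
  - by rewrite lee_fin ltW// Gamma_gt0.
  apply: eq_integral => s; rewrite inE/= in_itv/= andbT => s0.
  rewrite (@ge0_integral_affine R s 1)//; last 2 first.
  - apply/measurable_EFinP; apply: measurable_powRM; first exact: measurable_funB.
    apply: measurable_funM => //; apply: measurableT_comp => //; exact: measurable_funN.
  - by move=> t _; rewrite lee_fin !mulr_ge0 ?powR_ge0 ?expR_ge0.
  rewrite mul1e (_ : _ @^-1` _ = `]0%R, +oo[%classic); last first.
    apply/seteqP; split=> t /=; rewrite !in_itv/= !andbT mul1r; lra.
  rewrite -(Gamma_fin_num p0) -ge0_integralZr; last 4 first.
  - exact: measurable_itv.
  - apply/measurable_EFinP; apply: measurable_powRM => //.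
    by apply: measurableT_comp => //; exact: measurable_funN.
  - by move=> t _; rewrite lee_fin mulr_ge0 ?powR_ge0 ?expR_ge0.
  - by rewrite lee_fin mulr_ge0 ?powR_ge0 ?expR_ge0.
  apply: eq_integral => t _; rewrite /f -EFinM; congr EFin.
  by rewrite mul1r opprD expRD addrAC subrr add0r; ring.
- by move=> t s; rewrite /= !in_itv/= !andbT; split=> [[h /andP[-> ->]]|[h1 h2]]//;
    rewrite h1 h2 (lt_trans h1 h2).
- rewrite (_ : [set z | _] = [set z : TR * TR | 0 < z.2 < z.1]); first exact: measurable_triangle.
  apply/seteqP; split=> z /=; rewrite !in_itv/= andbT; first by case.
  by move=> h; split => //; case/andP: h => h1 h2; rewrite (lt_trans h1 h2).
- apply/measurable_EFinP; apply: measurable_powRM.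
    by apply: measurable_funTS; apply: measurable_funB.
  apply: measurable_powRM; first exact: measurable_funTS.
  apply: measurableT_comp => //; apply: measurable_funN; exact: measurable_funTS.
- by move=> t s _ _; rewrite lee_fin !mulr_ge0 ?powR_ge0 ?expR_ge0.
Qed.

Definition beta (p q : R) : R := Gamma p * Gamma q / Gamma (p + q).

Lemma beta_gt0 (p q : R) : 0 < p -> 0 < q -> 0 < beta p q.
Proof. by move=> p0 q0; rewrite divr_gt0 ?mulr_gt0 ?Gamma_gt0 ?addr_gt0. Qed.

Lemma eBetaE (p q : R) : 0 < p -> 0 < q -> eBeta p q = (beta p q)%:E.
Proof.
move=> p0 q0; have := eBeta_Gamma p0 q0.
have G0 := Gamma_gt0 (addr_gt0 p0 q0).
rewrite /beta; case: (eBeta p q) => [r||].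
- by rewrite -!EFinM => -[<-]; rewrite mulfK ?gt_eqF.
- by rewrite gt0_mulye// lte_fin.
- by rewrite gt0_mulNye// lte_fin.
Qed.

Lemma Gamma1 : Gamma 1 = 1 :> R.
Proof.
apply: EFin_inj; rewrite -Gamma_fin_num// -(integral_expRN_div (@ltr01 R)).
rewrite -integral_itv_obnd_cbnd; last first.
  apply/measurable_EFinP/measurableT_comp => //; apply: measurable_funN => //.
  exact: measurable_funM.
apply: eq_integral => t; rewrite inE/= in_itv/= andbT => t0.
by rewrite subrr powRr0 mul1r divr1.
Qed.

Lemma GammaS (n : nat) : Gamma n.+1%:R = n`!%:R :> R.
Proof.
elim: n => [|n IH]; first by rewrite Gamma1.
have n1 : 0 < n.+1%:R :> R by rewrite ltr0n.
have := eBeta_Gamma (@ltr01 R) n1.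
have -> : eBeta 1 n.+1%:R = (n.+1%:R^-1)%:E.
  rewrite /eBeta.
  transitivity (\int[mu]_(s in `[0%R, 1%R]) (s ^+ n)%:E)%E.
    rewrite [RHS]integral_itv_bndoo; last first.
      by apply/measurable_EFinP/measurable_funX.
    apply: eq_integral => s; rewrite inE/= in_itv/= => /andP[s0 s1].
    by rewrite subrr powRr0 mul1r -natr1 addrK powR_mulrn// ltW.
  rewrite (@continuous_FTC2 _ _ (fun s => s `^ n.+1%:R / n.+1%:R)) ?ltr01//.
  - by rewrite powR1 powR0 ?pnatr_eq0// mul0r sube0 mul1r.
  - by apply: continuous_subspaceT => x; exact: exprn_continuous.
  - split.
    + move=> x; rewrite in_itv/= => /andP[x0 _].
      by have [] := is_derive_powR_div n1 x0.
    + rewrite powR0 ?pnatr_eq0//; apply: cvgM; last exact: cvg_cst.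
      exact: powR_cvg0.
    + apply: cvg_at_left_filter; apply: cvgM; last exact: cvg_cst.
      exact: continuous_powR_gt0.
  - move=> x; rewrite in_itv/= => /andP[x0 _].
    have h := is_derive_powR_div n1 x0; rewrite derive1E derive_val.
    by rewrite -natr1 addrK powR_mulrn// ltW.
rewrite Gamma1 IH -!EFinM => -[]; rewrite mul1r nat1r => h.
by rewrite factS natrM -h mulrA mulfV ?mul1r// pnatr_eq0.
Qed.

End GammaBeta.

(** * Volterra integrals and Riemann-Liouville integrals *)

Section Volterra.
Context {R : realType}.
Local Notation mu := (@lebesgue_measure R).
Local Notation TR := (measurableTypeR R).

Definition ker (p g t s : R) : R := (t - s) `^ (p - 1) * s `^ (- g).

Lemma ker_ge0 p g t s : 0 <= ker p g t s.
Proof. by rewrite mulr_ge0 ?powR_ge0. Qed.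

Lemma measurable_ker p g t (D : set R) : measurable_fun D (ker p g t).
Proof.
apply: measurable_powRM; first exact: measurable_funB.
by apply: measurable_funTS; exact: measurable_powR.
Qed.

Lemma integral_ker (p g t : R) : 0 < p -> g < 1 -> 0 < t ->
  (\int[mu]_(s in `]0%R, t[) (ker p g t s)%:E = (t `^ (p - g) * beta p (1 - g))%:E)%E.
Proof.
move=> p0 g1 t0; have := integral_beta_kernel p (1 - g) t0.
rewrite subr0 eBetaE ?subr_gt0// -EFinM.
have -> : p + (1 - g) - 1 = p - g by ring.
move=> <-; apply: eq_integral => s _; rewrite /ker subr0.
by have -> : 1 - g - 1 = - g by ring.
Qed.

Lemma integrable_ker (p g t : R) : 0 < p -> g < 1 -> 0 < t ->
  mu.-integrable `]0, t[ (EFin \o ker p g t).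
Proof.
move=> p0 g1 t0; apply/integrableP; split.
  by apply/measurable_EFinP; exact: measurable_ker.
under eq_integral do rewrite /= ger0_norm ?ker_ge0//.
by rewrite integral_ker// ltry.
Qed.

Lemma Rintegral_ker (p g t : R) : 0 < p -> g < 1 -> 0 < t ->
  \int[mu]_(s in `]0, t[) ker p g t s = t `^ (p - g) * beta p (1 - g).
Proof. by move=> p0 g1 t0; rewrite /Rintegral integral_ker. Qed.

Lemma integrable_kerZ (C p g t : R) : 0 < p -> g < 1 -> 0 < t ->
  mu.-integrable `]0, t[ (fun s => (C * ker p g t s)%:E).
Proof.
move=> p0 g1 t0; rewrite (_ : (fun _ => _) = (fun s : TR => C%:E * (EFin \o ker p g t) s)%E).
  by apply: integrableZl => //; exact: integrable_ker.
by apply/funext => s; rewrite EFinM.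
Qed.

Lemma ker_bounded_integrable (p g t C : R) (h : R -> R) : 0 < p -> g < 1 -> 0 < t ->
  measurable_fun `]0, t[ h ->
  (forall s, 0 < s < t -> `|h s| <= C * ker p g t s) ->
  mu.-integrable `]0, t[ (EFin \o h).
Proof.
move=> p0 g1 t0 mh hb.
apply: (@le_integrable _ TR _ _ _ _ _ (fun s => (C * ker p g t s)%:E)) => //.
- exact/measurable_EFinP.
- move=> s; rewrite /= in_itv/= => /hb h1.
  by rewrite lee_fin (le_trans h1)// ler_norm.
- exact: integrable_kerZ.
Qed.

Lemma ker_bounded_integral (p g t C : R) (h : R -> R) : 0 < p -> g < 1 -> 0 < t ->
  measurable_fun `]0, t[ h ->
  (forall s, 0 < s < t -> `|h s| <= C * ker p g t s) ->
  `|\int[mu]_(s in `]0, t[) h s| <= C * (t `^ (p - g) * beta p (1 - g)).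
Proof.
move=> p0 g1 t0 mh hb; have ih := ker_bounded_integrable p0 g1 t0 mh hb.
apply: (le_trans (le_normr_Rintegral _ ih)) => //.
rewrite -Rintegral_ker// -RintegralZl//; last exact: integrable_ker.
apply: le_Rintegral => //.
- exact: integrable_norm.
- exact: integrable_kerZ.
Qed.

Lemma continuous_comp_at (f h : R -> R) x :
  {for x, continuous f} -> {for f x, continuous h} ->
  {for x, continuous (fun y => h (f y))}.
Proof. by move=> cf ch; apply: (@continuous_comp R R R f h). Qed.

Lemma continuous_eq_on (X t : R) (F G : R -> R) :
  (forall x, 0 < x < X -> F x = G x) -> 0 < t < X ->
  {for t, continuous G} -> {for t, continuous F}.
Proof.
move=> FG tX cG; rewrite /prop_for /continuous_at FG//.
apply: cvg_trans cG; apply: near_eq_cvg.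
near=> x; rewrite FG//; near: x; have /andP[t0 tX'] := tX.
by near=> x; apply/andP; split; near: x; [exact: lt_nbhsr|exact: lt_nbhsl].
Unshelve. all: by end_near. Qed.

Lemma powR_le_sum (a b x r : R) : 0 < a -> a <= x <= b -> x `^ r <= a `^ r + b `^ r.
Proof.
move=> a0 /andP[ax xb]; have [r0|r0] := leP 0 r.
  rewrite -[leLHS]add0r lerD ?powR_ge0// ge0_ler_powR ?nnegrE//; lra.
rewrite -[leLHS]addr0 lerD ?powR_ge0//.
rewrite -(opprK r) !(powRN _ (- r)) lef_pV2 ?posrE ?powR_gt0//; last lra.
rewrite ge0_ler_powR ?nnegrE; lra.
Qed.

Lemma volterra_continuous (X p g q C : R) (H : R -> R -> R) : 0 < p -> g < 1 -> 0 <= C ->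
  (forall t s : R, 0 < s < t -> t < X -> `|H t s| <= C * t `^ (- q) * ker p g t s) ->
  (forall t r : R, 0 < t < X -> 0 < r < 1 -> {for t, continuous (fun x => H x (x * r))}) ->
  (forall t : R, 0 < t < X -> measurable_fun `]0, t[ (H t)) ->
  forall t : R, 0 < t < X -> {for t, continuous (fun t : R => \int[mu]_(s in `]0, t[) H t s)}.
Proof.
move=> p0 g1 C0 Hb Hc Hm t /[dup] tX /andP[t0 tX'].
pose f (x r : R) := H x (0 + x * r).
have FE x : 0 < x < X -> \int[mu]_(s in `]0, x[) H x s = x * \int[mu]_(r in `]0, 1[) f x r.
  move=> xX; have /andP[x0 _] := xX.
  rewrite (integral_affine 0 x0)//; last exact: Hm.
  congr (_ * _); congr (\int[mu]_(r in _) _).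
  by rewrite affine_preimage_itv// !subr0 mul0r divff ?gt_eqF.
apply: (continuous_eq_on FE tX).
pose u := t / 2; pose v := (t + X) / 2.
have uv x : x \in `]u, v[ -> 0 < x < X.
  by rewrite in_itv/= /u /v => /andP[? ?]; apply/andP; split; lra.
pose e := p - 1 - g - q.
pose K := C * (u `^ e + v `^ e).
have fb x r : u < x < v -> 0 < r < 1 -> `|f x r| <= K * ker p g 1 r.
  move=> xuv /andP[r0 r1].
  have /andP[x0 xX] : 0 < x < X by apply: uv; rewrite in_itv.
  have h1 : 0 < 0 + x * r < x by rewrite add0r mulr_gt0//= gtr_pMr.
  apply: (le_trans (Hb x _ h1 xX)); rewrite /K -!mulrA ler_wpM2l//.
  have r1' : 0 <= 1 - r by rewrite subr_ge0 ltW.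
  rewrite /ker add0r -[X in X - x * r]mulr1 -mulrBr (powRM _ (ltW x0) r1') (powRM _ (ltW x0) (ltW r0)).
  have -> : x `^ (- q) * (x `^ (p - 1) * (1 - r) `^ (p - 1) * (x `^ (- g) * r `^ (- g))) =
    x `^ e * ((1 - r) `^ (p - 1) * r `^ (- g)).
    have -> : x `^ e = x `^ (- q) * x `^ (p - 1) * x `^ (- g).
      by rewrite -!powRD_gt0//; congr (_ `^ _); rewrite /e; ring.
    ring.
  rewrite ler_wpM2r ?mulr_ge0 ?powR_ge0// powR_le_sum//; first by rewrite /u; lra.
  by case/andP: xuv => /ltW-> /ltW->.
have mf (x : R) : x \in `]u, v[ -> measurable_fun (`]0, 1[%classic : set R) (f x).
  move=> /uv xX; have /andP[x0 _] := xX.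
  apply: (@measurable_comp _ _ _ _ _ _ `]0, x[ _ _ (fun r => 0 + x * r)) => //.
  - move=> _ [r /= + <-]; rewrite !in_itv/= => /andP[r0 r1].
    by rewrite add0r mulr_gt0//= gtr_pMr.
  - exact: Hm.
  - by apply: measurable_funD => //; exact: measurable_funM.
apply: continuousM; first exact: cvg_id.
apply: (@continuity_under_integral R _ TR mu f `]0, 1[%classic (measurable_itv _) u v
  _ _ (fun r => K * ker p g 1 r)).
- move=> x xuv; apply: (@ker_bounded_integrable p g 1 K) => //; first exact: mf.
  by move=> r; apply: fb; move: xuv; rewrite /= in_itv.
- apply: aeW => r; rewrite /= in_itv/= => r01 x; rewrite inE/= => /uv xX.
  by apply: (continuous_eq_on _ xX (Hc _ _ xX r01)) => y _; rewrite /f add0r.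
- exact: integrable_kerZ.
- move=> x xuv; apply: aeW => r; rewrite /= in_itv/=; apply: fb.
  by move: xuv; rewrite /= in_itv.
- by rewrite inE/= in_itv/= /u /v; apply/andP; split; lra.
Qed.

Lemma measurable_dep_integral (A : set R) (B : R -> set R) (f : TR -> TR -> \bar R) :
  let D : set (TR * TR) := [set z | A z.1 /\ B z.1 z.2] in
  measurable A -> measurable D ->
  measurable_fun D (fun z => f z.1 z.2) ->
  (forall t s, A t -> B t s -> (0 <= f t s)%E) ->
  measurable_fun A (fun t => (\int[mu]_(s in B t) f t s)%E).
Proof.
move=> D mA mD mf f0.
pose g : TR * TR -> \bar R := (fun z => f z.1 z.2) \_ D.
have mg : measurable_fun setT g by apply: (measurable_restrictT _ _).1.
have g0 z : (0 <= g z)%E.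
  by rewrite /g patchE; case: ifPn => // /set_mem[]; exact: f0.
have mF := @measurable_fun_fubini_tonelli_F _ _ TR TR R mu g mg g0.
apply: (@eq_measurable_fun _ _ TR _ A (fun t => \int[mu]_s g (t, s))%E); last first.
  exact: measurable_funTS.
move=> t tA; rewrite [RHS]integral_mkcond; apply: eq_integral => s _; rewrite /g !patchE.
have -> : ((t, s) \in D) = (s \in B t).
  apply/idP/idP => /set_mem h; apply/mem_set; first by case: h.
  by split => //; exact/set_mem.
by [].
Qed.

Lemma fubini_volterra (x p q b g C : R) (G : TR -> TR -> R) :
  0 < x -> 0 < p -> 0 < b -> g < 1 -> g + q - b < 1 -> 0 <= C ->
  measurable_fun [set z : TR * TR | 0 < z.2 < z.1 /\ z.1 < x] (fun z => G z.1 z.2) ->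
  (forall t s : R, 0 < s < t -> t < x ->
    `|G t s| <= C * ((x - t) `^ (p - 1) * t `^ (- q)) * ker b g t s) ->
  \int[mu]_(t in `]0, x[) \int[mu]_(s in `]0, t[) G t s =
  \int[mu]_(s in `]0, x[) \int[mu]_(t in `]s, x[) G t s.
Proof.
move=> x0 p0 b0 g1 gqb C0 mG Gb.
have DE : [set z : TR * TR | 0 < z.2 < z.1 /\ z.1 < x] =
    [set z : TR * TR | `]0, x[%classic z.1 /\ `]0, z.1[%classic z.2].
  apply/seteqP; split=> z /=; rewrite !in_itv/=.
    by move=> [/andP[h1 h2] ->]; rewrite h1 h2 (lt_trans h1 h2).
  by move=> [/andP[_ ->] ->].
have mD : measurable [set z : TR * TR | `]0, x[%classic z.1 /\ `]0, z.1[%classic z.2].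
  rewrite -DE; apply: measurableI; first exact: measurable_triangle.
  rewrite -[X in measurable X]setTI.
  have := @measurable_fun_ltr _ (TR * TR)%type R setT fst (cst x).
  move=> /(_ _ _ measurableT [set true] _); rewrite preimage_true; apply => //.
rewrite DE in mG.
apply: Rintegral_dep_swap => //.
  move=> t s; rewrite /= !in_itv/=; split.
    move=> [/andP[_ h3] /andP[h1 h2]]; rewrite h1 h2 h3; split=> //.
    by rewrite (lt_trans h2 h3).
  move=> [/andP[h1 _] /andP[h2 h3]]; rewrite h1 h2 h3; split=> //.
  by rewrite (lt_trans h1 h2).
have mGt t : 0 < t < x -> measurable_fun `]0, t[ (G t).
  move=> tx; apply: (@measurable_comp _ _ _ _ _ _ _ (fun z : TR * TR => G z.1 z.2) _ (fun s : TR => (t, s)) mD _ mG).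
    by move=> _ [s /= st <-]; rewrite /= in_itv.
  by apply: measurable_funTS; exact: pair1_measurable.
apply: (@le_lt_trans _ _ (\int[mu]_(t in `]0%R, x[) (C * beta b (1 - g) * ker p (g + q - b) x t)%:E)%E); last first.
  rewrite ltey; apply: contraT; rewrite negbK => /eqP h.
  have := @integrable_fin_num _ TR _ mu _ (measurable_itv `]0, x[) _ (integrable_kerZ (C * beta b (1 - g)) p0 gqb x0).
  by rewrite h.
apply: ge0_le_integral => //.
- by move=> t _; apply: integral_ge0 => s _; rewrite lee_fin.
- apply: measurable_dep_integral => //.
  by apply/measurable_EFinP; apply: measurableT_comp.
- by apply/measurable_EFinP; apply: measurable_funM => //; exact: measurable_ker.
- move=> t; rewrite /= in_itv/= => /[dup] tx /andP[t0 tx'].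
  apply: (@le_trans _ _ (\int[mu]_(s in `]0%R, t[) (C * ((x - t) `^ (p - 1) * t `^ (- q)) * ker b g t s)%:E)%E).
    apply: ge0_le_integral => //.
    + by apply/measurable_EFinP; apply: measurableT_comp => //; exact: mGt.
    + by apply/measurable_EFinP; apply: measurable_funM => //; exact: measurable_ker.
    + by move=> s; rewrite /= in_itv/= lee_fin => /Gb; apply.
  under eq_integral do rewrite EFinM.
  rewrite ge0_integralZl//; last 3 first.
  - by apply/measurable_EFinP; exact: measurable_ker.
  - by move=> s _; rewrite lee_fin ker_ge0.
  - by rewrite lee_fin !mulr_ge0 ?powR_ge0.
  rewrite integral_ker// -EFinM lee_fin /ker.
  have -> : - (g + q - b) = - q + (b - g) by ring.
  rewrite (powRD_gt0 (- q) (b - g) t0); set B := beta _ _.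
  suff -> : C * ((x - t) `^ (p - 1) * t `^ (- q)) * (t `^ (b - g) * B) =
    C * B * ((x - t) `^ (p - 1) * (t `^ (- q) * t `^ (b - g))) by [].
  ring.
Qed.

End Volterra.

Section RiemannLiouville.
Context {R : realType}.
Local Notation mu := (@lebesgue_measure R).
Local Notation TR := (measurableTypeR R).

(* The space in which the highest derivative [u] of a solution lives. The bound
   [t `^ (- g)] is what makes [u] an element of C_g. *)
Definition wcont (X g : R) (u : R -> R) : Prop :=
  (forall t, 0 < t < X -> {for t, continuous u}) /\
  exists2 M, 0 <= M & forall t, 0 < t < X -> `|u t| <= M * t `^ (- g).

Lemma RLintE (p t : R) (f : R -> R) : 0 < p -> measurable_fun `]0, t[ f ->
  RLint p f t = (Gamma p)^-1 * \int[mu]_(s in `]0, t[) ((t - s) `^ (p - 1) * f s).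
Proof.
move=> p0 mf; rewrite /RLint gt_eqF//; congr (_ * _); rewrite /Rintegral.
rewrite integral_itv_bndoo//; apply/measurable_EFinP; apply: measurable_powRM => //.
exact: measurable_funB.
Qed.

Lemma eq_RLint (p t : R) (f1 f2 : R -> R) : 0 <= p -> measurable_fun `]0, t[ f1 ->
  (forall s, 0 < s < t -> f1 s = f2 s) -> f1 t = f2 t ->
  RLint p f1 t = RLint p f2 t.
Proof.
rewrite le_eqVlt => /predU1P[<-|p0] mf f12 ft; first by rewrite /RLint eqxx.
have mf2 : measurable_fun `]0, t[ f2.
  apply: eq_measurable_fun mf => s; rewrite inE/= in_itv/=; exact: f12.
rewrite !RLintE//; congr (_ * _); apply: eq_Rintegral => s; rewrite inE/= in_itv/= => h.
by rewrite f12.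
Qed.

Lemma wcont_measurable (X g : R) u t : wcont X g u -> t <= X -> measurable_fun `]0, t[ u.
Proof.
move=> [cu _] tX; apply: cont_oo_measurable => x /andP[x0 xt].
by apply: cu; rewrite x0 (lt_le_trans xt).
Qed.

Lemma wcontW (X Y g : R) u : Y <= X -> wcont X g u -> wcont Y g u.
Proof.
move=> YX [cu [M M0 uM]]; split=> [t /andP[t0 tY]|].
  by apply: cu; rewrite t0 (lt_le_trans tY).
by exists M => // t /andP[t0 tY]; apply: uM; rewrite t0 (lt_le_trans tY).
Qed.

Lemma RLint_bound (p g t N : R) (u : R -> R) : 0 < p -> g < 1 -> 0 < t ->
  measurable_fun `]0, t[ u ->
  (forall s, 0 < s < t -> `|u s| <= N * s `^ (- g)) ->
  `|RLint p u t| <= (Gamma p)^-1 * N * (t `^ (p - g) * beta p (1 - g)).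
Proof.
move=> p0 g1 t0 mu' ub; rewrite RLintE// normrM ger0_norm ?invr_ge0 ?(ltW (Gamma_gt0 _))//.
rewrite -!mulrA ler_wpM2l ?invr_ge0 ?(ltW (Gamma_gt0 _))//.
apply: ker_bounded_integral => //.
  apply: measurable_powRM => //; exact: measurable_funB.
move=> s st; rewrite normrM ger0_norm ?powR_ge0// /ker mulrCA ler_wpM2l ?powR_ge0//.
exact: ub.
Qed.

Lemma wcont_RLint (X g p : R) (u : R -> R) : g < 1 -> 0 <= p ->
  wcont X g u -> wcont X g (RLint p u).
Proof.
move=> g1; rewrite le_eqVlt => /predU1P[<-|p0]; first by rewrite /RLint eqxx.
move=> wu; have [cu [M M0 uM]] := wu; split.
  move=> t tX; have := tX => /andP[t0 tX'].
  apply: (@continuous_eq_on R X t _ (fun t => (Gamma p)^-1 * \int[mu]_(s in `]0, t[) ((t - s) `^ (p - 1) * u s))) => //.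
    by move=> x /andP[x0 xX]; rewrite RLintE//; apply: (wcont_measurable wu); exact: ltW.
  apply: continuousM; first exact: cvg_cst.
  apply: (@volterra_continuous R X p g 0 M (fun t s => (t - s) `^ (p - 1) * u s)) => //.
  - move=> x s /andP[s0 sx] xX; rewrite oppr0 powRr0 mulr1 normrM ger0_norm ?powR_ge0//.
    rewrite /ker mulrCA ler_wpM2l ?powR_ge0// uM// s0; exact: lt_trans xX.
  - move=> x r /andP[x0 xX] /andP[r0 r1]; apply: continuousM.
      apply: (@continuous_comp_at _ (fun y => y - y * r) (fun y => y `^ (p - 1))).
        by apply: continuousB; [exact: cvg_id|apply: continuousM; [exact: cvg_id|exact: cvg_cst]].
      apply: continuous_powR_gt0; rewrite subr_gt0 gtr_pMr//.
    apply: (@continuous_comp_at _ (fun y => y * r) u).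
      by apply: continuousM; [exact: cvg_id|exact: cvg_cst].
    by apply: cu; rewrite mulr_gt0//= (lt_trans _ xX)// gtr_pMr.
  - move=> x /andP[x0 xX]; apply: measurable_powRM; first exact: measurable_funB.
    by apply: (wcont_measurable wu); exact: ltW.
exists ((Gamma p)^-1 * M * beta p (1 - g) * X `^ p).
  apply: mulr_ge0; [apply: mulr_ge0; [apply: mulr_ge0 => //|]|exact: powR_ge0].
    by rewrite invr_ge0 ltW ?Gamma_gt0.
  by rewrite ltW// beta_gt0 ?subr_gt0.
move=> t /andP[t0 tX]; apply: (@le_trans _ _ ((Gamma p)^-1 * M * (t `^ (p - g) * beta p (1 - g)))).
  apply: RLint_bound => //; first by apply: (wcont_measurable wu); exact: ltW.
  by move=> s /andP[s0 st]; rewrite uM// s0 (lt_trans st).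
have : 0 < beta p (1 - g) by rewrite beta_gt0 ?subr_gt0.
move: (beta p (1 - g)) => B B0.
rewrite -!mulrA ler_wpM2l ?invr_ge0 ?(ltW (Gamma_gt0 _))// ler_wpM2l// mulrC.
rewrite ler_wpM2l ?(ltW B0)// powRD_gt0// ler_wpM2r ?powR_ge0//.
rewrite ge0_ler_powR ?nnegrE ?(ltW p0) ?(ltW t0) ?(ltW tX)//.
by rewrite (ltW (lt_trans t0 tX)).
Qed.

Lemma RLint_semigroup (X g p q t : R) (u : R -> R) : g < 1 -> 0 <= g -> 0 <= p -> 0 <= q ->
  wcont X g u -> 0 < t < X -> RLint p (RLint q u) t = RLint (p + q) u t.
Proof.
move=> g1 g0; rewrite le_eqVlt => /predU1P[<-|p0].
  by rewrite add0r {1}/RLint eqxx.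
rewrite le_eqVlt => /predU1P[<-|q0] wu /andP[t0 tX].
  by rewrite addr0 /RLint eqxx.
have [cu [M M0 uM]] := wu.
have mut : measurable_fun `]0, t[ u by apply: (wcont_measurable wu); exact: ltW.
have muI : measurable_fun `]0, t[ (RLint q u).
  by apply: (@wcont_measurable X g); [apply: wcont_RLint => //; exact: ltW|exact: ltW].
rewrite !RLintE ?addr_gt0//.
have Gq := Gamma_gt0 q0; have Gp := Gamma_gt0 p0.
have ikr (y : R) : 0 < y <= t -> forall r, 0 < r -> mu.-integrable `]0, y[ (EFin \o (fun s => (y - s) `^ (r - 1) * u s)).
  move=> /andP[y0 yt] r r0; apply: (@ker_bounded_integrable R r g y M) => //.
    apply: measurable_powRM; first exact: measurable_funB.
    by apply: (wcont_measurable wu); rewrite (le_trans yt)// ltW.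
  move=> s /andP[s0 sy]; rewrite normrM ger0_norm ?powR_ge0// /ker mulrCA.
  by rewrite ler_wpM2l ?powR_ge0// uM// s0 (lt_trans sy)// (le_lt_trans yt).
pose G (x s : TR) : R := (t - x) `^ (p - 1) * (Gamma q)^-1 * ((x - s) `^ (q - 1) * u s).
transitivity ((Gamma p)^-1 * \int[mu]_(x in `]0, t[) \int[mu]_(s in `]0, x[) G x s).
  congr (_ * _); apply: eq_Rintegral => x; rewrite inE/= in_itv/= => /andP[x0 xt].
  rewrite RLintE//; last by apply: (wcont_measurable wu); rewrite ltW// (lt_trans xt).
  by rewrite mulrA -RintegralZl//; apply: ikr => //; rewrite x0 ltW.
rewrite (@fubini_volterra R t p 0 q g (M / Gamma q) G)//; last 4 first.
- lra.
- by apply: divr_ge0; [|exact: ltW].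
- apply: measurable_funM.
    apply: measurable_powRM; last exact: measurable_cst.
    by apply: measurable_funB => //; exact: measurable_funTS.
  apply: measurable_powRM.
    by apply: measurable_funB => //; exact: measurable_funTS.
  apply: (@measurable_comp _ _ _ _ _ _ `]0, t[ u _ snd) => //.
    by move=> _ [z /= [/andP[z1 z2] z3] <-]; rewrite in_itv/= z1 (lt_trans z2).
  exact: measurable_funTS.
- move=> x s /andP[s0 sx] xt; rewrite /G oppr0 powRr0 mulr1 !normrM.
  rewrite (ger0_norm (powR_ge0 _ _)) (ger0_norm (powR_ge0 _ _)) ger0_norm ?invr_ge0 ?(ltW Gq)//.
  rewrite [leRHS](_ : _ = (t - x) `^ (p - 1) * (Gamma q)^-1 * ((x - s) `^ (q - 1) * (M * s `^ (- g)))); last by rewrite /ker; ring.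
  rewrite ler_wpM2l ?mulr_ge0 ?powR_ge0 ?invr_ge0 ?(ltW Gq)//.
  by rewrite ler_wpM2l ?powR_ge0// uM// s0 (lt_trans sx)// (lt_trans xt).
transitivity ((Gamma p)^-1 * \int[mu]_(s in `]0, t[) (((Gamma q)^-1 * beta p q) * ((t - s) `^ (p + q - 1) * u s))).
  congr (_ * _); apply: eq_Rintegral => s; rewrite inE/= in_itv/= => /andP[s0 st].
  have ib : mu.-integrable `]s, t[ (EFin \o (fun x => (t - x) `^ (p - 1) * (x - s) `^ (q - 1))).
    apply/integrableP; split.
      apply/measurable_EFinP; apply: measurable_powRM; first exact: measurable_funB.
      by apply: (measurableT_comp (measurable_powR _)); exact: measurable_funB.
    under eq_integral do rewrite /= ger0_norm ?mulr_ge0 ?powR_ge0//.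
    by rewrite integral_beta_kernel// eBetaE// -EFinM ltry.
  transitivity (\int[mu]_(x in `]s, t[) (((Gamma q)^-1 * u s) * ((t - x) `^ (p - 1) * (x - s) `^ (q - 1)))).
    by apply: eq_Rintegral => x _; rewrite /G; ring.
  rewrite RintegralZl//.
  have -> : \int[mu]_(x in `]s, t[) ((t - x) `^ (p - 1) * (x - s) `^ (q - 1)) = (t - s) `^ (p + q - 1) * beta p q.
    by rewrite /Rintegral integral_beta_kernel// eBetaE.
  ring.
rewrite RintegralZl//; last by apply: ikr; rewrite ?t0 ?lexx ?addr_gt0.
rewrite mulrA; congr (_ * _); rewrite /beta.
have := Gamma_gt0 (addr_gt0 p0 q0).
move: (Gamma (p + q)) (Gamma p) (Gamma q) Gp Gq => c d e d0 e0 c0.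
by field; rewrite !gt_eqF.
Qed.

End RiemannLiouville.

Section Linearity.
Context {R : realType}.
Local Notation mu := (@lebesgue_measure R).

Lemma invGamma_ge0 (p : R) : 0 < p -> 0 <= (Gamma p)^-1.
Proof. by move=> p0; rewrite invr_ge0 ltW ?Gamma_gt0. Qed.

Lemma wcontD (X g : R) (u v : R -> R) : wcont X g u -> wcont X g v ->
  wcont X g (fun t => u t + v t).
Proof.
move=> [cu [M M0 uM]] [cv [N N0 vN]]; split.
  by move=> t tX; apply: continuousD; [exact: cu|exact: cv].
exists (M + N); first exact: addr_ge0.
by move=> t tX; rewrite mulrDl (le_trans (ler_normD _ _))// lerD ?uM ?vN.
Qed.

Lemma wcontZ (X g c : R) (u : R -> R) : wcont X g u -> wcont X g (fun t => c * u t).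
Proof.
move=> [cu [M M0 uM]]; split.
  by move=> t tX; apply: continuousM; [exact: cvg_cst|exact: cu].
exists (`|c| * M); first exact: mulr_ge0.
by move=> t tX; rewrite normrM -mulrA ler_wpM2l ?uM.
Qed.

Lemma wcont0 (X g : R) : wcont X g (fun _ => 0).
Proof. by split=> [t _|]; [exact: cvg_cst|exists 0 => // t _; rewrite normr0 mul0r]. Qed.

Lemma wcont_sum (X g : R) (I : Type) (r : seq I) (P : pred I) (F : I -> R -> R) :
  (forall i, P i -> wcont X g (F i)) -> wcont X g (fun t => \sum_(i <- r | P i) F i t).
Proof.
move=> wF; elim: r => [|i r IH].
  by under eq_fun do rewrite big_nil; exact: wcont0.
under eq_fun do rewrite big_cons.
by case: (P i) (wF i) => // wFi; apply: wcontD => //; exact: wFi.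
Qed.

Lemma wcontM_bounded (X g A : R) (a u : R -> R) :
  (forall t, 0 < t < X -> {for t, continuous a}) ->
  (forall t, 0 < t < X -> `|a t| <= A) ->
  wcont X g u -> wcont X g (fun t => a t * u t).
Proof.
move=> ca aA [cu [M M0 uM]]; split.
  by move=> t tX; apply: continuousM; [exact: ca|exact: cu].
exists (`|A| * M); first exact: mulr_ge0.
move=> t tX; rewrite normrM -mulrA ler_pM ?uM//.
by rewrite (le_trans (aA _ tX))// ler_norm.
Qed.

Lemma wcont_ext (X g : R) (u v : R -> R) : (forall t, 0 < t < X -> u t = v t) ->
  wcont X g v -> wcont X g u.
Proof.
move=> uv [cv [M M0 vM]]; split.
  by move=> t tX; apply: (continuous_eq_on uv tX); exact: cv.
by exists M => // t tX; rewrite uv// vM.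
Qed.

Lemma integrable_RLint (X g p t : R) (u : R -> R) : g < 1 -> 0 < p ->
  wcont X g u -> 0 < t < X ->
  mu.-integrable `]0, t[ (EFin \o (fun s => (t - s) `^ (p - 1) * u s)).
Proof.
move=> g1 p0 wu /andP[t0 tX]; have [_ [M M0 uM]] := wu.
apply: (@ker_bounded_integrable R p g t M) => //.
  apply: measurable_powRM; first exact: measurable_funB.
  by apply: (wcont_measurable wu); exact: ltW.
move=> s /andP[s0 st]; rewrite normrM ger0_norm ?powR_ge0// /ker mulrCA.
by rewrite ler_wpM2l ?powR_ge0// uM// s0 (lt_trans st).
Qed.

Lemma RLint0E (f : R -> R) : RLint 0 f = f.
Proof. by rewrite /RLint eqxx. Qed.

Lemma RLint_at0 (p : R) (f : R -> R) : p != 0 -> RLint p f 0 = 0.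
Proof.
by move=> p0; rewrite /RLint (negbTE p0) set_itv1 /Rintegral integral_set1 mulr0.
Qed.

Lemma RLintD (X g p t : R) (u v : R -> R) : g < 1 -> 0 <= p ->
  wcont X g u -> wcont X g v -> 0 < t < X ->
  RLint p (fun s => u s + v s) t = RLint p u t + RLint p v t.
Proof.
move=> g1; rewrite le_eqVlt => /predU1P[<-|p0]; first by rewrite !RLint0E.
move=> wu wv tX; have /andP[t0 tX'] := tX.
rewrite !RLintE//; try by [apply: (wcont_measurable wu); exact: ltW|
  apply: (wcont_measurable wv); exact: ltW|apply: (wcont_measurable (wcontD wu wv)); exact: ltW].
rewrite -mulrDr -RintegralD//; [|exact: (integrable_RLint g1 p0 wu tX)|exact: (integrable_RLint g1 p0 wv tX)].
by congr (_ * _); apply: eq_Rintegral => s _; rewrite mulrDr.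
Qed.

Lemma RLintZ (X g p t c : R) (u : R -> R) : g < 1 -> 0 <= p ->
  wcont X g u -> 0 < t < X ->
  RLint p (fun s => c * u s) t = c * RLint p u t.
Proof.
move=> g1; rewrite le_eqVlt => /predU1P[<-|p0]; first by rewrite !RLint0E.
move=> wu tX; have /andP[t0 tX'] := tX.
rewrite !RLintE//; try by [apply: (wcont_measurable wu); exact: ltW|
  apply: (wcont_measurable (wcontZ c wu)); exact: ltW].
rewrite [RHS]mulrCA; congr (_ * _).
rewrite -RintegralZl//; last exact: (integrable_RLint g1 p0 wu tX).
by apply: eq_Rintegral => s _; rewrite mulrCA.
Qed.

Lemma RLint_cst0 (p t : R) : RLint p (fun _ => 0) t = 0.
Proof.
rewrite /RLint; case: ifP => // _.
under eq_Rintegral do rewrite mulr0.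
by rewrite /Rintegral integral0 mulr0.
Qed.

Lemma RLint_sum (X g p t : R) (I : Type) (r : seq I) (P : pred I) (F : I -> R -> R) :
  g < 1 -> 0 <= p -> (forall i, P i -> wcont X g (F i)) -> 0 < t < X ->
  RLint p (fun s => \sum_(i <- r | P i) F i s) t = \sum_(i <- r | P i) RLint p (F i) t.
Proof.
move=> g1 p0 wF tX; elim: r => [|i r IH].
  under [X in RLint _ X]eq_fun do rewrite big_nil.
  by rewrite big_nil RLint_cst0.
under [X in RLint _ X]eq_fun do rewrite big_cons.
rewrite big_cons; case: ifPn => // Pi.
by rewrite (@RLintD X g)// ?IH//; [exact: wF|exact: wcont_sum].
Qed.

Lemma RLint_Phi (p q t : R) : 0 <= p -> 0 < q -> 0 < t ->
  RLint p (Phi q) t = Phi (p + q) t.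
Proof.
rewrite le_eqVlt => /predU1P[<-|p0] q0 t0; first by rewrite add0r RLint0E.
have pq0 : 0 < p + q by rewrite addr_gt0.
rewrite RLintE//; last first.
  apply: measurable_funM => //; apply: measurable_funTS; exact: measurable_powR.
have -> : \int[mu]_(s in `]0, t[) ((t - s) `^ (p - 1) * Phi q s) =
          \int[mu]_(s in `]0, t[) ((Gamma q)^-1 * ker p (1 - q) t s).
  by apply: eq_Rintegral => s _; rewrite /Phi /ker opprB; ring.
have q1 : 1 - q < 1 by rewrite gtrDl oppr_lt0.
rewrite RintegralZl//; last exact: integrable_ker.
rewrite Rintegral_ker// /Phi /beta.
have -> : p - (1 - q) = p + q - 1 by ring.
have -> : 1 - (1 - q) = q by ring.
have := Gamma_gt0 pq0; have := Gamma_gt0 p0; have := Gamma_gt0 q0.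
move: (Gamma (p + q)) (Gamma p) (Gamma q) => c d e c0 d0 e0.
by field; rewrite !gt_eqF.
Qed.

Lemma Phi_wcont (X g q : R) : 0 < X -> 1 - g <= q -> wcont X g (Phi q).
Proof.
move=> X0 gq; split.
  move=> t /andP[t0 _]; apply: continuousM; last exact: cvg_cst.
  exact: continuous_powR_gt0.
exists (X `^ (q - 1 + g) * `|(Gamma q)^-1|); first by rewrite mulr_ge0 ?powR_ge0.
move=> t /andP[t0 tX]; rewrite /Phi normrM ger0_norm ?powR_ge0// mulrAC.
rewrite ler_wpM2r//.
have -> : q - 1 = (q - 1 + g) - g by ring.
rewrite powRD_gt0// ler_wpM2r ?powR_ge0//.
have -> : q - 1 + g - g + g = q - 1 + g by ring.
by rewrite ge0_ler_powR ?nnegrE//; first lra; exact: ltW.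
Qed.

Lemma PhiS (k : nat) (t : R) : 0 <= t -> Phi k.+1%:R t = t ^+ k / k`!%:R.
Proof. by move=> t0; rewrite /Phi GammaS -natr1 addrK powR_mulrn. Qed.

Lemma wcont_integrable (X g t : R) (u : R -> R) : g < 1 ->
  wcont X g u -> 0 < t < X -> mu.-integrable `]0, t[ (EFin \o u).
Proof.
move=> g1 wu tX; have := integrable_RLint g1 (@ltr01 R) wu tX.
apply: eq_integrable => // s _ /=; by rewrite subrr powRr0 mul1r.
Qed.

End Linearity.

Section FTC.
Context {R : realType}.
Local Notation mu := (@lebesgue_measure R).
Local Notation TR := (measurableTypeR R).

Lemma is_derive_continuous (F : R -> R) (x l : R) : is_derive x 1 F l -> {for x, continuous F}.
Proof.
by move=> h; apply: differentiable_continuous; apply/derivable1_diffP; case: h.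
Qed.

Lemma integrable_oo_cc (a b : R) (f : R -> R) :
  mu.-integrable `]a, b[ (EFin \o f) ->
  mu.-integrable `[a, b] (EFin \o (f \_ `]a, b[)).
Proof.
move=> fi; rewrite -restrict_EFin.
apply: (@integrableS _ TR _ _ setT) => //.
by rewrite -integrable_mkcond.
Qed.

Lemma Rintegral_oo_cc (a b : R) (f : R -> R) :
  \int[mu]_(t in `[a, b]) (f \_ `]a, b[) t = \int[mu]_(t in `]a, b[) f t.
Proof.
rewrite [RHS]Rintegral_mkcond [LHS]Rintegral_mkcond; apply: eq_Rintegral => t _.
rewrite !patchE; case: ifPn => // tab; case: ifPn => // tab'.
by case/negP: tab; rewrite inE; apply: subset_itv_oo_cc; rewrite -inE.
Qed.

Lemma integral_FTC_oo (a b : R) (F f : R -> R) : a < b ->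
  (forall x, a < x < b -> is_derive x 1 F (f x)) ->
  (forall x, a < x < b -> {for x, continuous f}) ->
  {within `[a, b], continuous F} ->
  mu.-integrable `]a, b[ (EFin \o f) ->
  \int[mu]_(x in `]a, b[) f x = F b - F a.
Proof.
move=> ab dF cf cF fi; rewrite -Rintegral_oo_cc.
have fi' := integrable_oo_cc fi; set f0 := f \_ _ in fi' *.
pose G x := \int[mu]_(t in `[a, x]) f0 t.
have cG : {within `[a, b], continuous G} by exact: parameterized_integral_continuous (ltW ab) fi'.
have dG x : a < x < b -> is_derive x 1 G (f x).
  move=> /[dup] xab /andP[ax xb].
  have f0x : f0 x = f x by rewrite /f0 patchE mem_set//= in_itv/= ax.
  have c0 : {for x, continuous f0}.
    rewrite /prop_for /continuous_at f0x; apply: cvg_trans (cf _ xab); apply: near_eq_cvg.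
    near=> y; rewrite /f0 patchE mem_set//= in_itv/=; apply/andP; split; near: y;
      [exact: lt_nbhsr|exact: lt_nbhsl].
  have [dG G'] := continuous_FTC1_closed xb fi' ax c0.
  by split=> //; rewrite -f0x -G' derive1E.
have dH x : x \in `]a, b[ -> is_derive x 1 (fun y => F y - G y) 0.
  rewrite in_itv/= => xab; have h1 := dF _ xab; have h2 := dG _ xab.
  by apply: is_derive_eq; rewrite subrr.
have cH : {within `[a, b], continuous (fun y => F y - G y)}.
  by move=> x; apply: continuousB; [exact: cF|exact: cG].
have [c _] := MVT_segment (ltW ab) dH cH.
have Ga : G a = 0 by rewrite /G set_itv1 /Rintegral integral_set1.
rewrite mul0r Ga subr0 -/(G b) => h; lra.
Unshelve. all: by end_near. Qed.

End FTC.

(** * Derivatives relative to a segment *)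

Section RelativeDerivative.
Context {R : realType}.
Implicit Types (f h : R -> R) (T t l : R).

Definition has_deriv T f t l := dquot f t @ within `[0, T] t^' --> l.

Lemma has_derivP T f t l : has_deriv T f t l <->
  (forall e : R, 0 < e -> exists2 d, 0 < d &
    forall s : R, 0 <= s <= T -> s != t -> `|s - t| < d -> `|dquot f t s - l| < e).
Proof.
split=> [/cvgrPdist_lt h e e0|h].
  have := h e e0; rewrite near_withinE near_withinE => /nbhs_ballP[d/= d0 dh].
  exists d => // s sT st sd; rewrite distrC; apply: dh => //=.
  by rewrite /ball/= distrC.
apply/cvgrPdist_lt => e e0; have [d d0 dh] := h e e0.
rewrite near_withinE near_withinE; apply/nbhs_ballP; exists d => //= s.
rewrite /ball/= distrC => sd st; rewrite in_itv/= => sT.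
by rewrite distrC; exact: dh.
Qed.

Lemma is_derive_dquotP f t l : is_derive t 1 f l <->
  (forall e : R, 0 < e -> exists2 d, 0 < d &
    forall s : R, s != t -> `|s - t| < d -> `|dquot f t s - l| < e).
Proof.
have dqE (x : R) : x != 0 -> x^-1 *: (f (x *: 1 + t) - f t) = dquot f t (x + t).
  by move=> x0; rewrite /dquot addrK /GRing.scale/= mulr1 mulrC.
split=> [[df fl] e e0|h].
  have := df; rewrite /derivable => /cvgrPdist_lt/(_ e e0).
  rewrite -/(derive f t 1) fl near_withinE => /nbhs_ballP[d/= d0 dh].
  exists d => // s st sd; have := dh (s - t).
  rewrite /ball/= sub0r normrN => /(_ sd); rewrite subr_eq0 => /(_ st).
  by rewrite dqE ?subr_eq0// subrK distrC.
have cl : (fun x => x^-1 *: (f (x *: 1 + t) - f t)) @ 0^' --> l.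
  apply/cvgrPdist_lt => e e0; have [d d0 dh] := h e e0.
  rewrite near_withinE; apply/nbhs_ballP; exists d => //= x.
  rewrite /ball/= sub0r normrN => xd x0; rewrite dqE// distrC; apply: dh.
    by rewrite -subr_eq0 addrK.
  by rewrite addrK.
split; first by apply/cvg_ex; exists l.
exact/cvg_lim.
Qed.

Lemma is_derive_has_deriv T f t l : is_derive t 1 f l -> has_deriv T f t l.
Proof.
move=> /is_derive_dquotP h; apply/has_derivP => e /h[d d0 dh].
by exists d => // s _; exact: dh.
Qed.

Lemma has_deriv_is_derive T f t l : 0 < t < T -> has_deriv T f t l -> is_derive t 1 f l.
Proof.
move=> /andP[t0 tT] /has_derivP h; apply/is_derive_dquotP => e /h[d d0 dh].
exists (Num.min d (Num.min t (T - t))); first by rewrite !lt_min d0 t0 subr_gt0.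
move=> s st; rewrite !lt_min => /and3P[h1 h2 h3]; apply: dh => //.
have := ler_norm (s - t); have := ler_norm (t - s); rewrite (distrC t); lra.
Qed.

Lemma within_itv_proper T t : 0 < T -> 0 <= t <= T ->
  ProperFilter (within `[0, T] t^').
Proof.
move=> T0 /andP[t0 tT]; apply: Build_ProperFilter => A.
have {A} : \forall x \near within `[0, T] t^', False by [].
rewrite near_withinE near_withinE => /nbhs_ballP[d/= d0 dh].
have [s [sT st sd]] : exists s : R, [/\ 0 <= s <= T, s != t & `|s - t| < d].
  have [tT'|tT'] := ltP t T.
    exists (Num.min T (t + d / 2)).
    have h1 : t < Num.min T (t + d / 2) by rewrite lt_min tT' ltrDl divr_gt0.
    have h2 : Num.min T (t + d / 2) <= T by rewrite ge_min lexx.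
    have h3 : Num.min T (t + d / 2) <= t + d / 2 by rewrite ge_min lexx orbT.
    split; [|by rewrite gt_eqF|rewrite gtr0_norm; lra].
    by apply/andP; split; lra.
  exists (Num.max 0 (t - d / 2)).
  have h1 : Num.max 0 (t - d / 2) < t by rewrite gt_max; apply/andP; split; lra.
  have h2 : 0 <= Num.max 0 (t - d / 2) by rewrite le_max lexx.
  have h3 : t - d / 2 <= Num.max 0 (t - d / 2) by rewrite le_max lexx orbT.
  split; [|by rewrite lt_eqF|rewrite ltr0_norm; lra].
  by apply/andP; split; lra.
by apply: (dh s) => //=; rewrite /ball/= distrC.
Qed.

Lemma has_deriv_on T f t l : 0 < T -> 0 <= t <= T -> has_deriv T f t l ->
  derivable_on T f t /\ deriv_on T f t = l.
Proof.
move=> T0 tT h; have F := within_itv_proper T0 tT; split.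
  by apply/cvg_ex; exists l.
exact/cvg_lim.
Qed.

Lemma derivable_onE T f t : derivable_on T f t -> has_deriv T f t (deriv_on T f t).
Proof. by []. Qed.

Lemma deriv_on_ext T f h t : (forall s, 0 < s <= T -> f s = h s) -> 0 < t <= T ->
  deriv_on T f t = deriv_on T h t.
Proof.
move=> fh /[dup] tT /andP[t0 _].
have fh' : {near within `[0, T] t^', dquot f t =1 dquot h t}.
  rewrite near_withinE near_withinE; near=> s; rewrite /= in_itv/= => _ /andP[_ sT].
  have s0 : 0 < s by near: s; exact: lt_nbhsr.
  by rewrite /dquot !fh// s0.
rewrite /deriv_on; congr (lim _); apply/seteqP; split.
  by apply: near_eq_cvg; apply: filterS fh' => s ->.
by apply: near_eq_cvg; apply: filterS fh' => s ->.
Unshelve. all: by end_near. Qed.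

Lemma derivn_on_ext T k f h : (forall s, 0 < s <= T -> f s = h s) ->
  forall t, 0 < t <= T -> derivn_on T k f t = derivn_on T k h t.
Proof. by move=> fh; elim: k => [|k IH] t tT; [exact: fh|exact: deriv_on_ext]. Qed.

Lemma has_deriv_extc T f h t l : (forall s, 0 <= s <= T -> f s = h s) -> 0 <= t <= T ->
  has_deriv T f t l -> has_deriv T h t l.
Proof.
move=> fh tT /has_derivP H; apply/has_derivP => e /H[d d0 dh]; exists d => // s sT st sd.
by rewrite /dquot -!fh//; exact: dh.
Qed.

End RelativeDerivative.

(** * Product of a fractional integral with a coefficient *)

Section ProductKernel.
Context {R : realType}.
Local Notation mu := (@lebesgue_measure R).
Local Notation TR := (measurableTypeR R).

Lemma powRN_le (p s x : R) : 0 <= p -> 0 < s <= x -> x `^ (- p) <= s `^ (- p).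
Proof.
move=> p0 /andP[s0 sx]; have x0 := lt_le_trans s0 sx.
by rewrite !powRN lef_pV2 ?posrE ?powR_gt0// ge0_ler_powR ?nnegrE ?(ltW s0) ?(ltW x0).
Qed.

Definition wdiff (X g : R) (a d : R -> R) : Prop :=
  [/\ forall t, 0 < t < X -> is_derive t 1 a (d t), wcont X g d &
    exists A : R, forall t, 0 < t < X -> `|a t| <= A].

Lemma wdiff_continuous X g a d t : wdiff X g a d -> 0 < t < X -> {for t, continuous a}.
Proof. by move=> [da _ _] /da; exact: is_derive_continuous. Qed.

Lemma wdiff_mul X g a d u : wdiff X g a d -> wcont X g u -> wcont X g (fun t => a t * u t).
Proof.
move=> wa wu; have [_ _ [A aA]] := wa; apply: (wcontM_bounded _ aA wu) => t tX.
exact: wdiff_continuous wa tX.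
Qed.

Lemma wdiffW X Y g a d : Y <= X -> wdiff X g a d -> wdiff Y g a d.
Proof.
move=> YX [da wd [A aA]].
have YX' t : 0 < t < Y -> 0 < t < X by move=> /andP[-> tY]; exact: lt_le_trans YX.
split; [by move=> t /YX'; exact: da|exact: wcontW wd|].
by exists A => t /YX'; exact: aA.
Qed.

Lemma wdiff_lip X g a d : g < 1 -> 0 <= g -> wdiff X g a d ->
  exists2 K, 0 <= K & forall s t, 0 < s < t -> t < X ->
    `|a t - a s| <= K * ((t - s) * t `^ (- g)).
Proof.
move=> g1 g0 wa; have [da [_ [M M0 dM]] _] := wa.
have K0 : 0 < 1 - g by rewrite subr_gt0.
exists (M / (1 - g)); first by rewrite divr_ge0// ltW.
move=> s t /[dup] st0 /andP[s0 st] tX; have t0 := lt_trans s0 st.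
have powd (x : R) : 0 < x -> is_derive x 1 (fun y => M * (y `^ (1 - g) / (1 - g))) (M * x `^ (- g)).
  move=> x0; have h := is_derive_powR_div K0 x0.
  by apply: is_derive_eq; rewrite /GRing.scale/= addrAC subrr add0r.
have cpow : {within `[s, t], continuous (fun y => M * (y `^ (1 - g) / (1 - g)))}.
  apply: continuous_in_subspaceT => x; rewrite inE/= in_itv/= => /andP[sx _].
  by apply: is_derive_continuous (powd _ _); exact: lt_le_trans sx.
have ca : {within `[s, t], continuous a}.
  apply: continuous_in_subspaceT => x; rewrite inE/= in_itv/= => /andP[sx xt].
  by apply: (wdiff_continuous wa); rewrite (lt_le_trans s0 sx) (le_lt_trans xt).
have bnd : M * (t `^ (1 - g) / (1 - g)) - M * (s `^ (1 - g) / (1 - g)) <= M / (1 - g) * ((t - s) * t `^ (- g)).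
  have -> : M * (t `^ (1 - g) / (1 - g)) - M * (s `^ (1 - g) / (1 - g)) =
    M / (1 - g) * (t `^ (1 - g) - s `^ (1 - g)) by ring.
  rewrite ler_wpM2l ?divr_ge0 ?(ltW K0)//.
  rewrite !powRD_gt0// !powRr1 ?(ltW t0) ?(ltW s0)// mulrBl lerD2l lerN2 ler_wpM2l ?(ltW s0)//.
  by apply: powRN_le => //; rewrite s0 ltW.
rewrite ler_norml; apply/andP; split.
  have dF x : x \in `]s, t[ -> is_derive x 1 (fun y => M * (y `^ (1 - g) / (1 - g)) + a y) (M * x `^ (- g) + d x).
    rewrite in_itv/= => /andP[sx xt]; have x0 := lt_trans s0 sx.
    have h1 := powd x x0; have h2 : is_derive x 1 a (d x) by apply: da; rewrite x0 (lt_trans xt).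
    exact: is_deriveD.
  have [c] := MVT st dF (fun x => continuousD (cpow x) (ca x)).
  rewrite in_itv/= => /andP[sc ct] h.
  have : 0 <= (M * c `^ (- g) + d c) * (t - s).
    rewrite mulr_ge0// ?subr_ge0 ?(ltW st)//.
    have := dM c; rewrite (lt_trans s0 sc) (lt_trans ct tX) => /(_ isT); rewrite ler_norml; lra.
  rewrite -h; lra.
have dF x : x \in `]s, t[ -> is_derive x 1 (fun y => M * (y `^ (1 - g) / (1 - g)) - a y) (M * x `^ (- g) - d x).
  rewrite in_itv/= => /andP[sx xt]; have x0 := lt_trans s0 sx.
  have h1 := powd x x0; have h2 : is_derive x 1 a (d x) by apply: da; rewrite x0 (lt_trans xt).
  exact: is_deriveB.
have [c] := MVT st dF (fun x => continuousB (cpow x) (ca x)).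
rewrite in_itv/= => /andP[sc ct] h.
have : 0 <= (M * c `^ (- g) - d c) * (t - s).
  rewrite mulr_ge0// ?subr_ge0 ?(ltW st)//.
  have := dM c; rewrite (lt_trans s0 sc) (lt_trans ct tX) => /(_ isT); rewrite ler_norml; lra.
rewrite -h; lra.
Qed.

(* The derivative in [t] of [(t - s) `^ (b - 1) * (a t - a s) / Gamma b], where [d] is the
   derivative of [a]: integrating it gives the commutator of [RLint b] with [a]. *)
Definition mker (a d : R -> R) (b t s : R) : R :=
  (Gamma b)^-1 * ((b - 1) * (t - s) `^ (b - 2) * (a t - a s) + (t - s) `^ (b - 1) * d t).

Definition mop (a d : R -> R) (b : R) (u : R -> R) (t : R) : R :=
  \int[mu]_(s in `]0, t[) (mker a d b t s * u s).

Lemma mker_bound X g a d b : g < 1 -> 0 <= g -> 0 < b -> wdiff X g a d ->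
  exists2 C, 0 <= C & forall t s, 0 < s < t -> t < X ->
    `|mker a d b t s| <= C * ((t - s) `^ (b - 1) * t `^ (- g)).
Proof.
move=> g1 g0 b0 wa; have [K K0 aK] := wdiff_lip g1 g0 wa.
have [da [_ [M M0 dM]] _] := wa.
exists ((Gamma b)^-1 * (`|b - 1| * K + M)).
  by rewrite mulr_ge0 ?invGamma_ge0// addr_ge0// mulr_ge0.
move=> t s /[dup] st0 /andP[s0 st] tX; have ts0 : 0 < t - s by rewrite subr_gt0.
have t0 := lt_trans s0 st.
rewrite /mker normrM (ger0_norm (invGamma_ge0 b0)) -!mulrA ler_wpM2l ?invGamma_ge0//.
apply: (le_trans (ler_normD _ _)); rewrite [leRHS]mulrDl lerD//.
  rewrite !normrM -!mulrA ler_wpM2l// (ger0_norm (powR_ge0 _ _)).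
  apply: (le_trans (ler_wpM2l (powR_ge0 _ _) (aK _ _ st0 tX))).
  rewrite mulrCA ler_wpM2l// mulrA ler_wpM2r ?powR_ge0//.
  rewrite -{2}[t - s](powRr1 (ltW ts0)) -powRD_gt0//.
  by have -> : b - 2 + 1 = b - 1 by ring.
rewrite normrM (ger0_norm (powR_ge0 _ _)) mulrCA ler_wpM2l ?powR_ge0//.
by apply: dM; rewrite t0.
Qed.

Lemma measurable_mker X g a d b t : wdiff X g a d -> 0 < t < X ->
  measurable_fun `]0, t[ (mker a d b t).
Proof.
move=> wa /andP[t0 tX]; apply: measurable_funM => //; apply: measurable_funD.
  apply: measurable_funM.
    apply: measurable_funM => //; apply: (measurableT_comp (measurable_powR _)).
    exact: measurable_funB.
  apply: measurable_funB => //; apply: cont_oo_measurable => x /andP[x0 xt].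
  by apply: (wdiff_continuous wa); rewrite x0 (lt_trans xt).
apply: measurable_powRM => //; exact: measurable_funB.
Qed.

Lemma mop_kernel_bound X g a d b u : g < 1 -> 0 <= g -> 0 < b -> wdiff X g a d -> wcont X g u ->
  exists2 C, 0 <= C & forall t s, 0 < s < t -> t < X ->
    `|mker a d b t s * u s| <= C * t `^ (- g) * ker b g t s.
Proof.
move=> g1 g0 b0 wa [_ [M M0 uM]]; have [C C0 mC] := mker_bound g1 g0 b0 wa.
exists (C * M); first exact: mulr_ge0.
move=> t s /[dup] st0 /andP[s0 st] tX.
have us : `|u s| <= M * s `^ (- g) by apply: uM; rewrite s0 (lt_trans st).
rewrite normrM (le_trans (ler_pM _ _ (mC _ _ st0 tX) us))//.
suff -> : C * ((t - s) `^ (b - 1) * t `^ (- g)) * (M * s `^ (- g)) = C * M * t `^ (- g) * ker b g t s by [].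
rewrite /ker; ring.
Qed.

Lemma measurable_mop_kernel X g a d b u t : wdiff X g a d -> wcont X g u -> 0 < t < X ->
  measurable_fun `]0, t[ (fun s => mker a d b t s * u s).
Proof.
move=> wa wu tX; apply: measurable_funM; first exact: measurable_mker wa tX.
by apply: (wcont_measurable wu); case/andP: tX => _ /ltW.
Qed.

Lemma mop_wcont X g a d b u : g < 1 -> 0 <= g -> 0 < b -> g <= b ->
  wdiff X g a d -> wcont X g u -> wcont X g (mop a d b u).
Proof.
move=> g1 g0 b0 gb wa wu; have [C C0 hC] := mop_kernel_bound g1 g0 b0 wa wu.
have [da [cd _] _] := wa; have [cu _] := wu.
have mk := measurable_mop_kernel b wa wu.
split.
  move=> t tX; apply: (volterra_continuous (p := b) (g := g) (q := g) (C := C) _ _ _ _ _ _ tX) => //.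
  move=> x r /andP[x0 xX] /andP[r0 r1].
  have xr : x * r < x by rewrite gtr_pMr.
  have xr0 : 0 < x * r by rewrite mulr_gt0.
  have cl : {for x, continuous (fun y : R => y * r)}.
    by apply: continuousM; [exact: cvg_id|exact: cvg_cst].
  have cs : {for x, continuous (fun y : R => y - y * r)}.
    by apply: continuousB; [exact: cvg_id|exact: cl].
  have cp e : {for x, continuous (fun y : R => (y - y * r) `^ e)}.
    apply: (continuous_comp_at (h := fun y => y `^ e) cs); apply: continuous_powR_gt0.
    by rewrite subr_gt0.
  have xX' : 0 < x < X by rewrite x0.
  have xrX' : 0 < x * r < X by rewrite xr0 (lt_trans xr).
  apply: continuousM; last by apply: (continuous_comp_at cl); exact: cu.
  apply: continuousM; first exact: cvg_cst.
  apply: continuousD; apply: continuousM.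
  - by apply: continuousM; [exact: cvg_cst|exact: cp].
  - apply: continuousB; first exact: (wdiff_continuous wa).
    by apply: (continuous_comp_at cl); exact: (wdiff_continuous wa).
  - exact: cp.
  - exact: cd.
have B0 : 0 < beta b (1 - g) by rewrite beta_gt0 ?subr_gt0.
exists (C * (X `^ (b - g) * beta b (1 - g))).
  by rewrite mulr_ge0// mulr_ge0 ?powR_ge0// ltW.
move=> t /[dup] tX /andP[t0 tX'].
apply: (@le_trans _ _ (C * t `^ (- g) * (t `^ (b - g) * beta b (1 - g)))).
  apply: ker_bounded_integral => //; first exact: mk.
  by move=> s st; exact: hC.
move: (beta b (1 - g)) B0 => B B0.
rewrite -!mulrA ler_wpM2l// mulrC !mulrA ler_wpM2r ?powR_ge0// ler_wpM2r ?(ltW B0)//.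
by rewrite ge0_ler_powR ?nnegrE ?subr_ge0 ?(ltW t0) ?(ltW tX') ?(ltW (lt_trans t0 tX')).
Qed.

Lemma mker_continuous (X g : R) (a d : R -> R) (b s x : R) : wdiff X g a d ->
  0 < s < x -> x < X -> {for x, continuous (fun y : R => mker a d b y s)}.
Proof.
move=> wa /andP[s0 sx] xX; have [da [cd _] _] := wa; have x0 := lt_trans s0 sx.
have xX' : 0 < x < X by rewrite x0.
have cs : {for x, continuous (fun y : R => y - s)}.
  by apply: continuousB; [exact: cvg_id|exact: cvg_cst].
have cp e : {for x, continuous (fun y : R => (y - s) `^ e)}.
  apply: (continuous_comp_at (h := fun y => y `^ e) cs); apply: continuous_powR_gt0.
  by rewrite subr_gt0.
apply: continuousM; first exact: cvg_cst.
apply: continuousD; apply: continuousM.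
- by apply: continuousM; [exact: cvg_cst|exact: cp].
- by apply: continuousB; [exact: (wdiff_continuous wa)|exact: cvg_cst].
- exact: cp.
- exact: cd.
Qed.

Lemma mker_integrable X g a d b s t : g < 1 -> 0 <= g -> 0 < b -> wdiff X g a d ->
  0 < s < t -> t < X -> mu.-integrable `]s, t[ (EFin \o (fun x => mker a d b x s)).
Proof.
move=> g1 g0 b0 wa /andP[s0 st] tX; have [C C0 hC] := mker_bound g1 g0 b0 wa.
have sX x : s < x < t -> 0 < s < x /\ x < X.
  by move=> /andP[sx xt]; rewrite s0 sx (lt_trans xt).
have ib : mu.-integrable `]s, t[ (fun x => (C * s `^ (- g) * (x - s) `^ (b - 1))%:E).
  rewrite (_ : (fun _ => _) = (fun x : TR => (C * s `^ (- g))%:E * ((x - s) `^ (b - 1))%:E)%E); last first.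
    by apply/funext => x; rewrite EFinM.
  apply: integrableZl => //; apply/integrableP; split.
    apply/measurable_EFinP; apply: (measurableT_comp (measurable_powR _)); exact: measurable_funB.
  under eq_integral do rewrite /= ger0_norm ?powR_ge0//.
  have := integral_beta_kernel 1 b st; rewrite eBetaE// -EFinM => h.
  under eq_integral => x _.
    rewrite -[(x - s) `^ (b - 1)]mul1r -[X in X * _](powRr0 (t - x)) -[X in _ `^ X * _](subrr 1).
    over.
  by rewrite h ltry.
apply: (@le_integrable _ TR _ _ _ _ _ (fun x => (C * s `^ (- g) * (x - s) `^ (b - 1))%:E)) => //.
- apply/measurable_EFinP; apply: cont_oo_measurable => x /sX[sx xX].
  exact: mker_continuous wa sx xX.
- move=> x; rewrite /= in_itv/= => /[dup] /sX [sx' xX] /andP[sx xt].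
  rewrite lee_fin (le_trans (hC _ _ sx' xX))// ger0_norm ?mulr_ge0 ?powR_ge0//.
  rewrite -mulrA ler_wpM2l// mulrC ler_wpM2r ?powR_ge0//.
  by apply: powRN_le => //; rewrite s0 ltW.
Qed.

Lemma mker_FTC X g a d b s t : g < 1 -> 0 <= g -> 0 < b -> wdiff X g a d -> 0 < s < t -> t < X ->
  \int[mu]_(x in `]s, t[) mker a d b x s = (Gamma b)^-1 * ((t - s) `^ (b - 1) * (a t - a s)).
Proof.
move=> g1 g0 b0 wa /andP[s0 st] tX; have [da [cd _] _] := wa.
have [K K0 aK] := wdiff_lip g1 g0 wa.
have [C C0 hC] := mker_bound g1 g0 b0 wa.
pose P x := (Gamma b)^-1 * ((x - s) `^ (b - 1) * (a x - a s)).
have dP x : s < x < X -> is_derive x 1 P (mker a d b x s).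
  move=> /andP[sx xX]; have x0 := lt_trans s0 sx.
  have xs0 : 0 < x - s by rewrite subr_gt0.
  have h1 := @is_derive1_powR R (b - 1) (x - s) xs0.
  have h2 : is_derive x 1 a (d x) by apply: da; rewrite x0.
  have h3 : is_derive x 1 (fun y => (y - s) `^ (b - 1)) ((b - 1) * (x - s) `^ (b - 1 - 1)).
    have hs : is_derive x 1 (fun y => y - s) 1 by apply: is_derive_eq; rewrite subr0.
    have := @is_derive1_comp R (fun y => y `^ (b - 1)) (fun y => y - s) x _ _ h1 hs.
    by rewrite mulr1.
  apply: is_derive_eq; rewrite /mker /GRing.scale/=.
  have -> : b - 1 - 1 = b - 2 by ring.
  ring.
have cm (x : R) : s < x < X -> {for x, continuous (fun y : R => mker a d b y s)}.
  move=> /andP[sx xX]; have h : 0 < s < x by rewrite s0.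
  exact: (mker_continuous wa h xX).
have sX x : s < x < t -> s < x < X by move=> /andP[-> xt]; exact: lt_trans tX.
transitivity (P t - P s); last by rewrite /P (subrr (a s)) mulr0 mulr0 subr0.
apply: integral_FTC_oo => //.
- by move=> x /sX; exact: dP.
- by move=> x /sX; exact: cm.
- apply/continuous_within_itvP => //; split.
  + by move=> x; rewrite in_itv/= => /sX/dP; exact: is_derive_continuous.
  + have -> : P s = 0 by rewrite /P (subrr (a s)) mulr0 mulr0.
    apply/cvgrPdist_le => e e0.
    pose K' := (Gamma b)^-1 * (K * s `^ (- g)).
    have K'0 : 0 <= K' by rewrite mulr_ge0 ?invGamma_ge0 ?mulr_ge0 ?powR_ge0.
    have eK0 : 0 < e / (K' + 1) by rewrite divr_gt0// ltr_wpDl.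
    near=> x; rewrite sub0r normrN.
    have sx : s < x by near: x; exact: nbhs_right_gt.
    have xX : x < X by apply: (lt_trans _ tX); near: x; exact: nbhs_right_lt.
    have xs0 : 0 < x - s by rewrite subr_gt0.
    have s0x : 0 < s < x by rewrite s0.
    rewrite /P normrM (ger0_norm (invGamma_ge0 b0)) normrM (ger0_norm (powR_ge0 _ _)).
    apply: (@le_trans _ _ ((Gamma b)^-1 * (K * s `^ (- g)) * (x - s) `^ b)).
      rewrite -!mulrA ler_wpM2l ?invGamma_ge0//.
      apply: (le_trans (ler_wpM2l (powR_ge0 _ _) (aK _ _ s0x xX))).
      rewrite mulrCA ler_wpM2l// mulrA mulrC ler_pM ?mulr_ge0 ?powR_ge0 ?(ltW xs0)//.
        by apply: powRN_le => //; rewrite s0 ltW.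
      rewrite -{2}[x - s](powRr1 (ltW xs0)) -powRD_gt0//.
      by have -> : b - 1 + 1 = b by ring.
    have xr : (x - s) `^ b <= e / (K' + 1).
      have -> : e / (K' + 1) = ((e / (K' + 1)) `^ (b^-1)) `^ b.
        by rewrite -powRrM mulVf ?gt_eqF// powRr1 ?(ltW eK0).
      rewrite ge0_ler_powR ?nnegrE ?(ltW b0) ?(ltW xs0) ?powR_ge0//.
      rewrite lerBlDl; near: x; apply: nbhs_right_le.
      by rewrite ltrDl powR_gt0.
    apply: (le_trans (ler_wpM2l K'0 xr)).
    rewrite mulrA ler_pdivrMr; last lra.
    nra.
  + apply: cvg_at_left_filter; apply: is_derive_continuous (dP _ _).
    by rewrite st.
- by apply: (mker_integrable g1 g0 b0 wa _ tX); rewrite s0.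
Unshelve. all: by end_near. Qed.

Lemma mul_RLint X g a d b u t : g < 1 -> 0 <= g -> 0 < b -> g <= b ->
  wdiff X g a d -> wcont X g u -> 0 < t < X ->
  a t * RLint b u t = RLint b (fun s => a s * u s) t + RLint 1 (mop a d b u) t.
Proof.
move=> g1 g0 b0 gb wa wu /[dup] tX /andP[t0 tX']; have wau := wdiff_mul wa wu.
have wm := mop_wcont g1 g0 b0 gb wa wu.
have [C C0 hC] := mop_kernel_bound g1 g0 b0 wa wu.
have mt v : wcont X g v -> measurable_fun `]0, t[ v.
  by move=> wv; apply: (wcont_measurable wv); exact: ltW.
rewrite (RLintE b0 (mt _ wu)) (RLintE b0 (mt _ wau)) (RLintE ltr01 (mt _ wm)) Gamma1 invr1 mul1r.
have -> : \int[mu]_(s in `]0, t[) ((t - s) `^ (1 - 1) * mop a d b u s) =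
    \int[mu]_(x in `]0, t[) \int[mu]_(s in `]0, x[) (mker a d b x s * u s).
  by apply: eq_Rintegral => x _; rewrite subrr powRr0 mul1r.
rewrite (@fubini_volterra R t 1 g b g C)//; last 3 first.
- lra.
- have mc (v : R -> R) : (forall y, 0 < y < X -> {for y, continuous v}) ->
    measurable_fun [set z : TR * TR | 0 < z.2 < z.1 /\ z.1 < t] (fun z => v z.1) /\
    measurable_fun [set z : TR * TR | 0 < z.2 < z.1 /\ z.1 < t] (fun z => v z.2).
    move=> cv; have mv : measurable_fun `]0, t[ v.
      by apply: cont_oo_measurable => y /andP[y0 yt]; apply: cv; rewrite y0 (lt_trans yt).
    split; [apply: (@measurable_comp _ _ _ _ _ _ `]0, t[ v _ fst) => //|
            apply: (@measurable_comp _ _ _ _ _ _ `]0, t[ v _ snd) => //];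
      try exact: measurable_funTS;
      move=> _ [z /= [/andP[z1 z2] z3] <-]; rewrite in_itv/= ?z1 ?z3 ?(lt_trans z1 z2) ?(lt_trans z2 z3)//.
  have [da [cd _] _] := wa; have [cu _] := wu.
  have [ma1 ma2] := mc a (fun y yX => wdiff_continuous wa yX).
  have [md1 _] := mc d cd; have [_ mu2] := mc u cu.
  have ms : measurable_fun [set z : TR * TR | 0 < z.2 < z.1 /\ z.1 < t] (fun z => z.1 - z.2).
    by apply: measurable_funB; exact: measurable_funTS.
  apply: measurable_funM => //; apply: measurable_funM => //; apply: measurable_funD.
    apply: measurable_funM; last exact: measurable_funB.
    by apply: measurable_funM => //; exact: (measurableT_comp (measurable_powR _)).
  exact: measurable_powRM.
- move=> x s sx xt; rewrite subrr powRr0 mul1r; apply: hC => //.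
  exact: lt_trans tX'.
have iu := integrable_RLint g1 b0 wu tX; have iau := integrable_RLint g1 b0 wau tX.
have -> : \int[mu]_(s in `]0, t[) \int[mu]_(x in `]s, t[) (mker a d b x s * u s) =
    \int[mu]_(s in `]0, t[) ((Gamma b)^-1 * (a t * ((t - s) `^ (b - 1) * u s) - (t - s) `^ (b - 1) * (a s * u s))).
  apply: eq_Rintegral => s; rewrite inE/= in_itv/= => st.
  rewrite RintegralZr//; last exact: (mker_integrable g1 g0 b0 wa st tX').
  rewrite (mker_FTC g1 g0 b0 wa st tX'); ring.
have iz (c : R) (h : R -> R) : mu.-integrable `]0, t[ (EFin \o h) ->
    mu.-integrable `]0, t[ (EFin \o (fun s => c * h s)).
  move=> ih; rewrite (_ : _ \o _ = (fun x : TR => c%:E * (EFin \o h) x)%E); first exact: integrableZl.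
  by apply/funext => x; rewrite /= EFinM.
rewrite RintegralZl//; last first.
  have := @integrableB _ TR _ mu _ (measurable_itv `]0, t[) _ _ (iz (a t) _ iu) iau.
  by apply: eq_integrable => // x _; rewrite /= EFinB.
rewrite RintegralB//; last exact: iz.
rewrite RintegralZl//; ring.
Qed.

End ProductKernel.

Section ProductOperator.
Context {R : realType}.
Local Notation mu := (@lebesgue_measure R).

Lemma powR_le_expR_scaled (eta lam r : R) : 0 < eta -> 0 < lam -> 0 < r ->
  r `^ eta <= eta `^ eta * lam `^ (- eta) * expR (lam * r).
Proof.
move=> e0 l0 r0; have lr : 0 < lam * r by rewrite mulr_gt0.
have := powR_le_expR e0 lr; rewrite powRM ?(ltW l0) ?(ltW r0)// => h.
rewrite powRN -mulrA mulrCA mulrC ler_pdivlMr ?powR_gt0// mulrC.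
by rewrite (le_trans h).
Qed.

Lemma exp_ker_bound (p g eta lam t D : R) (h : R -> R) : 0 < eta < p -> g < 1 -> 0 < lam ->
  0 < t -> 0 <= D -> measurable_fun `]0, t[ h ->
  (forall s, 0 < s < t -> `|h s| <= D * ((t - s) `^ (p - 1) * (s `^ (- g) * expR (lam * s)))) ->
  `|\int[mu]_(s in `]0, t[) h s| <=
    D * (eta `^ eta * lam `^ (- eta)) * expR (lam * t) * (t `^ (p - eta - g) * beta (p - eta) (1 - g)).
Proof.
move=> /andP[e0 ep] g1 l0 t0 D0 mh hb; apply: ker_bounded_integral => //; first by rewrite subr_gt0.
move=> s /[dup] st0 /andP[s0 st]; apply: (le_trans (hb _ st0)).
have ts0 : 0 < t - s by rewrite subr_gt0.
have E : D * ((t - s) `^ (p - 1) * (s `^ (- g) * expR (lam * s))) =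
    D * ker (p - eta) g t s * ((t - s) `^ eta * expR (lam * s)).
  rewrite /ker; have -> : p - 1 = (p - eta - 1) + eta by ring.
  rewrite (powRD_gt0 (p - eta - 1) eta ts0); ring.
rewrite E [leRHS](_ : _ = D * ker (p - eta) g t s * (eta `^ eta * lam `^ (- eta) * expR (lam * t))); last by ring.
apply: ler_wpM2l; first by rewrite mulr_ge0// ker_ge0.
apply: (le_trans (ler_wpM2r (expR_ge0 _) (powR_le_expR_scaled e0 l0 ts0))).
rewrite -[leLHS]mulrA -expRD ler_wpM2l//; first by rewrite mulr_ge0 ?powR_ge0.
by have -> : lam * (t - s) + lam * s = lam * t by ring.
Qed.

(* The function whose integral of order [g] is [a * RLint (g + delta) u], see [RLint_prodop]. *)
Definition prodop (g : R) (a d : R -> R) (delta : R) (u : R -> R) (t : R) : R :=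
  RLint delta (fun s => a s * u s) t + RLint (1 - g) (mop a d (g + delta) u) t.

Variables (X g : R).
Hypotheses (g0 : 0 < g) (g1 : g < 1).

Let g_ge0 : 0 <= g. Proof. exact: ltW. Qed.
Let h_gt0 : 0 < 1 - g. Proof. by rewrite subr_gt0. Qed.

Lemma prodop_wcont a d delta u : 0 <= delta -> wdiff X g a d -> wcont X g u ->
  wcont X g (prodop g a d delta u).
Proof.
move=> d0 wa wu; apply: wcontD; apply: wcont_RLint => //.
- exact: wdiff_mul wa wu.
- exact: ltW.
- by apply: mop_wcont => //; [exact: ltr_wpDr|rewrite lerDl].
Qed.

Lemma RLint_prodop a d delta u t : 0 <= delta -> wdiff X g a d -> wcont X g u -> 0 < t < X ->
  RLint g (prodop g a d delta u) t = a t * RLint (g + delta) u t.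
Proof.
move=> d0 wa wu tX; have gd0 : 0 < g + delta by exact: ltr_wpDr.
have gd : g <= g + delta by rewrite lerDl.
have wau := wdiff_mul wa wu.
have wm : wcont X g (mop a d (g + delta) u) by exact: mop_wcont.
rewrite (RLintD g1 g_ge0 (wcont_RLint g1 d0 wau) (wcont_RLint g1 (ltW h_gt0) wm) tX).
rewrite (RLint_semigroup g1 g_ge0 g_ge0 d0 wau tX).
rewrite (RLint_semigroup g1 g_ge0 g_ge0 (ltW h_gt0) wm tX).
have -> : g + (1 - g) = 1 by ring.
by rewrite (mul_RLint g1 g_ge0 gd0 gd wa wu tX).
Qed.

Lemma mopD a d b u v t : 0 < b -> wdiff X g a d -> wcont X g u -> wcont X g v -> 0 < t < X ->
  mop a d b (fun s => u s + v s) t = mop a d b u t + mop a d b v t.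
Proof.
move=> b0 wa wu wv /[dup] tX /andP[t0 tX'].
have im w : wcont X g w -> mu.-integrable `]0, t[ (EFin \o (fun s => mker a d b t s * w s)).
  move=> ww; have [C C0 hC] := mop_kernel_bound g1 g_ge0 b0 wa ww.
  apply: (@ker_bounded_integrable R b g t (C * t `^ (- g))) => //.
    exact: measurable_mop_kernel wa ww tX.
  by move=> s st; exact: hC.
rewrite /mop -RintegralD//; [|exact: im|exact: im].
by apply: eq_Rintegral => s _; rewrite mulrDr.
Qed.

Lemma prodopD a d delta u v t : 0 <= delta -> wdiff X g a d -> wcont X g u -> wcont X g v ->
  0 < t < X -> prodop g a d delta (fun s => u s + v s) t = prodop g a d delta u t + prodop g a d delta v t.
Proof.
move=> d0 wa wu wv /[dup] tX /andP[t0 tX']; have gd0 : 0 < g + delta by exact: ltr_wpDr.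
have gd : g <= g + delta by rewrite lerDl.
have wau := wdiff_mul wa wu; have wav := wdiff_mul wa wv.
have wmu := mop_wcont g1 g_ge0 gd0 gd wa wu; have wmv := mop_wcont g1 g_ge0 gd0 gd wa wv.
have wuv := wcontD wu wv.
have muv := mop_wcont g1 g_ge0 gd0 gd wa wuv.
rewrite /prodop addrACA -(RLintD g1 d0 wau wav tX) -(RLintD g1 (ltW h_gt0) wmu wmv tX).
congr (_ + _).
  by congr (RLint _ _ _); apply/funext => s; rewrite mulrDr.
apply: eq_RLint => //.
- exact: ltW.
- by apply: (wcont_measurable muv); exact: ltW.
- by move=> s /andP[s0 st]; rewrite (mopD gd0 wa wu wv)// s0 (lt_trans st).
- exact: mopD.
Qed.

Lemma prodop_ext a d delta u v t : 0 <= delta -> wdiff X g a d -> wcont X g v ->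
  (forall s, 0 < s < X -> u s = v s) -> 0 < t < X -> prodop g a d delta u t = prodop g a d delta v t.
Proof.
move=> d0 wa wv uv /[dup] tX /andP[t0 tX']; have gd0 : 0 < g + delta by exact: ltr_wpDr.
have gd : g <= g + delta by rewrite lerDl.
have wu := wcont_ext uv wv.
have st s : 0 < s < t -> 0 < s < X by move=> /andP[-> h]; exact: lt_trans tX'.
have muv s : 0 < s < X -> mop a d (g + delta) u s = mop a d (g + delta) v s.
  move=> /andP[s0 sX]; apply: eq_Rintegral => r; rewrite inE/= in_itv/= => /andP[r0 rs].
  by rewrite uv// r0 (lt_trans rs).
congr (_ + _); apply: eq_RLint => //.
- by apply: (wcont_measurable (wdiff_mul wa wu)); exact: ltW.
- by move=> s /st sX; rewrite uv.
- by rewrite uv.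
- exact: ltW.
- by apply: (wcont_measurable (mop_wcont g1 g_ge0 gd0 gd wa wu)); exact: ltW.
- by move=> s /st; exact: muv.
- exact: muv.
Qed.

Lemma prodop_contraction a d delta eta : 0 < eta < delta -> wdiff X g a d ->
  exists2 C, 0 <= C & forall lam N x u, 0 < lam -> 0 <= N -> x <= X -> wcont X g u ->
    (forall t, 0 < t < x -> `|u t| <= N * (t `^ (- g) * expR (lam * t))) ->
    forall t, 0 < t < x -> `|prodop g a d delta u t| <= C * lam `^ (- eta) * N * (t `^ (- g) * expR (lam * t)).
Proof.
move=> /[dup] ed /andP[e0 ed'] wa; have d0 := lt_trans e0 ed'.
have b0 : 0 < g + delta by rewrite addr_gt0.
have [_ _ [A aA]] := wa.
have [C C0 hC] := mker_bound g1 g_ge0 b0 wa.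
have de0 : 0 < delta - eta by rewrite subr_gt0.
have ebd : 0 < eta < g + delta by rewrite e0 (lt_trans ed')// ltrDr.
have gde0 : 0 < g + delta - eta by rewrite subr_gt0; case/andP: ebd.
pose c1 := `|A| * eta `^ eta * X `^ (delta - eta) * beta (delta - eta) (1 - g) / Gamma delta.
pose c2 := C * eta `^ eta * X `^ (delta - eta) * beta (g + delta - eta) (1 - g).
pose c3 := c2 * X `^ (1 - g) * beta (1 - g) (1 - g) / Gamma (1 - g).
have c10 : 0 <= c1.
  rewrite /c1 mulr_ge0 ?invGamma_ge0// mulr_ge0 ?(ltW (beta_gt0 _ _))//.
  by rewrite !mulr_ge0 ?powR_ge0.
have c20 : 0 <= c2.
  by rewrite /c2 mulr_ge0 ?(ltW (beta_gt0 _ _))// !mulr_ge0 ?powR_ge0.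
have c30 : 0 <= c3.
  apply: mulr_ge0; [|exact: invGamma_ge0]; apply: mulr_ge0; [|by rewrite ltW// beta_gt0].
  by apply: mulr_ge0 => //; exact: powR_ge0.
exists (c1 + c3); first exact: addr_ge0.
move=> lam N x u l0 N0 xX wu ub t /andP[t0 tx].
have X0 : 0 < X by rewrite (lt_le_trans _ xX)// (lt_trans t0).
have tX s : 0 < s -> s <= t -> 0 < s < X.
  by move=> s0 st; rewrite s0 (lt_le_trans _ xX)// (le_lt_trans st).
have powX e s : 0 < e -> 0 < s -> s <= t -> s `^ e <= X `^ e.
  move=> e0' s0 st; rewrite ge0_ler_powR ?nnegrE ?(ltW e0') ?(ltW s0) ?(ltW X0)//.
  by case/andP: (tX _ s0 st) => _ /ltW.
have wau := wdiff_mul wa wu.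
have B1 : `|RLint delta (fun s => a s * u s) t| <= c1 * lam `^ (- eta) * N * (t `^ (- g) * expR (lam * t)).
  rewrite RLintE//; last first.
    by apply: (wcont_measurable wau); case/andP: (tX _ t0 (lexx t)) => _ /ltW.
  rewrite normrM (ger0_norm (invGamma_ge0 d0)).
  have := @exp_ker_bound delta g eta lam t (`|A| * N) (fun s => (t - s) `^ (delta - 1) * (a s * u s))
    ed g1 l0 t0 (mulr_ge0 (normr_ge0 _) N0).
  move=> /(_ _ _) h; apply: (le_trans (ler_wpM2l (invGamma_ge0 d0) (h _ _))).
  - apply: measurable_powRM; first exact: measurable_funB.
    by apply: (wcont_measurable wau); case/andP: (tX _ t0 (lexx t)) => _ /ltW.
  - move=> s /andP[s0 st]; rewrite normrM (ger0_norm (powR_ge0 _ _)) mulrCA ler_wpM2l ?powR_ge0//.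
    rewrite normrM -mulrA ler_pM// ?ub ?s0 ?(lt_trans st)//.
    by rewrite (le_trans (aA _ (tX _ s0 (ltW st))))// ler_norm.
  rewrite (powRD_gt0 (delta - eta) (- g) t0) /c1.
  have := powX _ _ de0 t0 (lexx t); have := @beta_gt0 R _ _ de0 h_gt0; have := invGamma_ge0 d0.
  move: (beta _ _) (Gamma _)^-1 (X `^ (delta - eta)) (t `^ (delta - eta)) => B G P Q G0 B0 QP.
  rewrite [leLHS](_ : _ = (G * `|A| * N * eta `^ eta * lam `^ (- eta) * expR (lam * t) * t `^ (- g) * B) * Q); last by ring.
  rewrite [leRHS](_ : _ = (G * `|A| * N * eta `^ eta * lam `^ (- eta) * expR (lam * t) * t `^ (- g) * B) * P); last by ring.
  by rewrite ler_wpM2l// !mulr_ge0 ?powR_ge0 ?expR_ge0 ?(ltW B0).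
have B2 s : 0 < s -> s <= t -> `|mop a d (g + delta) u s| <= c2 * lam `^ (- eta) * N * (s `^ (- g) * expR (lam * s)).
  move=> s0 st; have sX := tX _ s0 st.
  have := @exp_ker_bound (g + delta) g eta lam s (C * s `^ (- g) * N) (fun r => mker a d (g + delta) s r * u r)
    ebd g1 l0 s0 (mulr_ge0 (mulr_ge0 C0 (powR_ge0 _ _)) N0).
  move=> /(_ _ _) h; apply: (le_trans (h _ _)).
  - exact: measurable_mop_kernel wa wu sX.
  - move=> r /[dup] rs' /andP[r0 rs]; have sX' : s < X by case/andP: sX.
    have ur : `|u r| <= N * (r `^ (- g) * expR (lam * r)).
      by apply: ub; rewrite r0 (lt_trans rs)// (le_lt_trans st).
    rewrite normrM (le_trans (ler_pM _ _ (hC _ _ rs' sX') ur))//.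
    by rewrite le_eqVlt; apply/orP; left; apply/eqP; ring.
  have -> : g + delta - eta - g = delta - eta by ring.
  rewrite /c2; have := powX _ _ de0 s0 st; have := @beta_gt0 R _ _ gde0 h_gt0.
  move: (beta _ _) (X `^ (delta - eta)) (s `^ (delta - eta)) => B P Q B0 QP.
  rewrite [leLHS](_ : _ = (C * N * eta `^ eta * lam `^ (- eta) * expR (lam * s) * s `^ (- g) * B) * Q); last by ring.
  rewrite [leRHS](_ : _ = (C * N * eta `^ eta * lam `^ (- eta) * expR (lam * s) * s `^ (- g) * B) * P); last by ring.
  by rewrite ler_wpM2l// !mulr_ge0 ?powR_ge0 ?expR_ge0 ?(ltW B0).
have wm : wcont X g (mop a d (g + delta) u) by apply: mop_wcont => //; rewrite lerDl ltW.
have B3 : `|RLint (1 - g) (mop a d (g + delta) u) t| <= c3 * lam `^ (- eta) * N * (t `^ (- g) * expR (lam * t)).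
  have := @RLint_bound R (1 - g) g t (c2 * lam `^ (- eta) * N * expR (lam * t)) (mop a d (g + delta) u) h_gt0 g1 t0.
  move=> /(_ _ _) h; apply: (le_trans (h _ _)).
  - by apply: (wcont_measurable wm); case/andP: (tX _ t0 (lexx t)) => _ /ltW.
  - move=> s /andP[s0 st]; apply: (le_trans (B2 _ s0 (ltW st))).
    have k0 : 0 <= c2 * lam `^ (- eta) * N by rewrite mulr_ge0// mulr_ge0// powR_ge0.
    rewrite -[leRHS]mulrA (mulrC (expR _)) ler_wpM2l// ler_wpM2l ?powR_ge0//.
    by rewrite ler_expR ler_wpM2l ?(ltW l0)// ltW.
  rewrite /c3 (powRD_gt0 (1 - g) (- g) t0).
  have := powX _ _ h_gt0 t0 (lexx t); have := @beta_gt0 R _ _ h_gt0 h_gt0; have := invGamma_ge0 h_gt0.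
  move: (beta _ _) (Gamma _)^-1 (X `^ (1 - g)) (t `^ (1 - g)) => B G P Q G0 B0 QP.
  rewrite [leLHS](_ : _ = (G * c2 * N * lam `^ (- eta) * expR (lam * t) * t `^ (- g) * B) * Q); last by ring.
  rewrite [leRHS](_ : _ = (G * c2 * N * lam `^ (- eta) * expR (lam * t) * t `^ (- g) * B) * P); last by ring.
  rewrite ler_wpM2l//; apply: mulr_ge0; [|exact: ltW]; apply: mulr_ge0; [|exact: powR_ge0].
  apply: mulr_ge0; [|exact: expR_ge0]; apply: mulr_ge0; [|exact: powR_ge0].
  by apply: mulr_ge0 => //; exact: mulr_ge0.
apply: (le_trans (ler_normD _ _)); rewrite [leRHS](_ : _ = c1 * lam `^ (- eta) * N * (t `^ (- g) * expR (lam * t)) +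
  c3 * lam `^ (- eta) * N * (t `^ (- g) * expR (lam * t))); last by ring.
by rewrite lerD.
Qed.

End ProductOperator.

(** * Neumann series *)

Section Neumann.
Context {R : realType}.
Variables (X g lam : R) (L : (R -> R) -> R -> R).
Hypotheses (lam_gt0 : 0 < lam).
Hypothesis L_wcont : forall u, wcont X g u -> wcont X g (L u).
Hypothesis L_add : forall u v t, wcont X g u -> wcont X g v -> 0 < t < X ->
  L (fun s => u s + v s) t = L u t + L v t.
Hypothesis L_ext : forall u v, wcont X g v -> (forall s, 0 < s < X -> u s = v s) ->
  forall t, 0 < t < X -> L u t = L v t.
Hypothesis L_contr : forall N u, 0 <= N -> wcont X g u ->
  (forall t, 0 < t < X -> `|u t| <= N * (t `^ (- g) * expR (lam * t))) ->
  forall t, 0 < t < X -> `|L u t| <= 2^-1 * N * (t `^ (- g) * expR (lam * t)).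

Let w t := t `^ (- g) * expR (lam * t).

Let w_ge0 t : 0 <= w t. Proof. by rewrite mulr_ge0 ?powR_ge0 ?expR_ge0. Qed.

Lemma half_pow_small (c e : R) : 0 < e -> exists n, c * 2^-1 ^+ n < e.
Proof.
move=> e0; exists (Num.truncn (c / e)).+1.
rewrite exprVn ltr_pdivrMr ?exprn_gt0// mulrC -ltr_pdivrMr//.
apply: (lt_le_trans (truncnS_gt _)); rewrite -natrX ler_nat.
exact/ltnW/ltn_expl.
Qed.

Lemma le_half_pow_le0 (c x : R) : (forall n, x <= c * 2^-1 ^+ n) -> x <= 0.
Proof.
move=> h; rewrite leNgt; apply/negP => x0; have [n] := half_pow_small c x0.
by rewrite ltNge h.
Qed.

Let wbound u : wcont X g u -> exists2 M, 0 <= M & forall t, 0 < t < X -> `|u t| <= M * w t.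
Proof.
move=> [_ [M M0 uM]]; exists M => // t tX; apply: (le_trans (uM _ tX)).
rewrite ler_wpM2l// ler_peMr ?powR_ge0// -expR0 ler_expR.
by case/andP: tX => /ltW t0 _; rewrite mulr_ge0// ltW.
Qed.

Lemma neumann_unique u : wcont X g u -> (forall t, 0 < t < X -> u t = - L u t) ->
  forall t, 0 < t < X -> u t = 0.
Proof.
move=> wu uL; have [M M0 uM] := wbound wu.
have h n : forall t, 0 < t < X -> `|u t| <= M * 2^-1 ^+ n * w t.
  elim: n => [|n IH] t tX; first by rewrite expr0 mulr1 uM.
  rewrite uL// normrN.
  have -> : M * 2^-1 ^+ n.+1 * w t = 2^-1 * (M * 2^-1 ^+ n) * (t `^ (- g) * expR (lam * t)).
    by rewrite exprS /w; ring.
  by apply: L_contr => //; rewrite mulr_ge0// exprn_ge0.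
move=> t tX; apply/eqP; rewrite -normr_le0; apply: (@le_half_pow_le0 (M * w t)) => n.
by rewrite mulrAC h.
Qed.

Fixpoint neumann (f : R -> R) (k : nat) : R -> R :=
  if k is k'.+1 then fun t => - L (neumann f k') t else fun t => - f t.

Lemma wcontN u : wcont X g u -> wcont X g (fun t => - u t).
Proof.
move=> wu; apply: wcont_ext (wcontZ (-1) wu) => t _.
by rewrite mulN1r.
Qed.

Lemma neumann_wcont f k : wcont X g f -> wcont X g (neumann f k).
Proof. by move=> wf; elim: k => [|k IH] /=; apply: wcontN => //; exact: L_wcont. Qed.

Let L0 t : 0 < t < X -> L (fun _ => 0) t = 0.
Proof.
move=> tX; have w0 := wcont0 X g.
have := L_add w0 w0 tX; rewrite (@L_ext (fun _ => 0 + 0) (fun _ => 0))//; last by move=> s _; rewrite addr0.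
by move/eqP; rewrite -subr_eq subrr => /eqP.
Qed.

Let S f n t := \sum_(0 <= k < n) neumann f k t.

Let S_wcont f n : wcont X g f -> wcont X g (S f n).
Proof. by move=> wf; apply: wcont_sum => k _; exact: neumann_wcont. Qed.

Let S_rec f n t : wcont X g f -> 0 < t < X -> S f n.+1 t = - f t - L (S f n) t.
Proof.
move=> wf tX; elim: n => [|n IH].
  rewrite /S big_nat1 /= (@L_ext _ (fun _ => 0)) ?L0 ?subr0//; first exact: wcont0.
  by move=> s _; rewrite big_geq.
rewrite /S big_nat_recr//= -/(S f n.+1 t) IH -addrA -opprD; congr (_ - _).
rewrite -L_add//; [|exact: S_wcont|exact: neumann_wcont].
apply: L_ext => //; first exact: S_wcont.
by move=> s _; rewrite /S [in RHS]big_nat_recr.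
Qed.

Lemma neumann_exists f : wcont X g f -> exists u,
  [/\ wcont X g u, forall t, 0 < t < X -> u t = - f t - L u t &
    exists2 C, 0 <= C & forall n t, 0 < t < X ->
      `|u t - \sum_(0 <= k < n) neumann f k t| <= C * 2^-1 ^+ n * t `^ (- g)].
Proof.
move=> wf; have [N N0 fN] := wbound wf.
have Wb k : forall t, 0 < t < X -> `|neumann f k t| <= N * 2^-1 ^+ k * w t.
  elim: k => [|k IH] t tX /=; rewrite normrN; first by rewrite expr0 mulr1 fN.
  have -> : N * 2^-1 ^+ k.+1 * w t = 2^-1 * (N * 2^-1 ^+ k) * (t `^ (- g) * expR (lam * t)).
    by rewrite exprS /w; ring.
  apply: L_contr => //; first by rewrite mulr_ge0// exprn_ge0.
  exact: neumann_wcont.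
have Sb n j t : 0 < t < X -> `|S f (n + j) t - S f n t| <= 2 * N * 2^-1 ^+ n * w t * (1 - 2^-1 ^+ j).
  move=> tX; elim: j => [|j IH].
    by rewrite addn0 subrr normr0 expr0 subrr mulr0.
  rewrite /S addnS big_nat_recr//= addrAC (le_trans (ler_normD _ _))//.
  apply: (le_trans (lerD IH (Wb _ _ tX))); rewrite exprD exprS.
  rewrite le_eqVlt; apply/orP; left; apply/eqP.
  by field.
have Sb' n j t : 0 < t < X -> `|S f (n + j) t - S f n t| <= 2 * N * 2^-1 ^+ n * w t.
  move=> tX; apply: (le_trans (Sb _ _ _ tX)); rewrite ler_piMr ?gerBl ?exprn_ge0//.
  by rewrite mulr_ge0// !mulr_ge0// exprn_ge0.
have Sc t : 0 < t < X -> cvgn (fun n => S f n t).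
  move=> tX; apply: normed_cvg.
  apply: (@series_le_cvg _ _ (geometric (N * w t) 2^-1)) => [k|k|k|].
  - exact: normr_ge0.
  - by apply: mulr_ge0; [exact: mulr_ge0|exact: exprn_ge0].
  - by rewrite /= mulrAC; exact: Wb.
  - by apply: is_cvg_geometric_series; rewrite ger0_norm// invf_lt1// ltr1n.
pose u t := limn (fun n => S f n t).
have ub n t : 0 < t < X -> `|u t - S f n t| <= 2 * N * 2^-1 ^+ n * w t.
  move=> tX; apply/ler_addgt0Pr => e e0.
  have /cvgrPdist_lt/(_ e e0) [m _ hm] := Sc t tX.
  have nm : (m <= n + m)%N by rewrite leq_addl.
  have := hm _ nm; rewrite /= -/(u t) => h.
  have -> : u t - S f n t = (S f (n + m) t - S f n t) + (u t - S f (n + m) t) by ring.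
  apply: (le_trans (ler_normD _ _)); apply: lerD; first exact: Sb'.
  exact: ltW.
pose C := 2 * N * expR (lam * X).
have C0 : 0 <= C by rewrite !mulr_ge0 ?expR_ge0.
have ubC n t : 0 < t < X -> `|u t - S f n t| <= C * 2^-1 ^+ n * t `^ (- g).
  move=> tX; apply: (le_trans (ub n t tX)); rewrite /w /C.
  have -> : 2 * N * 2^-1 ^+ n * (t `^ (- g) * expR (lam * t)) =
     (2 * N * 2^-1 ^+ n * t `^ (- g)) * expR (lam * t) by ring.
  have -> : 2 * N * expR (lam * X) * 2^-1 ^+ n * t `^ (- g) =
     (2 * N * 2^-1 ^+ n * t `^ (- g)) * expR (lam * X) by ring.
  rewrite ler_wpM2l//; first by rewrite !mulr_ge0 ?exprn_ge0 ?powR_ge0.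
  by rewrite ler_expR ler_wpM2l ?(ltW lam_gt0)//; case/andP: tX => _ /ltW.
have wu : wcont X g u.
  split.
    move=> t /[dup] tX /andP[t0 tX']; apply/cvgrPdist_lt => e e0.
    have e3 : 0 < e / 3 by rewrite divr_gt0.
    pose K := C * ((t / 2) `^ (- g) + X `^ (- g)).
    have [n ne] := half_pow_small K e3.
    have uK s : t / 2 <= s -> s < X -> `|u s - S f n s| < e / 3.
      move=> ts sX; have s0 : 0 < s by apply: lt_le_trans ts; rewrite divr_gt0.
      apply: le_lt_trans ne; apply: (le_trans (ubC n s _)); first by rewrite s0.
      rewrite mulrAC /K; apply: ler_wpM2r; first exact: exprn_ge0.
      apply: ler_wpM2l => //.
      by apply: powR_le_sum; rewrite ?divr_gt0// ts ltW.
    have [cS _] := S_wcont n wf.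
    have /cvgrPdist_lt/(_ _ e3) := cS t tX => nS.
    near=> s.
    have h1 : t / 2 < s by near: s; apply: lt_nbhsr; rewrite ltr_pdivrMr// ltr_pMr// ltr1n.
    have h2 : s < X by near: s; exact: lt_nbhsl.
    have h3 : `|S f n t - S f n s| < e / 3 by near: s.
    have h4 := uK s (ltW h1) h2.
    have h5 : `|u t - S f n t| < e / 3.
      by apply: uK => //; rewrite ler_pdivrMr// ler_pMr// ler1n.
    have -> : u t - u s = (u t - S f n t) + (S f n t - S f n s) - (u s - S f n s) by ring.
    apply: (le_lt_trans (ler_normB _ _)); apply: (le_lt_trans (lerD (ler_normD _ _) (lexx _))).
    lra.
  have [_ [M M0 fM]] := S_wcont 0 wf.
  exists C => // t tX; have := ubC 0%N t tX.
  by rewrite /S big_geq// subr0 expr0 mulr1.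
exists u; split=> //; last by exists C.
move=> t tX; apply/eqP; rewrite -subr_eq0 -normr_le0.
apply: (@le_half_pow_le0 (2 * N * w t * 2)) => n.
have wS := S_wcont n wf.
have wuS : wcont X g (fun s => u s - S f n s) by apply: wcontD => //; exact: wcontN.
have -> : u t - (- f t - L u t) = (u t - S f n.+1 t) + L (fun s => u s - S f n s) t.
  rewrite S_rec// -(@L_ext (fun s => (u s - S f n s) + S f n s) u)//; last by move=> s _; rewrite subrK.
  rewrite L_add//; ring.
apply: (le_trans (ler_normD _ _)).
have h1 := ub n.+1 t tX.
have h2 : `|L (fun s => u s - S f n s) t| <= 2^-1 * (2 * N * 2^-1 ^+ n) * w t.
  by apply: L_contr => //; [rewrite !mulr_ge0 ?exprn_ge0|move=> s; exact: ub].
apply: (le_trans (lerD h1 h2)); rewrite exprS.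
have : 0 <= N * 2^-1 ^+ n * w t.
  by apply: mulr_ge0 => //; apply: mulr_ge0 => //; exact: exprn_ge0.
move: (w t) (2^-1 ^+ n) => W Q; nra.
Unshelve. all: by end_near. Qed.

End Neumann.

(** * Taylor formula *)

Section Taylor.
Context {R : realType}.
Local Notation mu := (@lebesgue_measure R).
Local Notation TR := (measurableTypeR R).

Lemma is_derive_ext_on (X t l : R) (F G : R -> R) :
  (forall x, 0 < x < X -> F x = G x) -> 0 < t < X -> is_derive t 1 G l -> is_derive t 1 F l.
Proof.
move=> FG /[dup] tX /andP[t0 tX'] /is_derive_dquotP h; apply/is_derive_dquotP => e /h[d d0 dh].
exists (Num.min d (Num.min t (X - t))); first by rewrite !lt_min d0 t0 subr_gt0.
move=> s st; rewrite !lt_min => /and3P[h1 h2 h3].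
have sX : 0 < s < X.
  have := ler_norm (s - t); have := ler_norm (t - s); rewrite (distrC t).
  by move=> ? ?; apply/andP; split; lra.
by rewrite /dquot !FG//; exact: dh.
Qed.

Lemma eq_RLint_wcont (X g p t : R) (f v : R -> R) : 0 <= p -> wcont X g v -> 0 < t < X ->
  (forall s, 0 < s <= t -> f s = v s) -> RLint p f t = RLint p v t.
Proof.
move=> p0 wv /andP[t0 tX] fv.
have oo (s : R) : 0 < s < t -> f s = v s by move=> /andP[s0 /ltW st]; apply: fv; rewrite s0.
apply: eq_RLint => //; last by apply: fv; rewrite t0 lexx.
apply: (@eq_measurable_fun _ _ TR _ _ v); last by apply: (wcont_measurable wv); exact: ltW.
by move=> s; rewrite inE/= in_itv/= => /oo.
Qed.

Lemma RLint1_oo (X g t : R) (u : R -> R) : g < 1 -> wcont X g u -> t < X ->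
  RLint 1 u t = \int[mu]_(s in `]0, t[) u s.
Proof.
move=> g1 wu tX; rewrite RLintE//; last by apply: (wcont_measurable wu); exact: ltW.
rewrite Gamma1 invr1 mul1r; apply: eq_Rintegral => s _.
by rewrite subrr powRr0 mul1r.
Qed.

Lemma is_derive_RLint1 (X g t : R) (u : R -> R) : g < 1 -> wcont X g u -> 0 < t < X ->
  is_derive t 1 (RLint 1 u) (u t).
Proof.
move=> g1 wu /[dup] tX /andP[t0 tX']; have [cu _] := wu.
pose x := (t + X) / 2.
have tx : t < x by rewrite /x; lra.
have xX : x < X by rewrite /x; lra.
have x0 : 0 < x by apply: lt_trans tx.
have ui : mu.-integrable `]0, x[ (EFin \o u) by apply: (wcont_integrable g1 wu); rewrite x0.
have fi := integrable_oo_cc ui; set f0 := _ \_ _ in fi.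
have f0E s : 0 < s < x -> f0 s = u s by move=> sx; rewrite /f0 patchE mem_set.
have tx' : 0 < t < x by rewrite t0.
have cf0 : {for t, continuous f0} by apply: (continuous_eq_on f0E tx'); exact: cu.
have [dG G'] := continuous_FTC1_closed tx fi t0 cf0.
apply: (@is_derive_ext_on x t (u t) _ (fun y => \int[mu]_(s in `[0, y]) f0 s)) => //; last first.
  by apply: DeriveDef; [exact: dG|rewrite -derive1E G' f0E].
move=> y /andP[y0 yx]; rewrite (RLint1_oo g1 wu (lt_trans yx xX)).
rewrite [RHS]/Rintegral integral_itv_bndoo; last first.
  apply/measurable_EFinP; apply: (@measurable_funS _ _ TR _ `[0, x]) => //.
    by move=> s /=; rewrite !in_itv/= => /andP[s0 sy]; rewrite ltW//= ltW// (lt_trans sy).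
  by case/integrableP : fi => /measurable_EFinP.
apply: eq_Rintegral => s; rewrite inE/= in_itv/= => /andP[s0 sy].
by rewrite f0E// s0 (lt_trans sy).
Qed.

Lemma RLint_bound_wcont (X g p : R) (u : R -> R) : g < 1 -> 0 < p -> wcont X g u ->
  exists2 C, 0 <= C & forall t, 0 < t < X -> `|RLint p u t| <= C * t `^ (p - g).
Proof.
move=> g1 p0 wu; have [_ [M M0 uM]] := wu.
exists ((Gamma p)^-1 * M * beta p (1 - g)).
  apply: mulr_ge0; first by apply: mulr_ge0 => //; exact: invGamma_ge0.
  by rewrite ltW// beta_gt0// subr_gt0.
move=> t /andP[t0 tX].
have -> : (Gamma p)^-1 * M * beta p (1 - g) * t `^ (p - g) = (Gamma p)^-1 * M * (t `^ (p - g) * beta p (1 - g)).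
  by move: (beta _ _) => B; ring.
apply: RLint_bound => //; first by apply: (wcont_measurable wu); exact: ltW.
by move=> s /andP[s0 st]; apply: uM; rewrite s0 (lt_trans st).
Qed.

Lemma powR_bound_near0 (X p C e : R) (f : R -> R) : 0 < X -> 0 < p -> 0 <= C -> 0 < e ->
  (forall t, 0 < t < X -> `|f t| <= C * t `^ p) ->
  exists2 d, 0 < d & forall t, 0 < t < d -> `|f t| < e.
Proof.
move=> X0 p0 C0 e0 fC; have eC : 0 < e / (C + 1) by rewrite divr_gt0// ltr_wpDl.
exists (Num.min X ((e / (C + 1)) `^ p^-1)); first by rewrite lt_min X0 powR_gt0.
move=> t; rewrite lt_min => /and3P[t0 tX td].
apply: (@le_lt_trans _ _ (C * (e / (C + 1)))).
  apply: (le_trans (fC t _)); first by rewrite t0.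
  rewrite ler_wpM2l//.
  have -> : e / (C + 1) = ((e / (C + 1)) `^ (p^-1)) `^ p.
    by rewrite -powRrM mulVf ?gt_eqF// powRr1 ?(ltW eC).
  by rewrite ge0_ler_powR ?nnegrE ?(ltW p0) ?(ltW t0) ?powR_ge0 ?(ltW td).
rewrite mulrA ltr_pdivrMr; last lra.
nra.
Qed.

Lemma RLint_near0 (X g p e : R) (u : R -> R) : g < 1 -> 0 <= g -> g < p -> 0 < X ->
  wcont X g u -> 0 < e -> exists2 d, 0 < d & forall t, 0 < t < d -> `|RLint p u t| < e.
Proof.
move=> g1 g0 gp X0 wu e0; have p0 : 0 < p by exact: le_lt_trans gp.
have [C C0 hC] := RLint_bound_wcont g1 p0 wu.
by apply: (powR_bound_near0 X0 _ C0 e0 hC); rewrite subr_gt0.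
Qed.

Lemma has_deriv_RLint1 (T X g t : R) (u : R -> R) : g < 1 -> wcont X g u -> 0 < T < X -> 0 <= t <= T ->
  (t = 0 -> forall e, 0 < e -> exists2 d, 0 < d & forall s, 0 < s < d -> `|u s - u 0| < e) ->
  has_deriv T (RLint 1 u) t (u t).
Proof.
move=> g1 wu /andP[T0 TX] /andP[t0 tT] u0.
move: t0; rewrite le_eqVlt => /predU1P[t0|t0]; last first.
  by apply: is_derive_has_deriv; apply: (is_derive_RLint1 g1 wu); rewrite t0 (le_lt_trans tT).
rewrite -t0; apply/has_derivP => e e0; have e20 : 0 < e / 2 by rewrite divr_gt0.
have [d d0 dh] := u0 (esym t0) _ e20; exists d => // s /andP[s0 sT] sn0; rewrite subr0 => sd.
have s0' : 0 < s by rewrite lt_neqAle eq_sym sn0.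
have sX : s < X by exact: le_lt_trans TX.
rewrite gtr0_norm// in sd.
rewrite /dquot (@RLint_at0 R 1)// subr0 subr0 (RLint1_oo g1 wu sX).
have iu : mu.-integrable `]0, s[ (EFin \o u) by apply: (wcont_integrable g1 wu); rewrite s0'.
have mus : measurable_fun `]0, s[ u by apply: (wcont_measurable wu); exact: ltW.
have ic : mu.-integrable `]0, s[ (EFin \o (fun _ => u 0)).
  apply/integrableP; split; first exact/measurable_EFinP/measurable_cst.
  under eq_integral do rewrite /=.
  by rewrite integral_cst//= lebesgue_measure_itv/= lte_fin s0' -EFinD -EFinM ltry.
have E : \int[mu]_(x in `]0, s[) u x - s * u 0 = \int[mu]_(x in `]0, s[) (u x - u 0).
  rewrite RintegralB//; congr (_ - _).
  by rewrite [RHS]/Rintegral integral_cst//= lebesgue_measure_itv/= lte_fin s0' -EFinD -EFinM/= subr0 mulrC.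
have -> : \int[mu]_(x in `]0, s[) u x / s - u 0 = (\int[mu]_(x in `]0, s[) u x - s * u 0) / s.
  by rewrite mulrBl mulrAC mulfV ?mul1r// gt_eqF.
rewrite E normrM (gtr0_norm (x := s^-1)) ?invr_gt0// ltr_pdivrMr//.
apply: (@le_lt_trans _ _ (e / 2 * (s `^ (1 - 0) * beta 1 (1 - 0)))).
  apply: ker_bounded_integral => //; first by apply: measurable_funB.
  move=> x /andP[x0 xs]; rewrite /ker subrr oppr0 !powRr0 !mulr1 ltW// dh// x0.
  exact: lt_trans sd.
rewrite subr0 powRr1 ?(ltW s0')// /beta (GammaS 1) Gamma1 mul1r divr1 mulr1; nra.
Qed.

Definition taylor (c : nat -> R) (u : R -> R) (N : nat) (t : R) : R :=
  \sum_(0 <= k < N) c k * Phi k.+1%:R t + RLint N%:R u t.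

Variables (X g : R).
Hypotheses (X0 : 0 < X) (g0 : 0 <= g) (g1 : g < 1).

Lemma PhiS_wcont k : wcont X g (Phi k.+1%:R).
Proof.
apply: Phi_wcont => //; rewrite -natr1; have k0 : 0 <= k%:R :> R by rewrite ler0n.
by have := g0; lra.
Qed.

Lemma taylor_wcont c u N : wcont X g u -> wcont X g (taylor c u N).
Proof.
move=> wu; apply: wcontD; last by apply: wcont_RLint => //; rewrite ler0n.
by apply: wcont_sum => k _; apply: wcontZ; exact: PhiS_wcont.
Qed.

Lemma RLint_taylor c u N p t : 0 <= p -> wcont X g u -> 0 < t < X ->
  RLint p (taylor c u N) t =
  \sum_(0 <= k < N) c k * Phi (p + k.+1%:R) t + RLint (p + N%:R) u t.
Proof.
move=> p0 wu /[dup] tX /andP[t0 _].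
have wP k : wcont X g (fun s => c k * Phi k.+1%:R s) by apply: wcontZ; exact: PhiS_wcont.
rewrite (@RLintD R X g)//; last 2 first.
- by apply: wcont_sum => k _.
- by apply: wcont_RLint => //; rewrite ler0n.
rewrite (@RLint_sum R X g)//; congr (_ + _).
  apply: eq_bigr => k _; rewrite (@RLintZ R X g)//; last exact: PhiS_wcont.
  by rewrite RLint_Phi.
by rewrite (@RLint_semigroup R X g)// ler0n.
Qed.

Lemma taylorD c u n N t : wcont X g u -> 0 < t < X ->
  taylor c u (n + N) t =
  \sum_(0 <= k < n) c k * Phi k.+1%:R t + RLint n%:R (taylor (fun k => c (n + k)%N) u N) t.
Proof.
move=> wu tX; rewrite RLint_taylor// ?ler0n// addrA -natrD; congr (_ + _).
rewrite /index_iota subn0 iotaD big_cat/= !subn0 add0n; congr (_ + _).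
rewrite -[in LHS](addn0 n) iotaDl big_map; apply: eq_bigr => k _.
by rewrite -natrD addnS.
Qed.

Lemma taylorS0 c u N : taylor c u N.+1 0 = c 0%N.
Proof.
rewrite /taylor RLint_at0 ?pnatr_eq0// addr0 big_nat_recl// big1_seq ?addr0.
  by rewrite /Phi subrr powRr0 Gamma1 divr1 mulr1.
move=> k _; rewrite /Phi -natr1 addrK powR0 ?mul0r ?mulr0//.
Qed.

Lemma Phi1 t : Phi 1 t = 1 :> R.
Proof. by rewrite /Phi subrr powRr0 Gamma1 divr1. Qed.

Lemma taylorS c u N t : wcont X g u -> 0 <= t < X ->
  taylor c u N.+1 t = c 0%N + RLint 1 (taylor (fun k => c k.+1) u N) t.
Proof.
move=> wu /andP[t0 tX]; move: t0; rewrite le_eqVlt => /predU1P[<-|t0].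
  by rewrite taylorS0 RLint_at0 ?addr0// oner_eq0.
rewrite -add1n taylorD ?t0// big_nat1 Phi1 mulr1; congr (_ + _).
Qed.

Lemma taylor_near0 c u N e : wcont X g u -> 0 < e ->
  exists2 d, 0 < d & forall s, 0 < s < d -> `|taylor c u N.+1 s - taylor c u N.+1 0| < e.
Proof.
move=> wu e0; have [d d0 dh] := @RLint_near0 X g 1 e (taylor (fun k => c k.+1) u N) g1 g0 g1 X0 (taylor_wcont _ _ wu) e0.
exists (Num.min d X); first by rewrite lt_min d0.
move=> s; rewrite lt_min => /and3P[s0 sd sX].
by rewrite taylorS0 taylorS ?(ltW s0)// addrAC subrr add0r dh// s0.
Qed.

Variable T : R.
Hypothesis TX : 0 < T < X.

Let T0 : 0 < T. Proof. by case/andP: TX. Qed.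
Let TX' : T < X. Proof. by case/andP: TX. Qed.

Lemma has_deriv_cstD (a t l : R) f : has_deriv T f t l -> has_deriv T (fun s => a + f s) t l.
Proof.
move=> /has_derivP h; apply/has_derivP => e /h[d d0 dh]; exists d => // s sT st sd.
have -> : dquot (fun s => a + f s) t s = dquot f t s; last exact: dh.
by rewrite /dquot; congr (_ / _); ring.
Qed.

Lemma has_deriv_taylor c u N t : wcont X g u -> 0 <= t <= T -> (0 < N)%N || (0 < t) ->
  has_deriv T (taylor c u N.+1) t (taylor (fun k => c k.+1) u N t).
Proof.
move=> wu tT Nt.
have h : has_deriv T (RLint 1 (taylor (fun k => c k.+1) u N)) t (taylor (fun k => c k.+1) u N t).
  apply: (has_deriv_RLint1 (X := X) (g := g)) => //; first exact: taylor_wcont.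
  move=> t0 e e0; move: Nt; rewrite t0 ltxx orbF.
  by case: N => // N _; exact: taylor_near0.
apply: has_deriv_extc tT (has_deriv_cstD (c 0%N) h) => s /andP[s0 sT].
by rewrite -taylorS// s0 (le_lt_trans sT).
Qed.

Lemma derivn_taylor c u N k t : wcont X g u -> 0 <= t <= T -> (k < N)%N || (k <= N)%N && (0 < t) ->
  derivn_on T k (taylor c u N) t = taylor (fun j => c (k + j)%N) u (N - k) t.
Proof.
move=> wu; elim: k t => [|k IH] t tT kt; first by rewrite subn0.
have kN : (k < N)%N by case/orP: kt => [/ltnW//|/andP[]].
have -> : derivn_on T k.+1 (taylor c u N) t = deriv_on T (derivn_on T k (taylor c u N)) t by [].
have [M NE] : exists M, (N - k = M.+1)%N by exists (N - k).-1; rewrite prednK// subn_gt0.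
have NSE : (N - k.+1 = M)%N by rewrite subnS NE.
rewrite NSE.
have h : has_deriv T (taylor (fun j => c (k + j)%N) u M.+1) t (taylor (fun j => c (k.+1 + j)%N) u M t).
  have := @has_deriv_taylor (fun j => c (k + j)%N) u M t wu tT.
  have -> : (fun j => c (k + j.+1)%N) = (fun j => c (k.+1 + j)%N) by apply/funext => j; rewrite addnS.
  apply; case/orP: kt => [kt|/andP[_ ->]]; last by rewrite orbT.
  by rewrite -NSE subn_gt0 kt.
apply: (has_deriv_on T0 tT _).2; apply: has_deriv_extc tT h => s sT.
by rewrite IH ?NE// kN.
Qed.

Lemma derivn_taylor_has_deriv c u N k t : wcont X g u -> 0 <= t <= T -> (k.+1 < N)%N || (k.+1 <= N)%N && (0 < t) ->
  has_deriv T (derivn_on T k (taylor c u N)) t (taylor (fun j => c (k.+1 + j)%N) u (N - k.+1) t).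
Proof.
move=> wu tT kt; have kN : (k < N)%N by case/orP: kt => [/ltnW//|/andP[]].
have [M NE] : exists M, (N - k = M.+1)%N by exists (N - k).-1; rewrite prednK// subn_gt0.
have NSE : (N - k.+1 = M)%N by rewrite subnS NE.
rewrite NSE; have := @has_deriv_taylor (fun j => c (k + j)%N) u M t wu tT.
have -> : (fun j => c (k + j.+1)%N) = (fun j => c (k.+1 + j)%N) by apply/funext => j; rewrite addnS.
move=> h; apply: has_deriv_extc tT (h _) => [s sT|].
  by rewrite derivn_taylor ?NE// kN.
case/orP: kt => [kt|/andP[_ ->]]; last by rewrite orbT.
by rewrite -NSE subn_gt0 kt.
Qed.

Lemma derivn_RLint (n : nat) (v : R -> R) (t : R) : wcont X g v -> 0 < t <= T ->
  derivn_on T n (RLint n%:R v) t = v t.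
Proof.
move=> wv /andP[t0 tT].
have E : RLint n%:R v = taylor (fun _ => 0) v n.
  by apply/funext => s; rewrite /taylor big1_seq ?add0r// => k _; rewrite mul0r.
rewrite E derivn_taylor// ?t0 ?leqnn ?orbT// ?(ltW t0)//.
by rewrite subnn /taylor big_geq// add0r RLint0E.
Qed.

Lemma Caputo_taylor c u N (al : R) t : wcont X g u -> 0 <= al -> al <= (order_of al)%:R ->
  (order_of al <= N)%N -> 0 < t <= T ->
  Caputo T al (taylor c u N) t =
  \sum_(order_of al <= k < N) c k * Phi (k.+1%:R - al) t + RLint (N%:R - al) u t.
Proof.
move=> wu al0; set n := order_of al => aln nN /andP[t0 tT].
have na : 0 <= n%:R - al by rewrite subr_ge0.
pose v := taylor (fun k => c (n + k)%N) u (N - n).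
have wv : wcont X g v by exact: taylor_wcont.
have sX s : 0 < s <= T -> 0 < s < X by move=> /andP[-> sT]; exact: le_lt_trans TX'.
have wIv : wcont X g (RLint (n%:R - al) v) by exact: wcont_RLint.
pose f s := taylor c u N s - \sum_(0 <= k < n) derivn_on T k (taylor c u N) 0 / k`!%:R * s ^+ k.
have fE s : 0 < s <= T -> f s = RLint n%:R v s.
  move=> sT; rewrite /f -{1}(subnKC nN) taylorD ?sX// -/v addrAC -[RHS]add0r; congr (_ + _).
  apply/eqP; rewrite subr_eq0; apply/eqP; apply: eq_big_nat => k /andP[_ kn].
  have kN : (k < N)%N by exact: leq_trans nN.
  have T00 : 0 <= (0 : R) <= T by rewrite lexx ltW.
  rewrite (@derivn_taylor c u N k 0 wu T00) ?kN//.
  have [M ->] : exists M, (N - k = M.+1)%N by exists (N - k).-1; rewrite prednK// subn_gt0.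
  by rewrite taylorS0 addn0 PhiS; [ring|case/andP: sT => /ltW].
have RE s : 0 < s <= T -> RLint (n%:R - al) f s = RLint n%:R (RLint (n%:R - al) v) s.
  move=> /[dup] sT /andP[s0 sT'].
  have wIn : wcont X g (RLint n%:R v) by apply: wcont_RLint => //; rewrite ler0n.
  have E : RLint (n%:R - al) f s = RLint (n%:R - al) (RLint n%:R v) s.
    apply: (eq_RLint_wcont na wIn (sX _ sT)) => r /andP[r0 rs]; apply: fE.
    by rewrite r0 (le_trans rs).
  have n0 : 0 <= n%:R :> R by rewrite ler0n.
  rewrite E (RLint_semigroup g1 g0 na n0 wv (sX _ sT)).
  by rewrite (RLint_semigroup g1 g0 n0 na wv (sX _ sT)) addrC.
rewrite /Caputo /RLderiv -/n (derivn_on_ext _ RE) ?t0// derivn_RLint ?t0//.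
have tT' : 0 < t <= T by rewrite t0.
rewrite /v (@RLint_taylor _ u (N - n) _ t na wu (sX _ tT')).
have -> : n%:R - al + (N - n)%:R = N%:R - al by rewrite natrB//; ring.
apply: (congr1 (fun x => x + _)).
rewrite -[in RHS](add0n n) big_addn; apply: eq_big_nat => k _.
by rewrite (addnC k) -addnS natrD; apply: (congr1 (fun x => _ * Phi x t)); ring.
Qed.

End Taylor.

Section Converse.
Context {R : realType}.

Lemma within_contP (T : R) (f : R -> R) : {within `[0, T], continuous f} <->
  (forall t, 0 <= t <= T -> forall e, 0 < e -> exists2 d, 0 < d &
    forall s, 0 <= s <= T -> `|s - t| < d -> `|f s - f t| < e).
Proof.
split=> [/subspace_continuousP h t tT e e0|h].
  have /cvgrPdist_lt/(_ e e0) := h t tT.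
  rewrite near_withinE => /nbhs_ballP[d/= d0 dh]; exists d => // s sT sd.
  by rewrite distrC; apply: dh => //; rewrite /ball/= distrC.
apply/subspace_continuousP => t tT; apply/cvgrPdist_lt => e e0.
have [d d0 dh] := h t tT e e0.
rewrite near_withinE; apply/nbhs_ballP; exists d => //= s sd sT.
by rewrite distrC; apply: dh => //; rewrite distrC.
Qed.

Lemma within_cont_ext (T : R) (f h : R -> R) : (forall t, 0 <= t <= T -> f t = h t) ->
  {within `[0, T], continuous f} -> {within `[0, T], continuous h}.
Proof.
move=> fh /within_contP H; apply/within_contP => t tT e /(H t tT)[d d0 dh].
by exists d => // s sT st; rewrite -!fh//; exact: dh.
Qed.

Lemma cvg_at0P (f : R -> R) (l : R) : f t @[t --> 0^'+] --> l <->
  (forall e, 0 < e -> exists2 d, 0 < d & forall s, 0 < s < d -> `|f s - l| < e).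
Proof.
split=> [/cvgrPdist_lt h e e0|h].
  have := h e e0; rewrite near_withinE => /nbhs_ballP[d/= d0 dh]; exists d => // s /andP[s0 sd].
  by rewrite distrC; apply: dh => //; rewrite /ball/= sub0r normrN gtr0_norm.
apply/cvgrPdist_lt => e /h[d d0 dh].
rewrite near_withinE; apply/nbhs_ballP; exists d => // s; rewrite /ball/= sub0r normrN => sd s0.
by rewrite distrC; apply: dh; rewrite s0 (le_lt_trans (ler_norm _)).
Qed.

Lemma within_cont_at0 (T : R) (f : R -> R) : 0 < T -> {within `[0, T], continuous f} ->
  f t @[t --> 0^'+] --> f 0.
Proof. by move=> T0 /(continuous_within_itvP _ T0)[]. Qed.

Lemma cvg_at0_ext (T l : R) (f h : R -> R) : 0 < T -> (forall t, 0 < t < T -> f t = h t) ->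
  f t @[t --> 0^'+] --> l -> h t @[t --> 0^'+] --> l.
Proof.
move=> T0 fh /cvg_at0P H; apply/cvg_at0P => e /H[d d0 dh].
exists (Num.min d T); first by rewrite lt_min d0.
by move=> s; rewrite lt_min => /and3P[s0 sd sT]; rewrite -fh ?dh ?s0.
Qed.

Lemma eq_has_deriv (T : R) (f h : R -> R) : 
  {within `[0, T], continuous f} -> {within `[0, T], continuous h} -> f 0 = h 0 ->
  (forall t, 0 < t < T -> exists2 l, has_deriv T f t l & has_deriv T h t l) ->
  forall t, 0 <= t <= T -> f t = h t.
Proof.
move=> /within_contP cf /within_contP ch fh0 fhd t /andP[t0 tT].
pose F := fun s => f s - h s.
have cF : {within `[0, t], continuous F}.
  apply/within_contP => s /andP[s0 st] e e0; have e20 : 0 < e / 2 by rewrite divr_gt0.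
  have sT : 0 <= s <= T by rewrite s0 (le_trans st).
  have [d d0 dh] := cf s sT _ e20; have [d' d'0 d'h] := ch s sT _ e20.
  exists (Num.min d d'); first by rewrite lt_min d0.
  move=> r /andP[r0 rt]; rewrite lt_min => /andP[rd rd'].
  have rT : 0 <= r <= T by rewrite r0 (le_trans rt).
  have -> : F r - F s = (f r - f s) - (h r - h s) by rewrite /F; ring.
  apply: (le_lt_trans (ler_normB _ _)).
  by have := dh r rT rd; have := d'h r rT rd'; lra.
have dF x : x \in `]0, t[ -> is_derive x 1 F (cst 0 x).
  rewrite in_itv/= => /andP[x0 xt]; have xT : 0 < x < T by rewrite x0 (lt_le_trans xt).
  have [l fl hl] := fhd x xT.
  by have := is_deriveB (has_deriv_is_derive xT fl) (has_deriv_is_derive xT hl); rewrite subrr.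
have [c _] := MVT_segment t0 dF cF; rewrite /= mul0r /F => /eqP.
by rewrite fh0 subrr subr0 subr_eq0 => /eqP.
Qed.

Lemma clamp_extension (T : R) (f : R -> R) : 0 < T -> {within `[0, T], continuous f} ->
  exists h : R -> R, [/\ continuous h, exists2 M, 0 <= M & forall t, `|h t| <= M &
    forall t, 0 <= t <= T -> h t = f t].
Proof.
move=> T0 cf; pose cl t := Num.max 0 (Num.min T t).
have clT t : 0 <= cl t <= T by rewrite /cl le_max lexx/= ge_max (ltW T0) ge_min lexx.
have clE t : 0 <= t <= T -> cl t = t by move=> /andP[t0 tT]; rewrite /cl min_r// max_r.
have cln s t : `|cl s - cl t| <= `|s - t|.
  rewrite /cl; have [] := leP T s; have [] := leP T t; rewrite ?(max_r (ltW T0)) => h1 h2.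
  - by rewrite subrr normr0.
  - have [h3|h3] := leP 0 t.
      by rewrite !ger0_norm ?subr_ge0 ?lerD2r// ltW// (lt_le_trans h1).
    by rewrite subr0 !gtr0_norm ?subr_gt0//; lra.
  - have [h3|h3] := leP 0 s.
      by rewrite distrC (distrC s) !ger0_norm ?subr_ge0 ?lerD2r//; lra.
    by rewrite distrC (distrC s) subr0 !gtr0_norm ?subr_gt0//; lra.
  - have [h3|h3] := leP 0 s; have [h4|h4] := leP 0 t => //.
    + by rewrite subr0 ger0_norm// ger0_norm ?subr_ge0; lra.
    + by rewrite sub0r normrN ger0_norm// distrC ger0_norm ?subr_ge0; lra.
    + by rewrite subrr normr0.
have cnf : {within `[0, T], continuous (fun t => `|f t|)}.
  apply/within_contP => t tT e e0; have /within_contP := cf => /(_ t tT e e0)[d d0 dh].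
  exists d => // s sT st; apply: le_lt_trans (dh s sT st).
  exact: ler_dist_dist.
have [c _ cM] := EVT_max (ltW T0) cnf.
exists (f \o cl); split=> /=.
- move=> t; apply/cvgrPdist_lt => e e0; have /within_contP := cf => /(_ _ (clT t) e e0)[d d0 dh].
  apply/nbhs_ballP; exists d => //= s; rewrite /ball/= => st.
  rewrite distrC; apply: dh => //; rewrite distrC.
  exact: le_lt_trans (cln _ _) st.
- by exists `|f c| => // t; apply: cM; rewrite in_itv/= clT.
- by move=> t tT; rewrite clE.
Qed.

Lemma C_space_wcont (T g : R) (f : R -> R) : 0 < T -> C_space g T f ->
  exists2 u : R -> R, (forall X, wcont X g u) & forall t, 0 < t <= T -> u t = f t.
Proof.
move=> T0 [h ch hf]; have [H [cH [M M0 HM] Hh]] := clamp_extension T0 ch.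
exists (fun t => t `^ (- g) * H t) => [X|t /[dup] tT /andP[t0 tT']]; last first.
  rewrite Hh ?(ltW t0)// hf// mulrA -powRD ?addNr ?powRr0 ?mul1r//.
  by apply/implyP => _; rewrite gt_eqF.
split; first by move=> t /andP[t0 _]; apply: continuousM; [exact: continuous_powR_gt0|exact: cH].
exists M => // t _; rewrite normrM ger0_norm ?powR_ge0// mulrC.
by rewrite ler_wpM2r ?powR_ge0.
Qed.

Lemma wcont_C_space (X T g l : R) (u : R -> R) : 0 < T < X -> wcont X g u ->
  (t : R) `^ g * u t @[t --> 0^'+] --> l -> C_space g T u.
Proof.
move=> /andP[T0 TX] [cu _] ul.
exists (fun t : R => if t <= 0 then l else t `^ g * u t); last by move=> t /andP[t0 _]; rewrite leNgt t0.
apply/(continuous_within_itvP _ T0).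
have cc (t : R) : 0 < t < X -> {for t, continuous (fun t : R => if t <= 0 then l else t `^ g * u t)}.
  move=> tX; have E (s : R) : 0 < s < X -> (if s <= 0 then l else s `^ g * u s) = s `^ g * u s.
    by move=> /andP[s0 _]; rewrite leNgt s0.
  apply: (continuous_eq_on E tX).
  apply: continuousM; last exact: cu.
  by apply: continuous_powR_gt0; case/andP: tX.
split.
- by move=> t; rewrite in_itv/= => /andP[t0 tT]; apply: cc; rewrite t0 (lt_trans tT).
- rewrite lexx; apply: (cvg_at0_ext T0) ul => t /andP[t0 _].
  by rewrite leNgt t0.
- by apply: cvg_at_left_filter; apply: cc; rewrite T0.
Qed.

Lemma derivn_on_extc (T : R) k (f h : R -> R) : 0 < T -> (forall s, 0 <= s <= T -> f s = h s) ->
  forall t, 0 <= t <= T -> derivn_on T k f t = derivn_on T k h t.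
Proof.
move=> T0 fh; elim: k => [|k IH] t tT; first exact: fh.
rewrite /derivn_on !iterS -/(derivn_on T k f) -/(derivn_on T k h) /deriv_on.
have E : {near within `[0, T] t^', dquot (derivn_on T k f) t =1 dquot (derivn_on T k h) t}.
  rewrite near_withinE near_withinE; near=> s => _ sT.
  by rewrite /dquot !IH.
have E' : {near within `[0, T] t^', dquot (derivn_on T k h) t =1 dquot (derivn_on T k f) t}.
  by apply: filterS E => s ->.
congr (lim _); apply/seteqP; split; [exact: near_eq_cvg E|exact: near_eq_cvg E'].
Unshelve. all: by end_near.
Qed.

Lemma Cn_space_ext (T : R) p g (f h : R -> R) : 0 < T -> (forall t, 0 <= t <= T -> f t = h t) ->
  Cn_space p.+1 g T f -> Cn_space p.+1 g T h.
Proof.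
move=> T0 fh [d1 c1 d2 [w cw wE]].
have E k := derivn_on_extc k T0 fh.
have dE k t : 0 <= t <= T -> derivable_on T (derivn_on T k f) t -> derivable_on T (derivn_on T k h) t.
  move=> tT /derivable_onE df.
  by have [] := has_deriv_on T0 tT (has_deriv_extc (E k) tT df).
split.
- by move=> k kp t tT; apply: dE => //; exact: d1.
- by move=> k kp; apply: within_cont_ext (E k) (c1 k kp).
- by move=> t /[dup] tT /andP[t0 tT']; apply: dE; [rewrite ltW|exact: d2].
- by exists w => // t /[dup] tT /andP[t0 tT']; rewrite wE// E// ltW.
Qed.

Lemma init_cond_ext (T : R) n b (f h : R -> R) : 0 < T -> (forall t, 0 <= t <= T -> f t = h t) ->
  init_cond T n b f -> init_cond T n b h.
Proof.
move=> T0 fh fb k kn; apply: (cvg_at0_ext T0) (fb k kn) => t /andP[t0 tT].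
by apply: derivn_on_extc => //; rewrite !ltW.
Qed.

Lemma RLint_extc (p t : R) (f h : R -> R) : 0 <= t -> (forall s, 0 <= s <= t -> f s = h s) ->
  RLint p f t = RLint p h t.
Proof.
move=> t0 fh; rewrite /RLint; case: ifP => _; first by rewrite fh// t0 lexx.
congr (_ * _); apply: eq_Rintegral => s; rewrite inE/= in_itv/= => st.
by rewrite fh.
Qed.

Lemma Caputo_ext (T al : R) (f h : R -> R) t : 0 < T -> (forall t, 0 <= t <= T -> f t = h t) ->
  0 < t <= T -> Caputo T al f t = Caputo T al h t.
Proof.
move=> T0 fh tT; apply: derivn_on_ext (tT) => s /andP[s0 sT].
apply: RLint_extc; first exact: ltW.
move=> r /andP[r0 rs]; rewrite fh ?r0 ?(le_trans rs)//; congr (_ - _).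
apply: eq_bigr => k _; congr (_ / _ * _); apply: derivn_on_extc => //.
by rewrite lexx ltW.
Qed.

Lemma solves_eq_ext (T : R) m alpha a (f h : R -> R) : 0 < T -> (forall t, 0 <= t <= T -> f t = h t) ->
  solves_eq T m alpha a f -> solves_eq T m alpha a h.
Proof.
move=> T0 fh fs t /[dup] tT /andP[t0 tT']; have tTc : 0 < t <= T by rewrite t0 ltW.
rewrite -(Caputo_ext _ T0 fh tTc) fs//; congr (- _); apply: eq_bigr => i _.
by rewrite (Caputo_ext _ T0 fh tTc).
Qed.

Variables (X g T : R).
Hypotheses (g0 : 0 < g) (g1 : g < 1) (TX : 0 < T < X).

Let g_ge0 : 0 <= g. Proof. exact: ltW. Qed.
Let T0 : 0 < T. Proof. by case/andP: TX. Qed.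
Let X0 : 0 < X. Proof. by case/andP: TX; exact: lt_trans. Qed.

Lemma within_cont_taylor c u N : wcont X g u -> {within `[0, T], continuous (taylor c u N.+1)}.
Proof.
move=> wu; apply/within_contP => t /andP[]; rewrite le_eqVlt => /predU1P[<-|t0] tT e e0.
  have [d d0 dh] := taylor_near0 X0 g_ge0 g1 c N wu e0; exists d => // s /andP[].
  rewrite le_eqVlt => /predU1P[<-|s0] _; first by rewrite !subrr !normr0.
  by rewrite subr0 gtr0_norm// => sd; apply: dh; rewrite s0.
have [ct _] := taylor_wcont X0 g_ge0 g1 c N.+1 wu.
have tX : 0 < t < X by rewrite t0 (le_lt_trans tT)//; case/andP: TX.
have /cvgrPdist_lt/(_ e e0)/nbhs_ballP[d/= d0 dh] := ct t tX.
by exists d => // s _ st; rewrite distrC; apply: dh; rewrite /ball/= distrC.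
Qed.

Lemma taylor_Cn_space c u N (l : R) : wcont X g u -> (t : R) `^ g * u t @[t --> 0^'+] --> l ->
  Cn_space N.+1 g T (taylor c u N.+1).
Proof.
move=> wu ul.
have DE k t : (k <= N)%N -> 0 <= t <= T ->
    derivn_on T k (taylor c u N.+1) t = taylor (fun j => c (k + j)%N) u (N.+1 - k) t.
  by move=> kN tT; apply: (derivn_taylor X0 g_ge0 g1 TX _ wu tT); rewrite ltnS kN.
split.
- move=> k kN t tT; have h : (k.+1 < N.+1)%N || (k.+1 <= N.+1)%N && (0 < t) by rewrite ltnS kN.
  by have [] := has_deriv_on T0 tT (derivn_taylor_has_deriv X0 g_ge0 g1 TX (c := c) wu tT h).
- move=> k kN; apply: (@within_cont_ext T (taylor (fun j => c (k + j)%N) u (N.+1 - k))).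
    by move=> t tT; rewrite (DE k t kN tT).
  by rewrite (subSn kN); exact: within_cont_taylor.
- move=> t /andP[t0 tT]; have h : (N.+1 < N.+1)%N || (N.+1 <= N.+1)%N && (0 < t) by rewrite leqnn t0 orbT.
  have tT' : 0 <= t <= T by rewrite ltW.
  by have [] := has_deriv_on T0 tT' (derivn_taylor_has_deriv X0 g_ge0 g1 TX (c := c) wu tT' h).
- have [w cw wE] := wcont_C_space TX wu ul; exists w => // t /[dup] tT /andP[t0 tT'].
  rewrite wE// (derivn_taylor X0 g_ge0 g1 TX _ wu) ?leqnn ?t0 ?orbT ?(ltW t0)//.
  by rewrite subnn /taylor big_geq// add0r RLint0E.
Qed.

Lemma taylor_init_cond c u N : wcont X g u -> init_cond T N.+1 c (taylor c u N.+1).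
Proof.
move=> wu k kN; have tE : (k <= N)%N by [].
rewrite -[c k]/(c k) -[k in c k]addn0 -(taylorS0 (fun j => c (k + j)%N) u (N - k)).
apply: (@cvg_at0_ext T _ (taylor (fun j => c (k + j)%N) u (N - k).+1)) => //; last first.
  exact: within_cont_at0 T0 (within_cont_taylor wu).
move=> t /andP[/ltW t0 /ltW tT]; have tT' : 0 <= t <= T by rewrite t0.
have h : (k < N.+1)%N || (k <= N.+1)%N && (0 < t) by rewrite kN.
by rewrite (derivn_taylor X0 g_ge0 g1 TX c wu tT' h) subSn.
Qed.

Lemma Cn_space_taylor p (z : R -> R) : Cn_space p.+1 g T z ->
  exists2 u, wcont X g u & forall t, 0 <= t <= T -> z t = taylor (fun k => derivn_on T k z 0) u p.+1 t.
Proof.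
move=> [zd zc zp zC]; have [u wu uE] := C_space_wcont T0 zC; exists u => //.
have T00 : 0 <= (0 : R) <= T by rewrite lexx ltW.
suff H j k : (k + j = p)%N -> forall t, 0 <= t <= T ->
    derivn_on T k z t = taylor (fun i => derivn_on T (k + i) z 0) u j.+1 t.
  by move=> t tT; exact: (H p 0%N _ t tT).
elim: j k => [|j IH] k kj.
  rewrite addn0 in kj; rewrite kj; apply: eq_has_deriv.
  - exact: zc.
  - exact: within_cont_taylor.
  - by rewrite taylorS0 addn0.
  - move=> t /andP[t0 tT]; have tT' : 0 <= t <= T by rewrite !ltW.
    exists (u t).
      by rewrite uE ?t0 ?(ltW tT)//; apply: derivable_onE; apply: zp; rewrite t0 ltW.
    have := has_deriv_taylor X0 g_ge0 g1 TX (c := fun i => derivn_on T (p + i) z 0) (wu X) tT' (N := 0).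
    by rewrite t0 => /(_ isT); rewrite {2}/taylor big_geq// add0r RLint0E.
have kp : (k < p)%N by rewrite -kj addnS ltnS leq_addr.
apply: eq_has_deriv.
- by apply: zc; exact: ltnW.
- exact: within_cont_taylor.
- by rewrite taylorS0 addn0.
- move=> t /andP[t0 tT]; have tT' : 0 <= t <= T by rewrite !ltW.
  exists (derivn_on T k.+1 z t); first by apply: derivable_onE; exact: zd.
  have -> := IH k.+1 _ t tT'; last by rewrite addSnnS.
  have := has_deriv_taylor X0 g_ge0 g1 TX (c := fun i => derivn_on T (k + i) z 0)
    (wu X) tT' (N := j.+1) isT.
  have -> : (fun i => derivn_on T (k + i.+1) z 0) = (fun i => derivn_on T (k.+1 + i) z 0).
    by apply/funext => i; rewrite addSnnS.
  by [].
Qed.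

Lemma init_cond_derivn p b (z : R -> R) : Cn_space p.+1 g T z -> init_cond T p.+1 b z ->
  forall k, (k <= p)%N -> derivn_on T k z 0 = b k.
Proof.
move=> [_ zc _ _] zb k kp; have h := within_cont_at0 T0 (zc k kp).
exact: (cvg_unique _ h (zb k kp)).
Qed.

Lemma RLint_inj (Y : R) (u v : R -> R) : wcont Y g u -> wcont Y g v ->
  (forall t, 0 < t < Y -> RLint g u t = RLint g v t) -> forall t, 0 < t < Y -> u t = v t.
Proof.
move=> wu wv uv t tY.
have h0 : 0 <= 1 - g by rewrite subr_ge0 ltW.
have E s : 0 < s < Y -> RLint 1 u s = RLint 1 v s.
  move=> sY; have -> : (1 : R) = (1 - g) + g by ring.
  rewrite -(RLint_semigroup g1 g_ge0 h0 g_ge0 wu sY) -(RLint_semigroup g1 g_ge0 h0 g_ge0 wv sY).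
  apply: (eq_RLint_wcont h0 (wcont_RLint g1 g_ge0 wv) sY) => r /andP[r0 rs].
  by apply: uv; rewrite r0 (le_lt_trans rs)//; case/andP: sY.
have du := is_derive_RLint1 g1 wu tY.
have dv := is_derive_ext_on E tY (is_derive_RLint1 g1 wv tY).
by rewrite -(@derive_val _ _ _ _ _ _ _ du) -(@derive_val _ _ _ _ _ _ _ dv).
Qed.

Lemma Cn1_wdiff (a : R -> R) : Cn_space 1 g T a -> exists a' d,
  [/\ wdiff X g a' d, forall t, 0 <= t <= T -> a' t = a t & exists l : R, a' t @[t --> 0^'+] --> l].
Proof.
move=> /Cn_space_taylor[d wd aE]; set c := (fun _ => _) in aE.
exists (taylor c d 1), d; split; last first.
- by exists (taylor c d 1 0); apply: (within_cont_at0 T0); exact: within_cont_taylor.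
- by move=> t tT; rewrite aE.
have tE t : taylor c d 1 t = c 0%N + RLint 1 d t by rewrite /taylor big_nat1 Phi1 mulr1.
split => //.
  move=> t tX; have := is_deriveD (is_derive_cst (c 0%N) t 1) (is_derive_RLint1 g1 wd tX).
  by rewrite add0r; apply: is_derive_ext_on tX => s _; exact: tE.
have [C C0 hC] := RLint_bound_wcont g1 ltr01 wd.
exists (`|c 0%N| + C * X `^ (1 - g)) => t /[dup] tX /andP[t0 tX'].
rewrite tE (le_trans (ler_normD _ _))// lerD2l (le_trans (hC t tX))// ler_wpM2l//.
by rewrite ge0_ler_powR ?nnegrE ?subr_ge0 ?(ltW g1) ?(ltW t0) ?(ltW X0) ?(ltW tX').
Qed.

Lemma powR_bound_cvg0 (p C : R) (f : R -> R) : 0 < p -> 0 <= C ->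
  (forall t, 0 < t < X -> `|f t| <= C * t `^ p) -> f t @[t --> 0^'+] --> 0.
Proof.
move=> p0 C0 fC; apply/cvg_at0P => e e0.
have [r r0 hr] := powR_bound_near0 X0 p0 C0 e0 fC.
by exists r => // t tr; rewrite subr0; exact: hr.
Qed.

Lemma powR_RLint_cvg0 (p : R) (u : R -> R) : 0 < p -> wcont X g u ->
  (t : R) `^ g * RLint p u t @[t --> 0^'+] --> 0.
Proof.
move=> p0 wu; have [C C0 hC] := RLint_bound_wcont g1 p0 wu.
apply: (powR_bound_cvg0 p0 C0) => t /[dup] tX /andP[t0 _].
rewrite normrM ger0_norm ?powR_ge0//.
have -> : C * t `^ p = t `^ g * (C * t `^ (p - g)).
  by rewrite mulrCA -(powRD_gt0 g (p - g) t0); congr (_ * _ `^ _); ring.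
by rewrite ler_wpM2l ?powR_ge0// hC.
Qed.

Lemma powR_prodop_cvg a d delta u : 0 <= delta -> wdiff X g a d -> wcont X g u ->
  (delta = 0 -> exists l : R, (t : R) `^ g * (a t * u t) @[t --> 0^'+] --> l) ->
  exists l : R, (t : R) `^ g * prodop g a d delta u t @[t --> 0^'+] --> l.
Proof.
move=> d0 wa wu ul.
have wau := wdiff_mul wa wu.
have gd0 : 0 < g + delta by exact: ltr_wpDr.
have gd : g <= g + delta by rewrite lerDl.
have wm := mop_wcont g1 g_ge0 gd0 gd wa wu.
have h0 : 0 < 1 - g by rewrite subr_gt0.
have [l1 h1] : exists l : R, (t : R) `^ g * RLint delta (fun s => a s * u s) t @[t --> 0^'+] --> l.
  move: d0; rewrite le_eqVlt => /predU1P[d0|d0]; last by exists 0; exact: powR_RLint_cvg0.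
  by rewrite -d0 RLint0E; exact: ul.
exists (l1 + 0); pose v := fun s => a s * u s.
apply: (@cvg_at0_ext T _ (fun t => t `^ g * RLint delta v t +
    t `^ g * RLint (1 - g) (mop a d (g + delta) u) t)) => //.
  by move=> t _; rewrite /prodop mulrDr.
by apply: cvgD => //; exact: powR_RLint_cvg0.
Qed.

End Converse.

Section Operator.
Context {R : realType}.
Variables (X g dmin : R) (m : nat) (delta : nat -> R) (A d : nat -> R -> R).
Hypotheses (g0 : 0 < g) (g1 : g < 1) (dmin0 : 0 < dmin).
Hypothesis delta_ge : forall i, (1 <= i < m.+1)%N -> dmin <= delta i.
Hypothesis wA : forall i, (1 <= i < m.+1)%N -> wdiff X g (A i) (d i).

Let g_ge0 : 0 <= g. Proof. exact: ltW. Qed.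
Let delta_ge0 i : (1 <= i < m.+1)%N -> 0 <= delta i.
Proof. by move=> /delta_ge; apply: le_trans; exact: ltW. Qed.

Lemma wcont_sum_nat (p q : nat) (P : pred nat) (F : nat -> R -> R) :
  (forall i, (p <= i < q)%N -> P i -> wcont X g (F i)) ->
  wcont X g (fun t => \sum_(p <= i < q | P i) F i t).
Proof.
move=> wF; under eq_fun do rewrite big_nat_cond.
by apply: wcont_sum => i /andP[ipq Pi]; exact: wF.
Qed.

Lemma RLint_sum_nat (r t : R) (p q : nat) (P : pred nat) (F : nat -> R -> R) : 0 <= r ->
  (forall i, (p <= i < q)%N -> P i -> wcont X g (F i)) -> 0 < t < X ->
  RLint r (fun t => \sum_(p <= i < q | P i) F i t) t = \sum_(p <= i < q | P i) RLint r (F i) t.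
Proof.
move=> r0 wF tX; under [X in RLint _ X]eq_fun do rewrite big_nat_cond.
rewrite (@RLint_sum R X g)//; first by rewrite -big_nat_cond.
by move=> i /andP[ipq Pi]; exact: wF.
Qed.

Definition opsum (u : R -> R) (t : R) : R :=
  \sum_(1 <= i < m.+1) prodop g (A i) (d i) (delta i) u t.

Lemma opsum_wcont u : wcont X g u -> wcont X g (opsum u).
Proof.
by move=> wu; apply: wcont_sum_nat => i im _; apply: prodop_wcont => //; [exact: delta_ge0|exact: wA].
Qed.

Lemma RLint_opsum u t : wcont X g u -> 0 < t < X ->
  RLint g (opsum u) t = \sum_(1 <= i < m.+1) A i t * RLint (g + delta i) u t.
Proof.
move=> wu tX; rewrite RLint_sum_nat//; last first.
  by move=> i im _; apply: prodop_wcont => //; [exact: delta_ge0|exact: wA].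
apply: eq_big_nat => i im.
exact: (RLint_prodop g0 g1 (delta_ge0 im) (wA im) wu tX).
Qed.

Lemma opsumD u v t : wcont X g u -> wcont X g v -> 0 < t < X ->
  opsum (fun s => u s + v s) t = opsum u t + opsum v t.
Proof.
move=> wu wv tX; rewrite /opsum -big_split; apply: eq_big_nat => i im.
exact: (prodopD g0 g1 (delta_ge0 im) (wA im) wu wv tX).
Qed.

Lemma opsum_ext u v : wcont X g v -> (forall s, 0 < s < X -> u s = v s) ->
  forall t, 0 < t < X -> opsum u t = opsum v t.
Proof.
move=> wv uv t tX; apply: eq_big_nat => i im.
exact: (prodop_ext g0 g1 (delta_ge0 im) (wA im) wv uv tX).
Qed.

(* For a large [lam] the weight [expR (lam * t)] absorbs the constants of the kernels,
   because each [prodop] gains a factor [lam `^ (- eta)] as soon as [eta < delta i]. *)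
Lemma opsum_contraction : exists2 lam, 0 < lam & forall N u, 0 <= N -> wcont X g u ->
  (forall t, 0 < t < X -> `|u t| <= N * (t `^ (- g) * expR (lam * t))) ->
  forall t, 0 < t < X -> `|opsum u t| <= 2^-1 * N * (t `^ (- g) * expR (lam * t)).
Proof.
pose eta := dmin / 2; have eta0 : 0 < eta by rewrite divr_gt0.
have etad i : (1 <= i < m.+1)%N -> 0 < eta < delta i.
  move=> /delta_ge h; rewrite eta0 (lt_le_trans _ h)// /eta ltr_pdivrMr// ltr_pMr//.
  by rewrite ltr1n.
have H k : (k <= m)%N -> exists2 C, 0 <= C & forall lam N u, 0 < lam -> 0 <= N -> wcont X g u ->
    (forall t, 0 < t < X -> `|u t| <= N * (t `^ (- g) * expR (lam * t))) ->
    forall t, 0 < t < X -> `|\sum_(1 <= i < k.+1) prodop g (A i) (d i) (delta i) u t| <=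
      C * lam `^ (- eta) * N * (t `^ (- g) * expR (lam * t)).
  elim: k => [|k IH] km.
    by exists 0 => // lam N u _ _ _ _ t _; rewrite big_geq// normr0 !mul0r.
  have [C C0 hC] := IH (ltnW km).
  have km' : (1 <= k.+1 < m.+1)%N by rewrite ltnS.
  have [D D0 hD] := prodop_contraction g0 g1 (etad _ km') (wA km').
  exists (C + D); first exact: addr_ge0.
  move=> lam N u l0 N0 wu uN t tX; rewrite big_nat_recr//=.
  rewrite (le_trans (ler_normD _ _))// !mulrDl lerD ?hC//.
  exact: (hD lam N X u l0 N0 (lexx _) wu uN t tX).
have [C C0 hC] := H m (leqnn m).
have C1 : 0 < 2 * C + 1 by rewrite ltr_wpDl// mulr_ge0.
exists ((2 * C + 1) `^ (eta^-1)); first exact: powR_gt0.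
move=> N u N0 wu uN t tX; apply: (le_trans (hC _ N u (powR_gt0 _ C1) N0 wu uN t tX)).
have -> : ((2 * C + 1) `^ eta^-1) `^ (- eta) = (2 * C + 1)^-1.
  by rewrite -powRrM mulrN mulVf ?gt_eqF// powRN powRr1// ltW.
apply: ler_wpM2r; first by apply: mulr_ge0; [exact: powR_ge0|exact: expR_ge0].
apply: ler_wpM2r => //; rewrite ler_pdivrMr//; lra.
Qed.

Lemma RLintN p u t : 0 <= p -> wcont X g u -> 0 < t < X ->
  RLint p (fun s => - u s) t = - RLint p u t.
Proof.
move=> p0 wu tX; rewrite -mulN1r -(RLintZ (-1) g1 p0 wu tX).
by congr (RLint p _ t); apply/funext => s; rewrite mulN1r.
Qed.

Lemma RLintB p u v t : 0 <= p -> wcont X g u -> wcont X g v -> 0 < t < X ->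
  RLint p (fun s => u s - v s) t = RLint p u t - RLint p v t.
Proof.
by move=> p0 wu wv tX; rewrite (RLintD g1 p0 wu (wcontN wv) tX) (RLintN p0 wv tX).
Qed.

Lemma opsum_fixpoint_unique w : wcont X g w ->
  (forall t, 0 < t < X ->
    RLint g w t + \sum_(1 <= i < m.+1) A i t * RLint (g + delta i) w t = 0) ->
  forall t, 0 < t < X -> w t = 0.
Proof.
move=> ww wE; have [lam lam0 hlam] := opsum_contraction.
have wL := opsum_wcont ww.
apply: (neumann_unique lam0 hlam ww) => t tX.
apply: (RLint_inj g0 g1 ww (wcontN wL)) tX => s sX.
rewrite (RLintN g_ge0 wL sX) (RLint_opsum ww sX).
by apply/eqP; rewrite -addr_eq0 wE.
Qed.

End Operator.

Lemma big_nat_delta (R : realType) (j p q : nat) (f : nat -> R) :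
  \sum_(p <= k < q) (k == j)%:R * f k = if (p <= j < q)%N then f j else 0.
Proof.
rewrite -(big_nat1_eq (idx := 0) +%R) big_mkcond; apply: eq_bigr => k _.
by case: ifP => _; rewrite ?mul1r ?mul0r.
Qed.

Lemma order_of_nat (R : realType) (x : R) (n : nat) : n%:R - 1 < x <= n%:R -> order_of x = n.
Proof.
move=> h; rewrite /order_of (@ceil_def R x n%:Z)//.
by rewrite rmorphB/= -!pmulrn.
Qed.

Section AtZero.
Context {R : realType}.

Definition cvg_at0 (f : R -> R) := exists l : R, f t @[t --> 0^'+] --> l.

Lemma cvg_at0D f h : cvg_at0 f -> cvg_at0 h -> cvg_at0 (fun t => f t + h t).
Proof. by move=> [l fl] [k hk]; exists (l + k); exact: cvgD. Qed.

Lemma cvg_at0Z c f : cvg_at0 f -> cvg_at0 (fun t => c * f t).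
Proof. by move=> [l fl]; exists (c * l); exact: cvgM (cvg_cst c) fl. Qed.

Lemma cvg_at0_sum (p q : nat) (P : pred nat) (F : nat -> R -> R) :
  (forall i, (p <= i < q)%N -> P i -> cvg_at0 (F i)) ->
  cvg_at0 (fun t => \sum_(p <= i < q | P i) F i t).
Proof.
move=> hF; under eq_fun do rewrite big_nat_cond.
have {}hF i : (p <= i < q)%N && P i -> cvg_at0 (F i) by move=> /andP[]; exact: hF.
elim: (index_iota p q) => [|i s IH].
  by under eq_fun do rewrite big_nil; exists 0; exact: cvg_cst.
under eq_fun do rewrite big_cons.
case: (boolP ((p <= i < q)%N && P i)) => // /hF Fi.
exact: cvg_at0D.
Qed.

Lemma cvg_at0_eq (T : R) f h : 0 < T -> (forall t, 0 < t < T -> f t = h t) -> cvg_at0 f -> cvg_at0 h.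
Proof. by move=> T0 fh [l fl]; exists l; exact: cvg_at0_ext T0 fh fl. Qed.

End AtZero.

(** * The initial value problem *)

Section Problem.
Context {R : realType}.
Variables (X T g : R) (m : nat) (alpha : nat -> R) (n : nat -> nat).
Variables (a A d : nat -> R -> R).
Hypotheses (g0 : 0 < g) (g1 : g < 1) (TX : 0 < T < X) (m_ge1 : (1 <= m)%N).
Hypothesis alpha_decr : forall i, (i < m)%N -> alpha i.+1 < alpha i.
Hypothesis alpha_m_ge0 : 0 <= alpha m.
Hypothesis n_def : forall i, (i <= m)%N -> (n i)%:R - 1 < alpha i <= (n i)%:R.
Hypothesis g_def : g = (n 0%N)%:R - alpha 0%N.
Hypothesis wA : forall i, (1 <= i < m.+1)%N -> wdiff X g (A i) (d i).
Hypothesis AE : forall i, (1 <= i < m.+1)%N -> forall t, 0 <= t <= T -> A i t = a i t.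
Hypothesis A0 : forall i, (1 <= i < m.+1)%N -> cvg_at0 (A i).

Local Notation N := (n 0%N).
Local Notation L := (opsum g m (fun i => alpha 0%N - alpha i) A d).
Local Notation dlt j := (fun k : nat => (k == j)%:R : R).

Let g_ge0 : 0 <= g. Proof. exact: ltW. Qed.
Let T0 : 0 < T. Proof. by case/andP: TX. Qed.
Let X0 : 0 < X. Proof. by case/andP: TX; exact: lt_trans. Qed.

Let inX t : 0 < t <= T -> 0 < t < X.
Proof. by case/andP: TX => _ TX' /andP[-> tT]; exact: le_lt_trans TX'. Qed.

Let inX' t : 0 < t < T -> 0 < t < X.
Proof. by move=> /andP[t0 /ltW tT]; apply: inX; rewrite t0. Qed.

Lemma alpha_lt i j : (i < j <= m)%N -> alpha j < alpha i.
Proof.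
move=> /andP[]; elim: j => // j IH; rewrite ltnS leq_eqVlt => /predU1P[->|ij] jm.
  exact: alpha_decr.
exact: lt_trans (alpha_decr jm) (IH ij (ltnW jm)).
Qed.

Lemma alpha_le i j : (i <= j <= m)%N -> alpha j <= alpha i.
Proof.
move=> /andP[]; rewrite leq_eqVlt => /predU1P[->//|ij jm].
by apply/ltW/alpha_lt; rewrite ij.
Qed.

Lemma alpha_ge0 i : (i <= m)%N -> 0 <= alpha i.
Proof. by move=> im; apply: (le_trans alpha_m_ge0); apply: alpha_le; rewrite im/=. Qed.

Lemma order_of_alpha i : (i <= m)%N -> order_of (alpha i) = n i.
Proof. by move=> /n_def/order_of_nat. Qed.

Lemma n_le_nat i j : (i <= m)%N -> (n i <= j)%N = (alpha i <= j%:R).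
Proof.
move=> im; have /andP[h1 h2] := n_def im; apply/idP/idP => h.
  by apply: (le_trans h2); rewrite ler_nat.
have : (n i)%:R - 1 < j%:R :> R by exact: lt_le_trans h.
by rewrite ltrBlDr natr1 ltr_nat ltnS.
Qed.

Lemma n_le_n0 i : (i <= m)%N -> (n i <= N)%N.
Proof.
move=> im; rewrite n_le_nat//; have /andP[_ h2] := n_def (leq0n m).
by apply: le_trans h2; apply: alpha_le; rewrite im.
Qed.

Lemma delta_ge i : (1 <= i < m.+1)%N -> alpha 0%N - alpha 1%N <= alpha 0%N - alpha i.
Proof. by move=> im; rewrite lerD2l lerN2 alpha_le. Qed.

Lemma delta1_gt0 : 0 < alpha 0%N - alpha 1%N.
Proof. by rewrite subr_gt0; apply: alpha_decr. Qed.

(* For [y = taylor c u N] the Caputo derivative of order [alpha i] is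
   [ucoef c i + RLint (N%:R - alpha i) u], and [N%:R - alpha i = g + (alpha 0%N - alpha i)]. *)
Definition ucoef (c : nat -> R) (i : nat) (t : R) : R :=
  \sum_(n i <= k < N) c k * Phi (k.+1%:R - alpha i) t.

Definition ueqn (Y : R) (c : nat -> R) (u : R -> R) : Prop := forall t, 0 < t < Y ->
  RLint g u t + \sum_(1 <= i < m.+1) A i t * (ucoef c i t + RLint (g + (alpha 0%N - alpha i)) u t) = 0.

Lemma ueqn_solves c u : wcont X g u ->
  ueqn T c u <-> solves_eq T m alpha a (taylor c u N).
Proof.
move=> wu; suff H t : 0 < t < T ->
    (RLint g u t + \sum_(1 <= i < m.+1) A i t * (ucoef c i t + RLint (g + (alpha 0%N - alpha i)) u t) = 0 <->
    Caputo T (alpha 0%N) (taylor c u N) t =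
      - \sum_(1 <= i < m.+1) a i t * Caputo T (alpha i) (taylor c u N) t).
  by split=> h t tT; apply/(H t tT); exact: h.
move=> /andP[t0 /ltW tT]; have tT' : 0 < t <= T by rewrite t0.
have CE i : (i <= m)%N -> Caputo T (alpha i) (taylor c u N) t =
    ucoef c i t + RLint (N%:R - alpha i) u t.
  move=> im; have oi := order_of_alpha im; have /andP[_ ai] := n_def im.
  by rewrite (Caputo_taylor X0 g_ge0 g1 TX c wu (alpha_ge0 im)) ?oi// n_le_n0.
have -> : Caputo T (alpha 0%N) (taylor c u N) t = RLint g u t.
  by rewrite CE// /ucoef big_geq// add0r -g_def.
have -> : \sum_(1 <= i < m.+1) a i t * Caputo T (alpha i) (taylor c u N) t =
    \sum_(1 <= i < m.+1) A i t * (ucoef c i t + RLint (g + (alpha 0%N - alpha i)) u t).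
  apply: eq_big_nat => i im; rewrite AE ?(ltW t0)// CE; last by case/andP: im.
  by have -> : g + (alpha 0%N - alpha i) = N%:R - alpha i by rewrite g_def; ring.
by split => [/eqP|->]; [rewrite addr_eq0 => /eqP|rewrite addNr].
Qed.

Lemma ueqn_unique c u v : wcont X g u -> wcont X g v -> ueqn T c u -> ueqn T c v ->
  forall t, 0 < t < T -> u t = v t.
Proof.
move=> wu wv hu hv t tT; have TX' : T <= X by case/andP: TX => _ /ltW.
apply/eqP; rewrite -subr_eq0; apply/eqP; move: t tT.
have wuT := wcontW TX' wu; have wvT := wcontW TX' wv.
apply: (@opsum_fixpoint_unique R T g _ m (fun i => alpha 0%N - alpha i) A d g0 g1 delta1_gt0 delta_ge).
- by move=> i /wA; exact: wdiffW.
- by apply: wcontD => //; exact: wcontN.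
move=> t tT; have p0 i : (1 <= i < m.+1)%N -> 0 <= g + (alpha 0%N - alpha i).
  by move=> im; apply: addr_ge0 => //; apply: le_trans (delta_ge im); exact/ltW/delta1_gt0.
rewrite (RLintB g1 g_ge0 wuT wvT tT).
have -> : \sum_(1 <= i < m.+1) A i t * RLint (g + (alpha 0%N - alpha i)) (fun s => u s - v s) t =
    \sum_(1 <= i < m.+1) A i t * (ucoef c i t + RLint (g + (alpha 0%N - alpha i)) u t) -
    \sum_(1 <= i < m.+1) A i t * (ucoef c i t + RLint (g + (alpha 0%N - alpha i)) v t).
  rewrite -sumrB; apply: eq_big_nat => i im; rewrite (RLintB g1 (p0 i im) wuT wvT tT).
  by ring.
have := hu t tT; have := hv t tT; lra.
Qed.

(* [RLint g (source j)] is the sum of the [a_i * Phi (j + 1 - alpha_i)] over [Hset j]. *)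
Definition source (j : nat) (t : R) : R :=
  \sum_(1 <= i < m.+1 | (n i <= j)%N) prodop g (A i) (d i) (j%:R - alpha i) (Phi (1 - g)) t.

Let jalpha_ge0 i j : (1 <= i < m.+1)%N -> (n i <= j)%N -> 0 <= j%:R - alpha i.
Proof. by move=> /andP[_ im]; rewrite n_le_nat// subr_ge0. Qed.

Let wPhi : wcont X g (Phi (1 - g)). Proof. exact: Phi_wcont. Qed.

Lemma source_wcont j : wcont X g (source j).
Proof.
apply: wcont_sum_nat => i im nij; apply: prodop_wcont => //; last exact: wA.
exact: jalpha_ge0.
Qed.

Lemma RLint_source j t : 0 < t < X -> RLint g (source j) t =
  \sum_(1 <= i < m.+1 | (n i <= j)%N) A i t * Phi (j.+1%:R - alpha i) t.
Proof.
move=> /[dup] tX /andP[t0 _]; rewrite (RLint_sum_nat g1 g_ge0 _ tX); last first.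
  by move=> i im nij; apply: prodop_wcont => //; [exact: jalpha_ge0|exact: wA].
rewrite big_nat_cond [RHS]big_nat_cond; apply: eq_bigr => i /andP[im nij].
have h := jalpha_ge0 im nij; have h' : 0 <= g + (j%:R - alpha i) by exact: addr_ge0.
have h1 : 0 < 1 - g by rewrite subr_gt0.
rewrite (RLint_prodop g0 g1 h (wA im) wPhi tX) (RLint_Phi h' h1 t0).
by rewrite -natr1; congr (_ * Phi _ _); ring.
Qed.

Lemma source_cvg_at0 j : cvg_at0 (fun t => t `^ g * source j t).
Proof.
have E (t : R) : 0 < t < T -> \sum_(1 <= i < m.+1 | (n i <= j)%N)
    t `^ g * prodop g (A i) (d i) (j%:R - alpha i) (Phi (1 - g)) t = t `^ g * source j t.
  by move=> _; rewrite big_distrr.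
apply: (cvg_at0_eq T0 E); apply: cvg_at0_sum => i im nij.
apply: (powR_prodop_cvg g0 g1 TX) => //; [exact: jalpha_ge0|exact: wA|move=> _].
have E' (t : R) : 0 < t < T -> (Gamma (1 - g))^-1 * A i t = t `^ g * (A i t * Phi (1 - g) t).
  move=> /andP[t0 _]; rewrite /Phi.
  have -> : 1 - g - 1 = - g by ring.
  have tg : t `^ g != 0 by rewrite gt_eqF// powR_gt0.
  have Gg : Gamma (1 - g) != 0 by rewrite gt_eqF// Gamma_gt0// subr_gt0.
  by rewrite powRN; field; rewrite ?tg ?Gg.
by apply: (cvg_at0_eq T0 E'); apply: cvg_at0Z; exact: A0.
Qed.

Let L_wcont u : wcont X g u -> wcont X g (L u).
Proof.
exact: (@opsum_wcont R X g _ m (fun i => alpha 0%N - alpha i) A d g0 g1 delta1_gt0 delta_ge wA u).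
Qed.

Let RLint_L u t : wcont X g u -> 0 < t < X ->
  RLint g (L u) t = \sum_(1 <= i < m.+1) A i t * RLint (g + (alpha 0%N - alpha i)) u t.
Proof.
exact: (@RLint_opsum R X g _ m (fun i => alpha 0%N - alpha i) A d g0 g1 delta1_gt0 delta_ge wA u t).
Qed.

Lemma fixpoint_cvg_at0 j u : wcont X g u ->
  (forall t, 0 < t < X -> u t = - source j t - L u t) -> cvg_at0 (fun t => t `^ g * u t).
Proof.
move=> wu uE.
have E (t : R) : 0 < t < T -> (-1) * (t `^ g * source j t + \sum_(1 <= i < m.+1)
    t `^ g * prodop g (A i) (d i) (alpha 0%N - alpha i) u t) = t `^ g * u t.
  by move=> tT; rewrite (uE _ (inX' tT)) /opsum -big_distrr/=; ring.
apply: (cvg_at0_eq T0 E); apply: cvg_at0Z; apply: cvg_at0D; first exact: source_cvg_at0.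
apply: cvg_at0_sum => i im _; have h := lt_le_trans delta1_gt0 (delta_ge im).
apply: (powR_prodop_cvg g0 g1 TX (ltW h) (wA im) wu) => h0.
by rewrite h0 ltxx in h.
Qed.

Lemma fixpoint_ueqn j u : (j < N)%N -> wcont X g u ->
  (forall t, 0 < t < X -> u t = - source j t - L u t) -> ueqn X (dlt j) u.
Proof.
move=> jN wu uE t tX; have wL := L_wcont wu; have wS := source_wcont j.
have wLS := wcontD wS wL.
have E : RLint g u t = RLint g (fun s => - (source j s + L u s)) t.
  apply: (eq_RLint_wcont g_ge0 (wcontN wLS) tX) => s /andP[s0 st].
  by rewrite uE ?opprD// s0 (le_lt_trans st)//; case/andP: tX.
rewrite E (RLintN g1 g_ge0 wLS tX) (RLintD g1 g_ge0 wS wL tX) (RLint_L wu tX) (RLint_source _ tX).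
rewrite opprD big_mkcond.
under [X in _ + X]eq_bigr do rewrite mulrDr.
rewrite big_split/= addrACA [X in _ + X]addNr addr0.
rewrite -[X in X + _]sumrN -big_split/= big1// => i _.
rewrite /ucoef big_nat_delta jN andbT.
by case: ifP => _; rewrite ?mulr0 ?oppr0 ?addr0// addNr.
Qed.

Lemma neumann_series j : exists u,
  [/\ wcont X g u, forall t, 0 < t < X -> u t = - source j t - L u t &
    exists2 C, 0 <= C & forall k t, 0 < t < X ->
      `|u t - \sum_(0 <= i < k) neumann L (source j) i t| <= C * 2^-1 ^+ k * t `^ (- g)].
Proof.
have [lam lam0 hlam] := opsum_contraction g0 g1 delta1_gt0 delta_ge wA.
have LD := opsumD g0 g1 delta1_gt0 delta_ge wA.
have Lext := opsum_ext g0 g1 delta1_gt0 delta_ge wA.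
exact: (neumann_exists lam0 L_wcont LD Lext hlam (source_wcont j)).
Qed.

Let wn j k : wcont X g (neumann L (source j) k).
Proof. by apply: neumann_wcont; [exact: L_wcont|exact: source_wcont]. Qed.

Lemma RLint_neumann j k t : 
  (forall G : nat -> R, \sum_(hmin m alpha j <= i < m.+1) G i = \sum_(1 <= i < m.+1 | (n i <= j)%N) G i) ->
  0 < t <= T -> RLint g (neumann L (source j) k) t = (-1) ^+ k.+1 *
    iter k (bracket m alpha a) (fun s => \sum_(hmin m alpha j <= i < m.+1) a i s * Phi (j.+1%:R - alpha i) s) t.
Proof.
move=> hm; elim: k t => [|k IH] t tT.
  rewrite /= (RLintN g1 g_ge0 (source_wcont j) (inX tT)) (RLint_source _ (inX tT)) hm expr1 mulN1r.
  rewrite big_nat_cond [in RHS]big_nat_cond; congr (- _); apply: eq_bigr => i /andP[im _].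
  by case/andP: tT => /ltW t0 tT; rewrite AE// t0.
rewrite /= (RLintN g1 g_ge0 (L_wcont (wn j k)) (inX tT)) (RLint_L (wn j k) (inX tT)).
rewrite exprS -mulrA mulN1r; congr (- _); rewrite /bracket big_distrr/=.
apply: eq_big_nat => i im; have d0 := le_trans (ltW delta1_gt0) (delta_ge im).
have tT' : 0 <= t <= T by case/andP: tT => /ltW -> ->.
rewrite (AE im tT') mulrCA; congr (_ * _).
have wI := wcont_RLint g1 g_ge0 (wn j k).
set f := iter k _ _.
have E : RLint (alpha 0%N - alpha i) f t =
    RLint (alpha 0%N - alpha i) (fun s => (-1) ^+ k.+1 * RLint g (neumann L (source j) k) s) t.
  apply: (eq_RLint_wcont d0 (wcontZ _ wI) (inX tT)) => s /andP[s0 st].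
  rewrite IH; first by rewrite mulrA -exprMn mulrNN mulr1 expr1n mul1r.
  by rewrite s0 (le_trans st)//; case/andP: tT.
rewrite E (RLintZ _ g1 d0 wI (inX tT)) mulrA -exprMn mulrNN mulr1 expr1n mul1r.
by rewrite (RLint_semigroup g1 g_ge0 d0 g_ge0 (wn j k) (inX tT)) addrC.
Qed.

Lemma sol_term_neumann j k t : 
  (forall G : nat -> R, \sum_(hmin m alpha j <= i < m.+1) G i = \sum_(1 <= i < m.+1 | (n i <= j)%N) G i) ->
  0 < t <= T -> sol_term m alpha a j t k = RLint N%:R (neumann L (source j) k) t.
Proof.
move=> hm tT; have a0 := alpha_ge0 (leq0n m).
have wI := wcont_RLint g1 g_ge0 (wn j k).
rewrite /sol_term; set f := iter k _ _.
have E : RLint (alpha 0%N) f t =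
    RLint (alpha 0%N) (fun s => (-1) ^+ k.+1 * RLint g (neumann L (source j) k) s) t.
  apply: (eq_RLint_wcont a0 (wcontZ _ wI) (inX tT)) => s /andP[s0 st].
  rewrite (RLint_neumann k hm); first by rewrite mulrA -exprMn mulrNN mulr1 expr1n mul1r.
  by rewrite s0 (le_trans st)//; case/andP: tT.
rewrite E (RLintZ _ g1 a0 wI (inX tT)) mulrA -exprMn mulrNN mulr1 expr1n mul1r.
rewrite (RLint_semigroup g1 g_ge0 a0 g_ge0 (wn j k) (inX tT)).
by congr (RLint _ _ _); rewrite g_def; ring.
Qed.

Lemma sol_term_cvg j u C t : (0 < N)%N ->
  (forall G : nat -> R, \sum_(hmin m alpha j <= i < m.+1) G i = \sum_(1 <= i < m.+1 | (n i <= j)%N) G i) ->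
  wcont X g u -> 0 <= C -> (forall k t, 0 < t < X ->
      `|u t - \sum_(0 <= i < k) neumann L (source j) i t| <= C * 2^-1 ^+ k * t `^ (- g)) ->
  0 <= t <= T -> series (sol_term m alpha a j t) x @[x --> \oo] --> RLint N%:R u t.
Proof.
move=> N0 hm wu C0 hC /andP[]; rewrite le_eqVlt => /predU1P[<- _|t0 tT].
  have a0 : alpha 0%N != 0.
    by apply: lt0r_neq0; apply: (le_lt_trans (alpha_ge0 m_ge1)); exact: alpha_decr.
  rewrite RLint_at0 ?pnatr_eq0 -?lt0n//.
  have -> : series (sol_term m alpha a j 0) = fun=> 0.
    by apply/funext => k; apply: big1 => i _; rewrite /sol_term RLint_at0// mulr0.
  exact: cvg_cst.
have tX : 0 < t < X by apply: inX; rewrite t0.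
have tX' : t <= X by case/andP: tX => _ /ltW.
have Np : 0 < N%:R :> R by rewrite ltr0n.
pose S k s := \sum_(0 <= i < k) neumann L (source j) i s.
have wS k : wcont X g (S k) by apply: wcont_sum => i _; exact: wn.
have SE k : series (sol_term m alpha a j t) k = RLint N%:R (S k) t.
  rewrite /S (@RLint_sum R X g)//.
  by apply: eq_bigr => i _; apply: sol_term_neumann => //; rewrite t0.
apply/cvgrPdist_lt => e e0.
pose B := (Gamma N%:R)^-1 * (t `^ (N%:R - g) * beta N%:R (1 - g)).
have [k0 hk0] := half_pow_small (B * C) e0.
have B0 : 0 <= B.
  apply: mulr_ge0; first exact: invGamma_ge0.
  by apply: mulr_ge0; [exact: powR_ge0|rewrite ltW// beta_gt0// subr_gt0].
exists k0 => // k /= k0k; rewrite SE -(RLintB g1 (ltW Np) wu (wS k) tX).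
apply: le_lt_trans hk0.
have wuS : wcont X g (fun s => u s - S k s) by apply: wcontD => //; exact: wcontN.
apply: (le_trans (RLint_bound Np g1 t0 (wcont_measurable wuS tX') _)).
  by move=> s /andP[s0 st]; apply: hC; rewrite s0 (lt_le_trans st).
have -> : (Gamma N%:R)^-1 * (C * 2^-1 ^+ k) * (t `^ (N%:R - g) * beta N%:R (1 - g)) = B * C * 2^-1 ^+ k.
  by rewrite /B; move: (beta _ _) => b; ring.
apply: ler_wpM2l; first exact: mulr_ge0.
by apply: ler_wiXn2l => //; rewrite invf_le1// ler1n.
Qed.

Lemma ueqn_sum b (u : nat -> R -> R) : (forall j, wcont X g (u j)) ->
  (forall j, (j < N)%N -> ueqn X (dlt j) (u j)) ->
  ueqn X b (fun t => \sum_(0 <= j < N) b j * u j t).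
Proof.
move=> wu hu t tX.
have RE p : 0 <= p -> RLint p (fun t => \sum_(0 <= j < N) b j * u j t) t =
    \sum_(0 <= j < N) b j * RLint p (u j) t.
  move=> p0; rewrite (@RLint_sum R X g)// => [|i _]; last exact: wcontZ.
  by apply: eq_bigr => i _; rewrite (RLintZ _ g1 p0 (wu i) tX).
have UE i : (i <= m)%N -> ucoef b i t = \sum_(0 <= j < N) b j * ucoef (dlt j) i t.
  move=> im; rewrite /ucoef (big_nat_widenl _ 0)//= big_mkcond; apply: eq_big_nat => j /andP[_ jN].
  by rewrite big_nat_delta jN andbT; case: ifP => _; rewrite ?mulr0.
rewrite (RE _ g_ge0).
have -> : \sum_(1 <= i < m.+1) A i t * (ucoef b i t +
    RLint (g + (alpha 0%N - alpha i)) (fun s => \sum_(0 <= j < N) b j * u j s) t) =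
  \sum_(0 <= j < N) b j * \sum_(1 <= i < m.+1) A i t * (ucoef (dlt j) i t +
    RLint (g + (alpha 0%N - alpha i)) (u j) t).
  under [RHS]eq_bigr do rewrite big_distrr/=.
  rewrite exchange_big_nat/=; apply: eq_big_nat => i im.
  have p0 : 0 <= g + (alpha 0%N - alpha i).
    by apply: addr_ge0 => //; apply: le_trans (delta_ge im); exact/ltW/delta1_gt0.
  rewrite UE; last by case/andP: im.
  rewrite (RE _ p0) -big_split/= big_distrr/=; apply: eq_bigr => j _.
  by ring.
rewrite -big_split/= big1_seq// => j; rewrite mem_index_iota => /andP[_ jN].
by rewrite -mulrDr hu// mulr0.
Qed.

Lemma taylor_sum b (u : nat -> R -> R) t : (0 < N)%N -> (forall j, wcont X g (u j)) ->
  0 <= t <= T -> taylor b (fun t => \sum_(0 <= j < N) b j * u j t) N t =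
  \sum_(0 <= j < N) b j * taylor (dlt j) (u j) N t.
Proof.
move=> N0 wu /andP[t0 tT].
have RE : RLint N%:R (fun t => \sum_(0 <= j < N) b j * u j t) t =
    \sum_(0 <= j < N) b j * RLint N%:R (u j) t.
  move: t0; rewrite le_eqVlt => /predU1P[<-|t0].
    have N1 : N%:R != 0 :> R by rewrite pnatr_eq0 -lt0n.
    by rewrite RLint_at0// big1// => j _; rewrite RLint_at0// mulr0.
  have tX : 0 < t < X by apply: inX; rewrite t0.
  have Np : 0 <= N%:R :> R by rewrite ler0n.
  rewrite (@RLint_sum R X g)// => [|i _]; last exact: wcontZ.
  by apply: eq_bigr => i _; rewrite (RLintZ _ g1 Np (wu i) tX).
rewrite /taylor RE -big_split/=; apply: eq_big_nat => j /andP[_ jN].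
by rewrite big_nat_delta jN /= mulrDr.
Qed.

Lemma mem_Hset j i : (1 <= i < m.+1)%N -> (i \in Hset m alpha j) = (n i <= j)%N.
Proof.
move=> /[dup] im /andP[_ im']; rewrite mem_filter mem_index_iota im andbT n_le_nat//.
by rewrite alpha_ge0.
Qed.

Lemma bigmin_mem (s : seq nat) (x : nat) :
  (\big[minn/x]_(i <- s) i \in x :: s) /\ {in s, forall y, (\big[minn/x]_(i <- s) i <= y)%N}.
Proof.
elim: s => [|z s [IH1 IH2]]; first by rewrite big_nil mem_head.
rewrite big_cons; set M := \big[minn/x]_(i <- s) i in IH1 IH2 *; split; last first.
  move=> y; rewrite inE => /predU1P[->|ys]; first exact: geq_minl.
  by apply: leq_trans (IH2 _ ys); exact: geq_minr.
rewrite /minn; case: ifP => _; first by rewrite !inE eqxx orbT.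
by move: IH1; rewrite !inE => /orP[->//|->]; rewrite !orbT.
Qed.

Lemma hmin_sum j (G : nat -> R) : Hset m alpha j <> [::] ->
  \sum_(hmin m alpha j <= i < m.+1) G i = \sum_(1 <= i < m.+1 | (n i <= j)%N) G i.
Proof.
move=> Hj; have mm : (1 <= m < m.+1)%N by rewrite m_ge1/=.
have mH : m \in Hset m alpha j.
  case E: (Hset m alpha j) Hj => [//|i s] _; have iH : i \in Hset m alpha j by rewrite E mem_head.
  rewrite -E; move: iH; rewrite !mem_filter !mem_index_iota mm alpha_m_ge0 andbT /=.
  move=> /andP[/andP[_ ij] /andP[_ im]]; apply: le_trans ij; apply: alpha_le.
  by rewrite leqnn andbT.
have [h1 h2] := bigmin_mem (Hset m alpha j) m.
rewrite -/(hmin m alpha j) in h1 h2.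
have {}h1 : hmin m alpha j \in Hset m alpha j by move: h1; rewrite inE => /predU1P[->|].
have /andP[/andP[_ hj] hm] : (0 <= alpha (hmin m alpha j) <= j%:R) && (1 <= hmin m alpha j < m.+1)%N.
  by move: h1; rewrite mem_filter mem_index_iota.
rewrite (big_nat_widenl _ 1); last by case/andP: hm.
rewrite big_nat_cond [RHS]big_nat_cond; apply: eq_bigl => i.
case im : (1 <= i < m.+1)%N => //=; apply/idP/idP => h; last by apply: h2; rewrite mem_Hset.
rewrite n_le_nat; last by case/andP: im.
by apply: le_trans hj; apply: alpha_le; rewrite h; case/andP: im.
Qed.

Lemma Hset_neq_nil j k : (j <= k)%N -> Hset m alpha j <> [::] -> Hset m alpha k <> [::].
Proof.
move=> jk; case E: (Hset m alpha j) => [//|i s] _ kE.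
have : i \in Hset m alpha j by rewrite E mem_head.
rewrite mem_filter => /andP[/andP[i0 ij] im].
have : i \in Hset m alpha k by rewrite mem_filter im i0 (le_trans ij)// ler_nat.
by rewrite kE.
Qed.

Lemma fixpoint_eq0 j u : (j < N)%N -> Hset m alpha j = [::] -> wcont X g u -> ueqn X (dlt j) u ->
  forall t, 0 < t < X -> u t = 0.
Proof.
move=> jN Hj wu hu.
apply: (@opsum_fixpoint_unique R X g _ m (fun i => alpha 0%N - alpha i) A d g0 g1 delta1_gt0 delta_ge wA u wu).
move=> t tX; rewrite -[RHS](hu t tX); congr (_ + _); apply: eq_big_nat => i im.
by rewrite /ucoef big_nat_delta -mem_Hset// Hj/= add0r.
Qed.

Lemma sol_taylor j0 j u C t : (j < N)%N -> (forall k, (k <= j0)%N -> Hset m alpha k = [::]) ->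
  (forall k, (j0 < k)%N -> Hset m alpha k <> [::]) ->
  wcont X g u -> (forall t, 0 < t < X -> u t = - source j t - L u t) -> 0 <= C ->
  (forall k t, 0 < t < X ->
    `|u t - \sum_(0 <= i < k) neumann L (source j) i t| <= C * 2^-1 ^+ k * t `^ (- g)) ->
  0 <= t <= T -> sol m alpha a j0 j t = taylor (dlt j) u N t.
Proof.
move=> jN H0 H1 wu uE C0 hC tT; have N0 : (0 < N)%N by apply: leq_ltn_trans jN.
rewrite /sol /taylor big_nat_delta jN /=; case: ifPn => jj0; last first.
  rewrite -ltnNge in jj0; have hm G := hmin_sum G (H1 j jj0).
  by congr (_ + _); apply/cvg_lim => //; exact: sol_term_cvg hC tT.
have u0 := fixpoint_eq0 jN (H0 j jj0) wu (fixpoint_ueqn jN wu uE).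
rewrite -[LHS]addr0; congr (_ + _); case/andP: tT; rewrite le_eqVlt => /predU1P[<- _|t0 tT].
  by rewrite RLint_at0// pnatr_eq0 -lt0n.
have Np : 0 <= N%:R :> R by rewrite ler0n.
have tX : 0 < t < X by apply: inX; rewrite t0.
rewrite -(RLint_cst0 N%:R t); apply/esym/(eq_RLint_wcont Np (wcont0 X g) tX) => s /andP[s0 st].
by apply: u0; rewrite s0 (le_lt_trans st)//; case/andP: tX.
Qed.

Lemma solution_unique p b u z : N = p.+1 -> wcont X g u -> ueqn X b u ->
  Cn_space N g T z -> solves_eq T m alpha a z -> init_cond T N b z ->
  forall t, 0 <= t <= T -> z t = taylor b u N t.
Proof.
move=> Np wu hu zC zeq zb t tT; have [v wv zv] : exists2 v, wcont X g v &
    forall t, 0 <= t <= T -> z t = taylor b v N t.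
  rewrite Np in zC zb *; have [v wv zv] := Cn_space_taylor g0 g1 TX zC; exists v => // s sT.
  rewrite zv// /taylor; congr (_ + _); apply: eq_big_nat => k /andP[_ kp].
  by rewrite (init_cond_derivn TX zC zb).
have hv : ueqn T b v by apply/(ueqn_solves b wv); apply: solves_eq_ext T0 zv zeq.
have hu' : ueqn T b u by move=> s /inX'; exact: hu.
have vu := ueqn_unique wv wu hv hu'.
rewrite zv// /taylor; congr (_ + _); case/andP: tT; rewrite le_eqVlt => /predU1P[<- _|t0 tT].
  by rewrite !RLint_at0// pnatr_eq0 Np.
have N0 : 0 < N%:R :> R by rewrite ltr0n Np.
have tX : t <= X by apply/ltW; have /andP[] := inX (introT andP (conj t0 tT)).
rewrite !RLintE//; [|exact: wcont_measurable wu tX|exact: wcont_measurable wv tX].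
congr (_ * _); apply: eq_Rintegral => s; rewrite inE/= in_itv/= => /andP[s0 st].
by rewrite vu// s0 (lt_le_trans st).
Qed.

End Problem.

Theorem corollary3 (R : realType) (T : R) (m : nat) (alpha : nat -> R)
    (n : nat -> nat) (gamma : R) (a : nat -> R -> R) (j0 : nat) (b : nat -> R)
    (T_gt0 : 0 < T) (m_ge1 : (1 <= m)%N)
    (alpha_decr : forall i, (i < m)%N -> alpha i.+1 < alpha i)
    (alpha_m_ge0 : 0 <= alpha m)
    (n_def : forall i, (i <= m)%N -> (n i)%:R - 1 < alpha i <= (n i)%:R)
    (gamma_def : gamma = (n 0%N)%:R - alpha 0%N)
    (gamma_bnd : 0 < gamma < 1)
    (n0_eq_n1 : n 0%N = n 1%N)
    (a_C1 : forall i, (1 <= i <= m)%N -> Cn_space 1 gamma T (a i))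
    (a_RL : forall i, (1 <= i <= m)%N ->
       C_space 0 T (RLderiv T ((n 0%N)%:R - alpha 0%N) (a i)))
    (n0_ge2 : (2 <= n 0%N)%N)
    (j0_bnd : (j0 <= n 0%N - 2)%N)
    (H_j0 : Hset m alpha j0 = [::])
    (H_j0S : Hset m alpha j0.+1 <> [::]) :
  (forall (j : nat) (t : R), (j0 < j < n 0%N)%N -> 0 <= t <= T ->
     cvgn (series (sol_term m alpha a j t))) /\
  canonical_system T m alpha a (n 0%N) gamma (sol m alpha a j0) /\
  exists y : R -> R,
    [/\ Cn_space (n 0%N) gamma T y,
        solves_eq T m alpha a y /\ init_cond T (n 0%N) b y,
        forall z : R -> R, Cn_space (n 0%N) gamma T z ->
          solves_eq T m alpha a z -> init_cond T (n 0%N) b z ->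
          forall t : R, 0 <= t <= T -> z t = y t &
        forall t : R, 0 <= t <= T ->
          y t = \sum_(0 <= j < n 0%N) b j * sol m alpha a j0 j t].
Proof.
have /andP[g0 g1] := gamma_bnd; have TX : 0 < T < T + 1 by rewrite T_gt0 ltrDl ltr01.
have n0_gt0 : (0 < n 0%N)%N by exact: leq_trans n0_ge2.
have [p Np] : exists p, n 0%N = p.+1 by exists (n 0%N).-1; rewrite prednK.
(* The coefficients are extended beyond [T], so that [T] becomes an interior point. *)
have /choice[Ad hAd] : forall i, exists q : (R -> R) * (R -> R), (1 <= i < m.+1)%N ->
    [/\ wdiff (T + 1) gamma q.1 q.2, forall t, 0 <= t <= T -> q.1 t = a i t & cvg_at0 q.1].
  move=> i; case im : (1 <= i < m.+1)%N; last by exists (a i, a i).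
  have im' : (1 <= i <= m)%N by rewrite -ltnS.
  have [a' [d h]] := Cn1_wdiff g0 g1 TX (a_C1 i im').
  by exists (a', d).
pose A i := (Ad i).1; pose d i := (Ad i).2.
have wA i (im : (1 <= i < m.+1)%N) : wdiff (T + 1) gamma (A i) (d i) by have [] := hAd i im.
have AE i (im : (1 <= i < m.+1)%N) : forall t, 0 <= t <= T -> A i t = a i t by have [] := hAd i im.
have A0 i (im : (1 <= i < m.+1)%N) : cvg_at0 (A i) by have [] := hAd i im.
have H0 k : (k <= j0)%N -> Hset m alpha k = [::].
  move=> kj; apply: contrapT => Hk; exact: (Hset_neq_nil kj Hk).
have H1 k : (j0 < k)%N -> Hset m alpha k <> [::] by move=> jk; exact: (Hset_neq_nil jk).
have /choice[u hu] := neumann_series g0 g1 TX m_ge1 alpha_decr n_def wA.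
have wu j : wcont (T + 1) gamma (u j) by have [] := hu j.
have uE j := let: And3 _ h _ := hu j in h.
have ul j : cvg_at0 (fun t => t `^ gamma * u j t).
  exact: (fixpoint_cvg_at0 g0 g1 TX m_ge1 alpha_decr n_def wA A0 (wu j) (uE j)).
have ueq j : (j < n 0%N)%N -> ueqn gamma m alpha n A (T + 1) (fun k => (k == j)%:R) (u j).
  move=> jN.
  exact: (fixpoint_ueqn g0 g1 TX m_ge1 alpha_decr n_def wA jN (wu j) (uE j)).
have inT Y c v : T <= Y -> ueqn gamma m alpha n A Y c v -> ueqn gamma m alpha n A T c v.
  by move=> TY h t /andP[t0 tT]; apply: h; rewrite t0 (lt_le_trans tT).
have TT1 : T <= T + 1 by rewrite lerDl.
have solE j : (j < n 0%N)%N -> forall t, 0 <= t <= T ->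
    sol m alpha a j0 j t = taylor (fun k => (k == j)%:R) (u j) (n 0%N) t.
  move=> jN t tT; have [_ _ [C C0 hC]] := hu j.
  exact: (sol_taylor g0 g1 TX m_ge1 alpha_decr alpha_m_ge0 n_def gamma_def wA AE jN H0 H1
    (wu j) (uE j) C0 hC tT).
have tC c v (l : R) : wcont (T + 1) gamma v -> t `^ gamma * v t @[t --> 0^'+] --> l ->
    Cn_space (n 0%N) gamma T (taylor c v (n 0%N)).
  by rewrite Np; exact: taylor_Cn_space.
have tI c v : wcont (T + 1) gamma v -> init_cond T (n 0%N) c (taylor c v (n 0%N)).
  by rewrite Np; exact: taylor_init_cond.
have tS c v : wcont (T + 1) gamma v -> ueqn gamma m alpha n A T c v ->
    solves_eq T m alpha a (taylor c v (n 0%N)).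
  move=> wv; exact: (ueqn_solves g0 g1 TX alpha_decr alpha_m_ge0 n_def gamma_def AE c wv).1.
split; [|split].
- move=> j t /andP[jj0 jN] tT; have [_ _ [C C0 hC]] := hu j.
  have hm G := hmin_sum m_ge1 alpha_decr alpha_m_ge0 n_def G (H1 j jj0).
  apply/cvg_ex; exists (RLint (n 0%N)%:R (u j) t).
  exact: (sol_term_cvg g0 g1 TX m_ge1 alpha_decr alpha_m_ge0 n_def gamma_def wA AE n0_gt0 hm
    (wu j) C0 hC tT).
- move=> j jN; have E t : 0 <= t <= T -> taylor (fun k => (k == j)%:R) (u j) (n 0%N) t =
      sol m alpha a j0 j t by move=> tT; rewrite solE.
  split.
  + have [l hl] := ul j; have := tC _ _ _ (wu j) hl; rewrite Np => h.
    by rewrite Np in E; exact: Cn_space_ext T_gt0 E (h _).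
  + by apply: solves_eq_ext T_gt0 E _; apply: tS => //; exact: inT (ueq j jN).
  + by apply: init_cond_ext T_gt0 E _; exact: tI.
pose U t := \sum_(0 <= j < n 0%N) b j * u j t.
have wU : wcont (T + 1) gamma U by apply: wcont_sum => j _; exact: wcontZ.
have hU : ueqn gamma m alpha n A (T + 1) b U.
  exact: (ueqn_sum g0 g1 m_ge1 alpha_decr b wu ueq).
have [l Ul] : cvg_at0 (fun t => t `^ gamma * U t).
  apply: (@cvg_at0_eq _ T (fun t => \sum_(0 <= j < n 0%N) b j * (t `^ gamma * u j t))) => //.
    by move=> t _; rewrite /U big_distrr/=; apply: eq_bigr => j _; ring.
  by apply: cvg_at0_sum => j _ _; exact: cvg_at0Z.
exists (taylor b U (n 0%N)); split.
- exact: tC wU Ul.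
- by split; [apply: tS => //; exact: inT hU|exact: tI].
- move=> z; exact: (solution_unique g0 g1 TX m_ge1 alpha_decr alpha_m_ge0 n_def gamma_def wA AE Np wU hU).
- move=> t tT; rewrite /U (taylor_sum g1 TX b n0_gt0 wu tT).
  by apply: eq_big_nat => j /andP[_ jN]; rewrite solE.
Qed.
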